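(* Let $\Omega\subset\mathbb{R}^2$ be one of the domains $\Omega_{l,s}$ described in the context (for $l$ large and $s$ near $0$). Then there exists a continuous, compactly supported stationary weak solution $(v,p)$ of the incompressible Euler equations on $\mathbb{R}^2$ such that $\operatorname{supp} v=\overline{\Omega}$. Furthermore, $(v,p)$ is analytic in $\Omega$.
   Context: Polar coordinates $(r,\theta)\in\mathbb{R}^+\times\mathbb{T}$, $\mathbb{T}=\mathbb{R}/2\pi\mathbb{Z}$. For every sufficiently large integer $l$ and all $s$ in a small neighborhood of $0$ there are $a_l\in(0,1)$ and analytic functions $b_{l,s},B_{l,s}$ on $\mathbb{T}$ of the form $b_{l,s}(\theta)=\alpha_l\cos l\theta+o(1)$, $B_{l,s}(\theta)=\beta_l\cos l\theta+o(1)$ ($\alpha_l,\beta_l\neq0$, $o(1)\to0$ as $s\to0$) such that the doubly connected bounded domain $\Omega_{l,s}=\{a_l+s b_{l,s}(\theta)<r<1+sB_{l,s}(\theta)\}$ carries a non-radial function $u$ with $\Delta u+\mu u=0$ in $\Omega_{l,s}$ for some $\mu\in\mathbb{R}$ and $\nabla u\equiv0$ on $\partial\Omega_{l,s}$. A pair $(v,p)\in L^2_{\mathrm{loc}}(\mathbb{R}^2,\mathbb{R}^2)\times L^1_{\mathrm{loc}}(\mathbb{R}^2)$ is a stationary weak solution of the incompressible Euler equations on $\mathbb{R}^2$ if $\int_{\mathbb{R}^2} v\cdot \nabla\phi\, dx=0$ and $\int_{\mathbb{R}^2} (v_i\,v_j\, \partial_i w_j+ p\,\mathrm{div}\, w)\,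 dx=0$ (summation over repeated indices) for all $\phi\in C^\infty_c(\mathbb{R}^2)$ and all $w\in C^\infty_c(\mathbb{R}^2,\mathbb{R}^2)$. *)

(* Defs.v *)
From HB Require Import structures.
From mathcomp Require Import all_boot all_order all_algebra.
From mathcomp Require Import all_classical all_reals all_analysis.
Set Implicit Arguments. Unset Strict Implicit. Unset Printing Implicit Defensive.
Import Order.TTheory GRing.Theory Num.Theory.
Import numFieldNormedType.Exports.
Local Open Scope classical_set_scope.
Local Open Scope ring_scope.

Section Defs.
Variable R : realType.
Notation P2 := (R * R)%type.

Definition e1 : P2 := (1, 0).
Definition e2 : P2 := (0, 1).

Fixpoint iterD (ds : seq P2) (f : P2 -> R) : P2 -> R :=
  match ds with
  | [::] => f
  | d :: ds' => fun x => derive (iterD ds' f) x d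
  end.

Definition Ck_on (k : nat) (A : set P2) (f : P2 -> R) : Prop :=
  forall ds : seq P2, (size ds <= k)%N ->
    (forall x, A x -> {for x, continuous (iterD ds f)}) /\
    ((size ds < k)%N -> forall x v, A x -> derivable (iterD ds f) x v).

Definition smooth (f : P2 -> R) : Prop := forall k, Ck_on k setT f.

Definition supp (f : P2 -> R) : set P2 := closure [set x | f x != 0].
Definition supp2 (f g : P2 -> R) : set P2 := closure [set x | (f x, g x) != 0].

Definition compactly_supported (f : P2 -> R) : Prop := compact (supp f).

Definition test_fun (f : P2 -> R) : Prop := smooth f /\ compactly_supported f.

Definition leb2 := (@lebesgue_measure R \x @lebesgue_measure R)%E.

Definition L1loc (f : P2 -> R) : Prop :=
  measurable_fun setT f /\
  forall K : set P2, compact K ->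
    (\int[leb2]_(x in K) (`|f x|)%:E < +oo)%E.

Definition L2loc (f : P2 -> R) : Prop :=
  measurable_fun setT f /\
  forall K : set P2, compact K ->
    (\int[leb2]_(x in K) (f x ^+ 2)%:E < +oo)%E.

Definition stationary_weak_euler (v1 v2 p : P2 -> R) : Prop :=
  [/\ L2loc v1, L2loc v2, L1loc p,
      (forall phi, test_fun phi ->
         (\int[leb2]_x (v1 x * derive phi x e1 + v2 x * derive phi x e2)%:E
            = 0)%E) &
      (forall w1 w2, test_fun w1 -> test_fun w2 ->
         (\int[leb2]_x
            (  v1 x * v1 x * derive w1 x e1 + v1 x * v2 x * derive w2 x e1
             + v2 x * v1 x * derive w1 x e2 + v2 x * v2 x * derive w2 x e2
             + p x * (derive w1 x e1 + derive w2 x e2))%:E = 0)%E)].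

Definition analytic2_on (A : set P2) (f : P2 -> R) : Prop :=
  forall x0, A x0 -> exists r : R, 0 < r /\ exists c : nat -> nat -> R,
    forall x : P2, `|x.1 - x0.1| < r -> `|x.2 - x0.2| < r ->
      cvg ((fun N : nat => \sum_(i < N) \sum_(j < N)
              `|c i j| * `|x.1 - x0.1| ^+ i * `|x.2 - x0.2| ^+ j) @ \oo) /\
      ((fun N : nat => \sum_(i < N) \sum_(j < N)
              c i j * (x.1 - x0.1) ^+ i * (x.2 - x0.2) ^+ j) @ \oo --> f x).

Definition analytic_on_T (b : R -> R) : Prop :=
  (forall t, b (t + 2 * pi) = b t) /\
  forall t0, exists r : R, 0 < r /\ exists c : nat -> R,
    forall t, `|t - t0| < r ->
      (fun N : nat => \sum_(k < N) c k * (t - t0) ^+ k) @ \oo --> b t.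

Definition polar_domain (a s : R) (b B : R -> R) : set P2 :=
  [set x | exists r th : R, x = (r * cos th, r * sin th) /\ 0 < r /\
           a + s * b th < r /\ r < 1 + s * B th].

Definition radial_on (A : set P2) (u : P2 -> R) : Prop :=
  exists g : R -> R, forall x, A x -> u x = g (Num.sqrt (x.1 ^+ 2 + x.2 ^+ 2)).

(* the overdetermined problem of the context: u is C^2 in Omega, continuous up
   to the boundary, Delta u + mu u = 0 in Omega, and grad u extends continuously
   to the closure with value 0 on the boundary (i.e. grad u = 0 on dOmega) *)
Definition overdetermined_sol (Om : set P2) (mu : R) (u : P2 -> R) : Prop :=
  [/\ Ck_on 2 Om u,
      {within closure Om, continuous u},
      (forall x, Om x ->
         derive (fun y => derive u y e1) x e1
       + derive (fun y => derive u y e2) x e2 + mu * u x = 0) &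
      (forall z, closure Om z -> ~ Om z ->
         (derive u x e1 @[x --> within Om (nbhs z)] --> 0) /\
         (derive u x e2 @[x --> within Om (nbhs z)] --> 0))].

End Defs.

(* Main.v *)
Require Import Defs.
From HB Require Import structures.
From mathcomp Require Import all_boot all_order all_algebra.
From mathcomp Require Import all_classical all_reals all_analysis.
From mathcomp Require Import measurable_realfun ring lra.
Set Implicit Arguments. Unset Strict Implicit. Unset Printing Implicit Defensive.
Import Order.TTheory GRing.Theory Num.Theory.
Import numFieldNormedType.Exports.
Local Open Scope classical_set_scope.
Local Open Scope ring_scope.

(* Put v = (u_y, - u_x) in the annular domain and v = 0 outside. Since the gradient of u vanishes on
   the boundary, v is continuous, and u is constant on each of the two boundary curves. By the
   equation for u, the field v and the pressure p = - |grad u|^2 / 2 - mu (u^2 - c^2) / 2 satisfy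
   div v = 0 and div (v (x) v + p I) = 0 in the domain; with c the outer boundary value of u, the
   pressure extends continuously by a constant to the hole and by 0 to the exterior. A continuous
   field which is divergence free off a curve of finite length and vanishes on the curve is
   weakly divergence free, because cutting out an e-neighbourhood of the curve costs O(1/e) in the
   gradient of the cutoff on an area O(e). On the inner curve, where the momentum flux is a
   constant vector, that constant times a bump function is first subtracted.
   Analyticity comes from the mean value formula for the Helmholtz equation: it bounds the
   derivatives of u of order n by M K^n n!, and such bounds are stable under products. By unique
   continuation v cannot vanish on an open subset of the domain: u would be constant on the
   domain, hence radial. *)

(** * Calculus in two variables *)

Section Calculus.
Variable R : realType.
Notation P2 := (R * R)%type.
Notation e1 := (e1 R).
Notation e2 := (e2 R).

(** The equation is assumed only in the classical sense, for a function of class C^2, so smoothness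
    inside the domain has to be earned. The device is an exact formula: r times the integral of
    [cos t * u] over the circle of radius r about x equals the first partial derivative of [u] at x
    times a number c(r) depending on mu and r alone. Solved for the derivative, it writes it as a
    circle mean of [u], hence again as a C^2 solution, which starts the induction on the order; read
    as an estimate, it yields Cauchy bounds. The number c(r) is a Bessel function in disguise; it is
    obtained by evaluating the formula on an explicit solution of one variable. At the boundary only
    the continuity of [u] and of its gradient is known. Second derivatives may blow up there, so the
    divergence theorem cannot be applied up to the boundary: hence cutoffs built from small squares,
    and the constancy of [u] on a boundary curve obtained as a limit from curves inside. The shape
    of the boundary enters through bounds on the radii and their derivatives. *)

Lemma is_derive_e1P (f : P2 -> R) x d :
  is_derive x e1 f d <-> is_derive x.1 (1 : R) (fun t => f (t, x.2)) d.
Proof.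
have E : (fun h : R => h^-1 *: ((f \o shift x) (h *: e1) - f x)) =
  (fun h : R => h^-1 *: (((fun t => f (t, x.2)) \o shift x.1) (h *: (1 : R)) - f (x.1, x.2))).
  apply/funext => h /=; rewrite /shift /=; congr (_ *: (f _ - f _)); last by case: x.
  by rewrite /Defs.e1; case: x => a b /=; rewrite [LHS]surjective_pairing /= scaler0 add0r.
split; case => D1 D2.
- split; first by rewrite /derivable -E.
  by rewrite -D2 /derive E.
- split; first by rewrite /derivable E.
  by rewrite -D2 /derive E.
Qed.

Lemma is_derive_e2P (f : P2 -> R) x d :
  is_derive x e2 f d <-> is_derive x.2 (1 : R) (fun t => f (x.1, t)) d.
Proof.
have E : (fun h : R => h^-1 *: ((f \o shift x) (h *: e2) - f x)) =
  (fun h : R => h^-1 *: (((fun t => f (x.1, t)) \o shift x.2) (h *: (1 : R)) - f (x.1, x.2))).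
  apply/funext => h /=; rewrite /shift /=; congr (_ *: (f _ - f _)); last by case: x.
  by rewrite /Defs.e2; case: x => a b /=; rewrite [LHS]surjective_pairing /= scaler0 add0r.
split; case => D1 D2.
- split; first by rewrite /derivable -E.
  by rewrite -D2 /derive E.
- split; first by rewrite /derivable E.
  by rewrite -D2 /derive E.
Qed.

(** Only the partial derivatives and their continuity at points of [A], in the full topology of the
    plane, are recorded. For open [A] differentiability follows, see [C1_diff]. *)
Definition C1 (A : set P2) (f : P2 -> R) := forall x, A x ->
  [/\ derivable f x e1, derivable f x e2,
      {for x, continuous (derive f ^~ e1)} & {for x, continuous (derive f ^~ e2)}].

Definition box (x : P2) (r : R) : set P2 := [set y | `|y.1 - x.1| < r /\ `|y.2 - x.2| < r].

(** The product carries the maximum norm, so its balls are open squares, in which the coordinates of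
    a point can be changed one at a time. *)
Lemma ball_box (x : P2) r : ball x r = box x r.
Proof.
apply/funext => y; rewrite -[ball x r y]/(ball x.1 r y.1 /\ ball x.2 r y.2).
by rewrite -!ball_normE /ball_ /box /= (distrC x.1) (distrC x.2).
Qed.

Lemma box_open x r : open (box x r).
Proof. by rewrite -ball_box; exact: ball_open. Qed.

Lemma nbhs_boxP (x : P2) (A : set P2) : nbhs x A <-> exists r : R, 0 < r /\ box x r `<=` A.
Proof.
split.
  by move=> /nbhs_ballP[r /= r0 rA]; exists r; split=> //; rewrite -ball_box.
by move=> [r [r0 rA]]; apply/nbhs_ballP; exists r => //=; rewrite ball_box.
Qed.

Lemma box_sub (x y : P2) r s : box x r y -> 0 <= r -> 
  (forall z, box y (s - r) z -> box x s z).
Proof.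
move=> [h1 h2] r0 z [k1 k2]; split.
  by rewrite (le_lt_trans (ler_distD y.1 _ _))// -(subrK r s) ltrD.
by rewrite (le_lt_trans (ler_distD y.2 _ _))// -(subrK r s) ltrD.
Qed.

Lemma between_box (a b c d r : R) : `|a - c| < r -> `|b - c| < r -> 
  a <= d <= b -> `|d - c| < r.
Proof. by rewrite !ltr_norml => /andP[? ?] /andP[? ?] /andP[? ?]; apply/andP; split; lra. Qed.

(** The form with [Num.min] and [Num.max] is there because the increments below have either sign. *)
Lemma mvt_abs (f df : R -> R) (a b : R) :
  (forall x, Num.min a b <= x <= Num.max a b -> is_derive x 1 f (df x)) ->
  exists2 c, Num.min a b <= c <= Num.max a b & f b - f a = df c * (b - a).
Proof.
wlog ab : a b / a <= b.
  move=> H; case/orP: (le_total a b) => [/H//|ba].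
  rewrite minC maxC => /(H _ _ ba)[c ce e]; exists c => //.
  by rewrite -[LHS]opprB e -mulrN opprB.
rewrite min_l// max_r// => D.
have [|x|c] := @MVT_segment R f df a b ab.
- by move=> x; rewrite in_itv/= => /andP[? ?]; apply: D; rewrite !ltW.
- by apply: derivable_within_continuous => y; rewrite in_itv/= => /D[].
- by rewrite in_itv/= => cab ->; exists c.
Qed.

Lemma minmax_box (a b c r : R) y : `|a - c| < r -> `|b - c| < r ->
  Num.min a b <= y <= Num.max a b -> `|y - c| < r.
Proof.
by move=> ha hb; case: (leP a b) => _ hy; [exact: between_box ha hb hy|exact: between_box hb ha hy].
Qed.

(** Join [x] to [y] by a vertical and a horizontal segment and use the mean value theorem on each:
    both intermediate points stay in the square where the partial derivatives are within [e] of
    their values at [x]. *)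
Lemma C1_increment (A : set P2) (f : P2 -> R) (x : P2) : open A -> C1 A f -> A x ->
  forall e : R, 0 < e -> \forall y \near x,
   `|f y - f x - ((y.1 - x.1) * 'D_e1 f x + (y.2 - x.2) * 'D_e2 f x)|
    <= e * (`|y.1 - x.1| + `|y.2 - x.2|).
Proof.
move=> oA fC Ax e e0.
have [_ _ c1 c2] := fC _ Ax.
have : nbhs x (A `&` [set y | `|'D_e1 f x - 'D_e1 f y| < e] `&` [set y | `|'D_e2 f x - 'D_e2 f y| < e]).
  apply: filterI; last by move/cvgrPdist_lt : c2; exact.
  apply: filterI; last by move/cvgrPdist_lt : c1; exact.
  exact: open_nbhs_nbhs.
move=> /nbhs_boxP[r [r0 rA]].
apply/nbhs_boxP; exists r; split=> // y [y1 y2] /=.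
have xx : forall a : R, `|a - a| < r by move=> a; rewrite subrr normr0.
have [t ht|c hc ec] := @mvt_abs (fun t => f (t, y.2)) (fun t => 'D_e1 f (t, y.2)) x.1 y.1.
  have [[At _] _] := rA (t, y.2) (conj (minmax_box (xx _) y1 ht) y2).
  by apply/(is_derive_e1P f (t, y.2)); have [/derivableP] := fC _ At.
have [t ht|d hd ed] := @mvt_abs (fun t => f (x.1, t)) (fun t => 'D_e2 f (x.1, t)) x.2 y.2.
  have [[At _] _] := rA (x.1, t) (conj (xx _) (minmax_box (xx _) y2 ht)).
  by apply/(is_derive_e2P f (x.1, t)); have [_ /derivableP] := fC _ At.
have [[_ b1] _] := rA (c, y.2) (conj (minmax_box (xx _) y1 hc) y2).
have [[_ _] b2] := rA (x.1, d) (conj (xx _) (minmax_box (xx _) y2 hd)).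
have -> : f y - f x - ((y.1 - x.1) * 'D_e1 f x + (y.2 - x.2) * 'D_e2 f x) =
  ('D_e1 f (c, y.2) - 'D_e1 f x) * (y.1 - x.1) + ('D_e2 f (x.1, d) - 'D_e2 f x) * (y.2 - x.2).
  have -> : f y - f x = (f (y.1, y.2) - f (x.1, y.2)) + (f (x.1, y.2) - f (x.1, x.2)).
    by rewrite subrKA; case: (x) (y) => [? ?] [].
  rewrite ec ed; ring.
rewrite (le_trans (ler_normD _ _))// !normrM mulrDr lerD// ler_wpM2r// distrC ltW//.
Qed.

Lemma C1_diff (A : set P2) (f : P2 -> R) (x : P2) : open A -> C1 A f -> A x ->
  is_diff x f (fun h => h.1 * 'D_e1 f x + h.2 * 'D_e2 f x).
Proof.
move=> oA fC Ax.
pose L := fun h : P2 => h.1 * 'D_e1 f x + h.2 * 'D_e2 f x.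
have Ll : linear (L : P2 -> R^o).
  by move=> k u v; rewrite /L /= /GRing.scale /=; ring.
pose Lm := GRing.isLinear.Build _ _ _ _ L Ll.
pose LL : {linear P2 -> R^o} := HB.pack L Lm.
have Lc : continuous LL.
  move=> y; apply: cvgD; apply: cvgM; try exact: cvg_cst.
    exact: cvg_fst.
  exact: cvg_snd.
have fE : f \o shift x = cst (f x) + LL +o_ (nbhs (0 : P2)) id.
  apply/eqaddoP => _/posnumP[e].
  (* Half of the tolerance, since the sum of the two coordinates is at most twice the maximum
     norm. *)
  have := C1_increment oA fC Ax (e := e%:num / 2).
  rewrite divr_gt0// => /(_ isT) /nbhs_boxP[r [r0 rH]].
  apply/nbhs_boxP; exists r; split => // h [/=]; rewrite !subr0 => h1 h2.
  have /rH /= : box x r (h + x) by split; rewrite /= addrK.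
  rewrite !addrK => hh.
  have -> : ((f \o shift x - (cst (f x) + LL)) h) =
     f (h + x) - f x - (h.1 * 'D_e1 f x + h.2 * 'D_e2 f x).
    by rewrite opprD addrA.
  rewrite (le_trans hh)// -mulrA ler_wpM2l// ler_pdivrMl// mulr_natl mulr2n lerD//.
    by rewrite prod_normE le_max lexx.
  by rewrite prod_normE le_max lexx orbT.
have dE := diff_unique Lc fE.
apply: DiffDef; last exact: dE.
by apply/diff_locallyP; rewrite dE.
Qed.

Lemma C1_chain (A : set P2) (f : P2 -> R) (c1 c2 : R -> R) (t d1 d2 : R) :
  open A -> C1 A f -> A (c1 t, c2 t) ->
  is_derive t 1 c1 d1 -> is_derive t 1 c2 d2 ->
  is_derive t 1 (fun t => f (c1 t, c2 t))
    (d1 * 'D_e1 f (c1 t, c2 t) + d2 * 'D_e2 f (c1 t, c2 t)).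
Proof.
move=> oA fC Ac [dc1 <-] [dc2 <-].
have Df := C1_diff oA fC Ac.
have D1 := differentiableP ((derivable1_diffP c1 t).1 dc1).
have D2 := differentiableP ((derivable1_diffP c2 t).1 dc2).
have D12 : is_diff t (fun t => (c1 t, c2 t)) (fun h => ('d c1 t h, 'd c2 t h)).
  exact: is_diff_pair.
have H := is_diff_comp D12 Df.
have dd : differentiable (f \o (fun t => (c1 t, c2 t))) t by case: H.
split; first exact/derivable1_diffP.
rewrite [LHS]deriveE //; case: H => _ -> /=.
by rewrite !deriveE //; exact/derivable1_diffP.
Qed.

End Calculus.

Local Opaque Defs.e1 Defs.e2 derive.

Section Calculus.
Variable R : realType.
Notation P2 := (R * R)%type.
Notation e1 := (e1 R).
Notation e2 := (e2 R).

Lemma C1_continuous (A : set P2) (f : P2 -> R) (x : P2) : open A -> C1 A f -> A x ->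
  {for x, continuous f}.
Proof.
move=> oA fC Ax; apply: differentiable_continuous.
by have [] := C1_diff oA fC Ax.
Qed.

Lemma C1_sub (A B : set P2) f : B `<=` A -> C1 A f -> C1 B f.
Proof. by move=> BA fC x /BA /fC. Qed.

Definition C2 (A : set P2) (f : P2 -> R) :=
  [/\ C1 A f, C1 A (derive f ^~ e1) & C1 A (derive f ^~ e2)].

Lemma dist_halves (p q s e : R) : `|p - s| < e / 2 -> `|q - s| < e / 2 -> `|p - q| <= e.
Proof.
move=> ps qs; apply: le_trans (ler_distD s p q) _.
by rewrite (splitr e) lerD ?ltW// distrC.
Qed.

(* second difference quotient on a small square: applying the mean value theorem in either
   order exhibits it as a value of either mixed derivative *)
Lemma clairaut (A : set P2) (f : P2 -> R) (x : P2) : open A -> C2 A f -> A x ->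
  'D_e1 ('D_e2 f) x = 'D_e2 ('D_e1 f) x.
Proof.
move=> oA [fC f1 f2] Ax; apply/eqP; rewrite -subr_eq0 -normr_le0; apply/ler_addgt0Pl => e e0.
rewrite addr0.
have [_ _ _ c12] := f1 _ Ax.
have [_ _ c21 _] := f2 _ Ax.
have : nbhs x (A `&` [set y | `|'D_e1 ('D_e2 f) x - 'D_e1 ('D_e2 f) y| < e / 2]
   `&` [set y | `|'D_e2 ('D_e1 f) x - 'D_e2 ('D_e1 f) y| < e / 2]).
  apply: filterI; last by move/cvgrPdist_lt : c12; apply; rewrite divr_gt0.
  apply: filterI; last by move/cvgrPdist_lt : c21; apply; rewrite divr_gt0.
  exact: open_nbhs_nbhs.
move=> /nbhs_boxP[r [r0 rA]].
pose h := r / 2.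
have h0 : 0 < h by rewrite divr_gt0.
have hr : h < r by rewrite /h; lra.
clearbody h.
have bx (a b : R) : x.1 <= a <= x.1 + h -> x.2 <= b <= x.2 + h -> box x r (a, b).
  by move=> /andP[? ?] /andP[? ?]; split => /=; rewrite ger0_norm; lra.
have bA (a b : R) : x.1 <= a <= x.1 + h -> x.2 <= b <= x.2 + h -> A (a, b).
  by move=> ha hb; have [[]] := rA _ (bx _ _ ha hb).
have m1 : Num.min x.1 (x.1 + h) = x.1 by rewrite min_l// lerDl ltW.
have M1 : Num.max x.1 (x.1 + h) = x.1 + h by rewrite max_r// lerDl ltW.
have m2 : Num.min x.2 (x.2 + h) = x.2 by rewrite min_l// lerDl ltW.
have M2 : Num.max x.2 (x.2 + h) = x.2 + h by rewrite max_r// lerDl ltW.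
have x1 : x.1 <= x.1 <= x.1 + h by rewrite lexx lerDl ltW.
have x2 : x.2 <= x.2 <= x.2 + h by rewrite lexx lerDl ltW.
have x1h : x.1 <= x.1 + h <= x.1 + h by rewrite lexx lerDl ltW.
have x2h : x.2 <= x.2 + h <= x.2 + h by rewrite lexx lerDl ltW.
have ah (a : R) : a + h - a = h by rewrite addrAC subrr add0r.
have [Q QE] : exists Q, Q = (f (x.1 + h, x.2 + h) - f (x.1, x.2 + h)) - (f (x.1 + h, x.2) - f (x.1, x.2)).
  by eexists.
have [c [c' [cx cy eq1]]] : exists c c' : R, [/\ x.1 <= c <= x.1 + h, x.2 <= c' <= x.2 + h &
   Q = 'D_e2 ('D_e1 f) (c, c') * h * h].
  have [t|a] := @mvt_abs R (fun t => f (t, x.2 + h) - f (t, x.2))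
     (fun t => 'D_e1 f (t, x.2 + h) - 'D_e1 f (t, x.2)) x.1 (x.1 + h).
    rewrite m1 M1 => ht; apply: is_deriveB.
      apply/(is_derive_e1P f (t, x.2 + h)).
      by have [/derivableP] := fC _ (bA _ _ ht x2h).
    apply/(is_derive_e1P f (t, x.2)).
    by have [/derivableP] := fC _ (bA _ _ ht x2).
  rewrite m1 M1 => ha eqa.
  have [t|b] := @mvt_abs R (fun t => 'D_e1 f (a, t))
     (fun t => 'D_e2 ('D_e1 f) (a, t)) x.2 (x.2 + h).
    rewrite m2 M2 => ht.
    apply/(is_derive_e2P ('D_e1 f) (a, t)).
    by have [_ /derivableP] := f1 _ (bA _ _ ha ht).
  rewrite m2 M2 => hb eqb.
  exists a, b; split; [exact: ha|exact: hb|].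
  rewrite QE; have -> : forall p q r s : R, p - q - (r - s) = (p - r) - (q - s) by move=> *; ring.
  by rewrite eqa eqb (ah x.1) (ah x.2).
have [d [d' [dx dy eq2]]] : exists d d' : R, [/\ x.1 <= d <= x.1 + h, x.2 <= d' <= x.2 + h &
   Q = 'D_e1 ('D_e2 f) (d, d') * h * h].
  have [t|a] := @mvt_abs R (fun t => f (x.1 + h, t) - f (x.1, t))
     (fun t => 'D_e2 f (x.1 + h, t) - 'D_e2 f (x.1, t)) x.2 (x.2 + h).
    rewrite m2 M2 => ht; apply: is_deriveB.
      apply/(is_derive_e2P f (x.1 + h, t)).
      by have [_ /derivableP] := fC _ (bA _ _ x1h ht).
    apply/(is_derive_e2P f (x.1, t)).
    by have [_ /derivableP] := fC _ (bA _ _ x1 ht).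
  rewrite m2 M2 => ha eqa.
  have [t|b] := @mvt_abs R (fun t => 'D_e2 f (t, a))
     (fun t => 'D_e1 ('D_e2 f) (t, a)) x.1 (x.1 + h).
    rewrite m1 M1 => ht.
    apply/(is_derive_e1P ('D_e2 f) (t, a)).
    by have [/derivableP] := f2 _ (bA _ _ ht ha).
  rewrite m1 M1 => hb eqb.
  exists b, a; split; [exact: hb|exact: ha|].
  rewrite QE eqa eqb (ah x.1) (ah x.2); reflexivity.
have hh : h != 0 by rewrite gt_eqF.
have E : 'D_e2 ('D_e1 f) (c, c') = 'D_e1 ('D_e2 f) (d, d').
  by have := etrans (esym eq1) eq2; move=> /(mulIf hh)/(mulIf hh).
have [[_ a1] _] := rA _ (bx _ _ dx dy).
have [[_ _] a2] := rA _ (bx _ _ cx cy).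
apply: (dist_halves a1); rewrite -E; exact: a2.
Qed.

End Calculus.

(** * Circle integrals *)

Section Circle.
Variable R : realType.
Notation P2 := (R * R)%type.
Notation e1 := (e1 R).
Notation e2 := (e2 R).
Notation mu := (@lebesgue_measure R).

(** The partial derivatives are supplied as functions instead of being read off [derive], so that
    the gradients of sums, products, compositions and circle means are carried along as explicit
    formulas. *)
Definition has_grad (A : set P2) (f f1 f2 : P2 -> R) := forall x, A x ->
  [/\ is_derive x e1 f (f1 x), is_derive x e2 f (f2 x),
      {for x, continuous f1} & {for x, continuous f2}].

Section Pointwise.
Variables (V : normedModType R) (f g : V -> R) (x v : V) (d d' : R).

Lemma derC (k : R) : is_derive x v (fun=> k) 0.
Proof. exact: is_derive_cst. Qed.

Lemma derD : is_derive x v f d -> is_derive x v g d' -> is_derive x v (fun y => f y + g y) (d + d').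
Proof. by move=> h1 h2; exact: is_deriveD h1 h2. Qed.

Lemma derM : is_derive x v f d -> is_derive x v g d' ->
  is_derive x v (fun y => f y * g y) (d * g x + f x * d').
Proof.
move=> h1 h2; apply: (is_derive_eq (is_deriveM h1 h2)).
by rewrite /GRing.scale /= addrC mulrC.
Qed.

Lemma derZ (k : R) : is_derive x v f d -> is_derive x v (fun y => k * f y) (k * d).
Proof. by move=> h; exact: is_deriveZ k _ _ _ h. Qed.

Lemma derN : is_derive x v f d -> is_derive x v (fun y => - f y) (- d).
Proof. by move=> h; exact: is_deriveN h. Qed.

End Pointwise.

Lemma derAff (a b r : R) : is_derive r 1 (fun r => a + r * b) b.
Proof.
apply: (is_derive_eq (derD (derC r 1 a) (derM (is_derive_id r 1) (derC r 1 b)))).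
by rewrite /= mulr0 add0r addr0 mul1r.
Qed.

Lemma C1_grad A f : C1 A f -> has_grad A f ('D_e1 f) ('D_e2 f).
Proof.
move=> fC x /fC[d1 d2 c1 c2].
by split; [exact: derivableP d1|exact: derivableP d2|exact: c1|exact: c2].
Qed.

Lemma for_continuous_near (T : topologicalType) (f g : T -> R) x : (\forall y \near x, f y = g y) ->
  {for x, continuous f} -> {for x, continuous g}.
Proof.
move=> fg fc; rewrite /prop_for /continuous_at -(nbhs_singleton fg).
apply: cvg_trans fc; apply: near_eq_cvg; by apply: filterS fg => y ->.
Qed.

Lemma grad_D1 A f f1 f2 x : has_grad A f f1 f2 -> A x -> 'D_e1 f x = f1 x.
Proof. by move=> fg /fg[d1 _ _ _]; exact: derive_val. Qed.

Lemma grad_D2 A f f1 f2 x : has_grad A f f1 f2 -> A x -> 'D_e2 f x = f2 x.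
Proof. by move=> fg /fg[_ d2 _ _]; exact: derive_val. Qed.

Lemma grad_C1 A f f1 f2 : open A -> has_grad A f f1 f2 -> C1 A f.
Proof.
move=> oA fg x Ax; have [d1 d2 c1 c2] := fg _ Ax.
split.
- exact: ex_derive.
- exact: ex_derive.
- apply: for_continuous_near c1.
  by apply: filterS (open_nbhs_nbhs (conj oA Ax)) => y /(grad_D1 fg).
- apply: for_continuous_near c2.
  by apply: filterS (open_nbhs_nbhs (conj oA Ax)) => y /(grad_D2 fg).
Qed.

Lemma grad_cont A f f1 f2 x : open A -> has_grad A f f1 f2 -> A x -> {for x, continuous f}.
Proof. by move=> oA fg Ax; exact: (C1_continuous oA (grad_C1 oA fg) Ax). Qed.

Lemma grad_chain A f f1 f2 (c1 c2 : R -> R) (t d1 d2 : R) : open A -> has_grad A f f1 f2 ->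
  A (c1 t, c2 t) -> is_derive t 1 c1 d1 -> is_derive t 1 c2 d2 ->
  is_derive t 1 (fun t => f (c1 t, c2 t)) (d1 * f1 (c1 t, c2 t) + d2 * f2 (c1 t, c2 t)).
Proof.
move=> oA fg Ac dc1 dc2.
have := C1_chain oA (grad_C1 oA fg) Ac dc1 dc2.
by rewrite (grad_D1 fg Ac) (grad_D2 fg Ac).
Qed.

Lemma continuous_pair (T U V : topologicalType) (g : T -> U) (h : T -> V) x :
  {for x, continuous g} -> {for x, continuous h} -> {for x, continuous (fun t => (g t, h t))}.
Proof. by move=> gc hc; exact: (cvg_pair gc hc). Qed.

Lemma continuous_fst (T U V : topologicalType) (X : T -> U * V) x :
  {for x, continuous X} -> {for x, continuous (fun t => (X t).1)}.
Proof. by move=> cX; exact: (@cvg_comp _ _ _ X fst _ _ _ cX (@cvg_fst _ _ _ _ _)). Qed.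

Lemma continuous_snd (T U V : topologicalType) (X : T -> U * V) x :
  {for x, continuous X} -> {for x, continuous (fun t => (X t).2)}.
Proof. by move=> cX; exact: (@cvg_comp _ _ _ X snd _ _ _ cX (@cvg_snd _ _ _ _ _)). Qed.

Lemma continuous_at_comp (T U V : topologicalType) (g : T -> U) (F : U -> V) x :
  {for x, continuous g} -> {for g x, continuous F} -> {for x, continuous (fun t => F (g t))}.
Proof. exact: continuous_comp. Qed.

Lemma continuous_pair2 (T U V W : topologicalType) (g : T -> U) (h : T -> V) (F : U * V -> W) x :
  {for x, continuous g} -> {for x, continuous h} -> {for (g x, h x), continuous F} ->
  {for x, continuous (fun t => F (g t, h t))}.
Proof.
move=> gc hc Fc.
exact: (@cvg_comp _ _ _ (fun t => (g t, h t)) F _ _ _ (cvg_pair gc hc) Fc).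
Qed.

Definition circ (f : R -> R) : R := \int[mu]_(t in `[0, 2 * pi]) f t.

Let twopi_gt0 : 0 < 2 * pi :> R.
Proof. by rewrite mulr_gt0// pi_gt0. Qed.

Lemma circ_int (f : R -> R) : continuous f -> mu.-integrable `[0, 2 * pi] (EFin \o f).
Proof.
move=> fc; apply: continuous_compact_integrable; first exact: segment_compact.
by apply: continuous_subspaceT.
Qed.

Lemma circ_cst k : circ (fun=> k) = 2 * pi * k.
Proof.
rewrite /circ Rintegral_cst//= lebesgue_measure_itv/= lte_fin twopi_gt0 -EFinB /= subr0.
by rewrite mulrC.
Qed.

Lemma circD (f g : R -> R) : continuous f -> continuous g -> circ (fun t => f t + g t) = circ f + circ g.
Proof. by move=> fc gc; apply: RintegralD => //; exact: circ_int. Qed.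

Lemma circZ (k : R) (f : R -> R) : continuous f -> circ (fun t => k * f t) = k * circ f.
Proof. by move=> fc; apply: RintegralZl => //; exact: circ_int. Qed.

Lemma circ_ext (f g : R -> R) : f =1 g -> circ f = circ g.
Proof. by move=> fg; apply: eq_Rintegral => t _; exact: fg. Qed.

Lemma circ_le (f g : R -> R) : continuous f -> continuous g -> 
  (forall t, 0 <= t <= 2 * pi -> f t <= g t) -> circ f <= circ g.
Proof.
move=> fc gc fg; apply: le_Rintegral; [by []|exact: circ_int|exact: circ_int|].
by move=> t; rewrite /= in_itv /=; exact: fg.
Qed.

Let cc (k : R) : continuous (fun _ : R => k).
Proof. by move=> x; exact: cvg_cst. Qed.

Lemma circ_abs (f : R -> R) (M : R) : continuous f -> 
  (forall t, 0 <= t <= 2 * pi -> `|f t| <= M) -> `|circ f| <= 2 * pi * M.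
Proof.
move=> fc fM; rewrite -circ_cst ler_norml; apply/andP; split.
  rewrite -mulN1r -circZ//; apply: circ_le => // t /fM.
  by rewrite mulN1r; rewrite ler_norml => /andP[].
by apply: circ_le => // t /fM; rewrite ler_norml => /andP[].
Qed.

Lemma circ_derive (f f' : R -> R) : (forall t : R, is_derive t (1 : R) f (f' t)) -> continuous f' ->
  circ f' = f (2 * pi) - f 0.
Proof.
move=> df f'c; rewrite /circ /Rintegral (@continuous_FTC2 _ f' f)//.
- exact: continuous_subspaceT.
- have fc : continuous f.
    move=> t; apply: differentiable_continuous; apply/derivable1_diffP.
    exact: ex_derive.
  split.
  + by move=> t _; exact: ex_derive.
  + by apply: cvg_at_right_filter; exact: fc.
  + by apply: cvg_at_left_filter; exact: fc.
- by move=> t _; rewrite derive1E; exact: derive_val.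
Qed.

(** Joint continuity together with the compactness of the interval of angles makes the closeness
    uniform in the angle. *)
Lemma circ_near (T : topologicalType) (f : T -> R -> R) (x0 : T) :
  (forall t, {for (x0, t), continuous (fun z : T * R => f z.1 z.2)}) ->
  forall e : R, 0 < e -> \forall x \near x0, forall t, 0 <= t <= 2 * pi -> `|f x t - f x0 t| < e.
Proof.
move=> fc e e0.
have cov := (compact_near_coveringP _).1 (@segment_compact R 0 (2 * pi)).
have := cov T (nbhs x0) (fun x t => `|f x t - f x0 t| < e) (nbhs_filter x0).
suff h (t : R) : \forall t' \near t & x' \near x0, `|f x' t' - f x0 t'| < e.
  by move=> /(_ (fun t _ => h t)); apply: filterS => x Hx t tI; apply: Hx; rewrite /= in_itv.
have /cvgrPdist_lt /(_ (e / 2)) := fc t.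
rewrite divr_gt0// => /(_ isT) [[A B] /= [Ax Bt] AB].
exists (B, A) => //= -[a b] [/= Ba Ab].
apply: le_lt_trans (ler_distD (f x0 t) _ _) _; rewrite (splitr e) ltrD//.
  by rewrite distrC; exact: (AB (b, a)).
by apply: (AB (x0, a)); split => //=; exact: nbhs_singleton.
Qed.

Lemma circ_continuous (T : topologicalType) (f : T -> R -> R) (x0 : T) :
  (forall t, {for (x0, t), continuous (fun z : T * R => f z.1 z.2)}) ->
  (\forall x \near x0, continuous (f x)) ->
  {for x0, continuous (fun x => circ (f x))}.
Proof.
move=> fc fx; apply/cvgrPdist_le => e e0.
have e'0 : 0 < e / (2 * pi) by rewrite divr_gt0.
have fx0 := nbhs_singleton fx.
near=> x.
have fxc : continuous (f x) by near: x.
rewrite distrC -mulN1r -circZ// -circD//; last by move=> t; apply: cvgM; [exact: cvg_cst|exact: fx0].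
rewrite -(mulfVK (lt0r_neq0 twopi_gt0) e) mulrC.
apply: circ_abs.
  by move=> t; apply: cvgD; [exact: fxc|apply: cvgM; [exact: cvg_cst|exact: fx0]].
near: x; apply: filterS (circ_near fc e'0) => x h t /h /ltW.
by rewrite mulN1r.
Unshelve. all: by end_near. Qed.

(** Differentiation under the integral by domination: near [r0] the derivative stays within 1 of its
    value at [r0], uniformly in the angle, so [|f' r0 t| + 1] is an integrable bound. *)
Lemma circ_is_derive (f f' : R -> R -> R) (r0 d : R) : 0 < d ->
  (forall r, `|r - r0| < d -> continuous (f r)) ->
  (forall r t, `|r - r0| < d -> is_derive r (1 : R) (f ^~ t) (f' r t)) ->
  (forall t, {for (r0, t), continuous (fun z : R * R => f' z.1 z.2)}) ->
  is_derive r0 (1 : R) (fun r => circ (f r)) (circ (f' r0)).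
Proof.
move=> d0 fc df f'c.
have f'0c : continuous (f' r0).
  move=> t; apply: (@continuous_pair2 _ _ _ _ (fun=> r0) id (fun z : R * R => f' z.1 z.2)).
  - exact: cvg_cst.
  - exact: cvg_id.
  - exact: f'c.
have /nbhs_ballP[d1 /= d10 Hd1] := circ_near f'c ltr01.
pose dd := Num.min d d1.
have dd0 : 0 < dd by rewrite lt_min d0.
have inI r : r \in `]r0 - dd, r0 + dd[ -> `|r - r0| < d /\ `|r - r0| < d1.
  by rewrite in_itv /= -ltr_distl lt_min => /andP[].
have Ir0 : `]r0 - dd, r0 + dd[%classic r0 by rewrite /= in_itv /= ltrBlDr ltrDl dd0.
have intf r : `]r0 - dd, r0 + dd[%classic r -> mu.-integrable `[0, 2 * pi] (EFin \o f r).
  by move=> /inI[rd _]; apply: circ_int; exact: fc.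
have derf r t : `]r0 - dd, r0 + dd[%classic r -> `[0, 2 * pi]%classic t ->
    derivable (f ^~ t) r 1.
  by move=> /inI[rd _] _; have [] := df r t rd.
have G0 t : 0 <= `|f' r0 t| + 1 by rewrite addr_ge0.
have Gc : continuous (fun t => `|f' r0 t| + 1).
  by move=> t; apply: cvgD; [apply: cvg_norm; exact: f'0c|exact: cvg_cst].
have Gub r t : `]r0 - dd, r0 + dd[%classic r -> `[0, 2 * pi]%classic t ->
    `|partial1of2 f r t| <= `|f' r0 t| + 1.
  move=> /inI[rd rd1]; rewrite /= in_itv /= => tI.
  have [_ dE] := df r t rd; rewrite partial1of2E dE.
  have : `|f' r t - f' r0 t| < 1 by apply: Hd1 => //; rewrite -ball_normE /= distrC.
  move=> /ltW h; rewrite addrC -lerBlDr; apply: le_trans h.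
  exact: lerB_dist.
split; first exact: (derivable_under_integral _ Ir0 intf derf G0 (circ_int Gc) Gub).
rewrite -derive1E (differentiation_under_integral _ Ir0 intf derf G0 (circ_int Gc) Gub)//.
apply: circ_ext => t.
have r0d : `|r0 - r0| < d by rewrite subrr normr0.
by have [_ dE] := df r0 t r0d; rewrite partial1of2E dE.
Qed.

End Circle.

(** * Functions on circles: derivatives in the radius, the angle and the centre *)

Section Helmholtz.
Variable R : realType.
Notation P2 := (R * R)%type.
Notation e1 := (e1 R).
Notation e2 := (e2 R).

Definition pol (x : P2) (r t : R) : P2 := (x.1 + r * cos t, x.2 + r * sin t).

Lemma cos_sin_le1 (t : R) : `|cos t| <= 1 /\ `|sin t| <= 1.
Proof. by split; rewrite ler_norml ?cos_geN1 ?cos_le1 ?sin_geN1 ?sin_le1. Qed.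

Lemma pol_box x r t d : `|r| < d -> box x d (pol x r t).
Proof.
have [h1 h2] := cos_sin_le1 t.
move=> rd; split; rewrite /pol /= addrAC subrr add0r normrM.
  by rewrite (le_lt_trans _ rd)// ler_piMr.
by rewrite (le_lt_trans _ rd)// ler_piMr.
Qed.

Lemma is_derive_polx (x : P2) (r t : R) :
  is_derive r (1 : R) (fun r => x.1 + r * cos t) (cos t).
Proof. exact: derAff. Qed.

Lemma is_derive_poly (x : P2) (r t : R) :
  is_derive r (1 : R) (fun r => x.2 + r * sin t) (sin t).
Proof. exact: derAff. Qed.

Lemma is_derive_polxt (x : P2) (r t : R) :
  is_derive t (1 : R) (fun t => x.1 + r * cos t) (- (r * sin t)).
Proof.
apply: (is_derive_eq (derD (derC t 1 x.1) (derZ r (is_derive_cos t)))).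
by rewrite add0r mulrN.
Qed.

Lemma is_derive_polyt (x : P2) (r t : R) :
  is_derive t (1 : R) (fun t => x.2 + r * sin t) (r * cos t).
Proof.
apply: (is_derive_eq (derD (derC t 1 x.2) (derZ r (is_derive_sin t)))).
by rewrite add0r.
Qed.

Lemma pol_continuous (T : topologicalType) (X : T -> P2) (r t : T -> R) z :
  {for z, continuous X} -> {for z, continuous r} -> {for z, continuous t} ->
  {for z, continuous (fun z => pol (X z) (r z) (t z))}.
Proof.
move=> cX cr ct; apply: continuous_pair.
- apply: cvgD; first exact: continuous_fst cX.
  apply: cvgM => //; exact: (continuous_at_comp ct (@continuous_cos R (t z))).
- apply: cvgD; first exact: continuous_snd cX.
  apply: cvgM => //; exact: (continuous_at_comp ct (@continuous_sin R (t z))).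
Qed.

Lemma pol0 x t : pol x 0 t = x.
Proof. by rewrite /pol !mul0r !addr0; case: x. Qed.

Lemma pol_per x r : pol x r (2 * pi) = pol x r 0.
Proof.
by rewrite /pol (_ : 2 * pi = pi *+ 2 :> R) ?cos2pi ?sin2pi ?cos0 ?sin0// mulr_natl.
Qed.

Lemma circ_pol_cont (A : set P2) (f : P2 -> R) (m : R -> R) x r :
  (forall y, A y -> {for y, continuous f}) -> continuous m ->
  (forall t, A (pol x r t)) -> continuous (fun t => m t * f (pol x r t)).
Proof.
move=> fc mc Ap t; apply: cvgM; first exact: mc.
apply: (@continuous_at_comp _ _ _ (fun t => pol x r t) f).
  by apply: pol_continuous; [exact: cvg_cst|exact: cvg_cst|exact: cvg_id].
exact: fc.
Qed.

Lemma circ_pol_jcont (A : set P2) (f : P2 -> R) (m : R -> R) (T : topologicalType)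
   (X : T -> P2) (r : T -> R) z t :
  (forall y, A y -> {for y, continuous f}) -> continuous m ->
  {for z, continuous X} -> {for z, continuous r} -> A (pol (X z) (r z) t) ->
  {for (z, t), continuous (fun y : T * R => m y.2 * f (pol (X y.1) (r y.1) y.2))}.
Proof.
move=> fc mc cX cr Ap.
apply: (@cvgM _ _ _ _ (fun y : T * R => m y.2)).
  by apply: (@continuous_at_comp _ _ _ (fun y : T * R => y.2) m); [exact: cvg_snd|exact: mc].
apply: (@continuous_at_comp _ _ _ (fun y : T * R => pol (X y.1) (r y.1) y.2) f); last exact: (fc _ Ap).
apply: pol_continuous.
- by apply: (@continuous_at_comp _ _ _ (fun y : T * R => y.1) X); [exact: cvg_fst|].
- by apply: (@continuous_at_comp _ _ _ (fun y : T * R => y.1) r); [exact: cvg_fst|].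
- exact: cvg_snd.
Qed.

Section Radial.
Variables (A : set P2) (f f1 f2 : P2 -> R) (x : P2) (d : R).
Hypothesis (oA : open A) (fg : has_grad A f f1 f2) (xA : box x d `<=` A).

Let polA r t : `|r| < d -> A (pol x r t).
Proof. by move=> rd; apply: xA; exact: pol_box. Qed.

Let fc y : A y -> {for y, continuous f}. Proof. by move=> Ay; exact: (grad_cont oA fg Ay). Qed.
Let f1c y : A y -> {for y, continuous f1}.
Proof. by move=> Ay; case: (fg Ay). Qed.
Let f2c y : A y -> {for y, continuous f2}.
Proof. by move=> Ay; case: (fg Ay). Qed.

Lemma polr_derive (r t : R) : `|r| < d ->
  is_derive r (1 : R) (fun r => f (pol x r t)) (cos t * f1 (pol x r t) + sin t * f2 (pol x r t)).
Proof.
move=> rd; apply: (grad_chain (c1 := fun r => x.1 + r * cos t)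
  (c2 := fun r => x.2 + r * sin t) oA fg).
- exact: (@polA r t rd).
- exact: is_derive_polx.
- exact: is_derive_poly.
Qed.

Lemma polt_derive (r t : R) : `|r| < d ->
  is_derive t (1 : R) (fun t => f (pol x r t))
   (- (r * sin t) * f1 (pol x r t) + r * cos t * f2 (pol x r t)).
Proof.
move=> rd; apply: (grad_chain (c1 := fun t => x.1 + r * cos t)
  (c2 := fun t => x.2 + r * sin t) oA fg).
- exact: (@polA r t rd).
- exact: is_derive_polxt.
- exact: is_derive_polyt.
Qed.

Lemma circ_polr_derive (m : R -> R) (r : R) : continuous m -> `|r| < d ->
  is_derive r (1 : R) (fun r => circ (fun t => m t * f (pol x r t)))
    (circ (fun t => m t * (cos t * f1 (pol x r t) + sin t * f2 (pol x r t)))).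
Proof.
move=> mc rd.
pose f' (r t : R) := m t * (cos t * f1 (pol x r t) + sin t * f2 (pol x r t)).
have near_r s : `|s - r| < d - `|r| -> `|s| < d.
  by rewrite -(ltrD2r `|r|) subrK; apply: le_lt_trans; rewrite -[X in `|X|](subrK r) ler_normD.
apply: (@circ_is_derive R (fun r t => m t * f (pol x r t)) f' r (d - `|r|)).
- by rewrite subr_gt0.
- move=> s /near_r sd; apply: (circ_pol_cont fc) => // t; exact: polA.
- move=> s t /near_r sd.
  exact: derZ (polr_derive t sd).
- move=> t.
  have -> : (fun z : R * R => f' z.1 z.2) = (fun z => (m z.2 * cos z.2) * f1 (pol x z.1 z.2)
     + (m z.2 * sin z.2) * f2 (pol x z.1 z.2)).
    by apply/funext => z; rewrite /f' mulrDr !mulrA.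
  apply: (@cvgD).
    apply: (@circ_pol_jcont A f1 (fun t => m t * cos t) R (fun=> x) id r t) => //.
    - by move=> y; apply: cvgM; [exact: mc|exact: continuous_cos].
    - exact: cvg_cst.
    - exact: polA.
  apply: (@circ_pol_jcont A f2 (fun t => m t * sin t) R (fun=> x) id r t) => //.
  - by move=> y; apply: cvgM; [exact: mc|exact: continuous_sin].
  - exact: cvg_cst.
  - exact: polA.
Qed.

(** Integration by parts in the angle: [n] is a periodic primitive of the weight, so there is no
    boundary term, and the angular derivative of [f] on the circle is [r] times its tangential
    derivative. *)
Lemma circ_polt_parts (m n : R -> R) (r : R) : (forall t : R, is_derive t (1 : R) n (m t)) ->
  continuous m -> n (2 * pi) = n 0 -> `|r| < d ->
  circ (fun t => m t * f (pol x r t)) =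
  r * circ (fun t => n t * (sin t * f1 (pol x r t) - cos t * f2 (pol x r t))).
Proof.
move=> dn mc np rd.
have nc : continuous n.
  by move=> t; apply: differentiable_continuous; apply/derivable1_diffP; exact: ex_derive.
have pA t : A (pol x r t) by exact: polA.
pose g t := n t * f (pol x r t).
pose g' t := m t * f (pol x r t)
   + (- r) * (n t * sin t * f1 (pol x r t) + (- (n t * cos t)) * f2 (pol x r t)).
have c1 : continuous (fun t => n t * sin t * f1 (pol x r t)).
  apply: (circ_pol_cont (m := fun t => n t * sin t) f1c) => // t.
  by apply: cvgM; [exact: nc|exact: continuous_sin].
have c2 : continuous (fun t => - (n t * cos t) * f2 (pol x r t)).
  apply: (circ_pol_cont (m := fun t => - (n t * cos t)) f2c) => // t.
  by apply: cvgN; apply: cvgM; [exact: nc|exact: continuous_cos].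
have c12 : continuous (fun t => n t * sin t * f1 (pol x r t) + (- (n t * cos t)) * f2 (pol x r t)).
  by move=> t; apply: cvgD; [exact: c1|exact: c2].
have c3 := circ_pol_cont fc mc pA.
have dg (t : R) : is_derive t (1 : R) g (g' t).
  apply: (is_derive_eq (derM (dn t) (polt_derive t rd))); rewrite /g'.
  move: (f _) (f1 _) (f2 _) (n t) (m t) (cos t) (sin t) => a a1 a2 b b' c s; ring.
have : circ g' = 0.
  rewrite (circ_derive dg) /g ?pol_per ?np ?subrr//.
  by move=> t; apply: cvgD; [exact: c3|apply: cvgM; [exact: cvg_cst|exact: c12]].
rewrite /g' circD//; last by move=> t; apply: cvgM; [exact: cvg_cst|exact: c12].
rewrite circZ// mulNr => /subr0_eq ->; congr (_ * _); apply: circ_ext => t.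
by rewrite mulrBr !mulrA mulNr.
Qed.

(** A centre within [d - r] of [x] still has its circle of radius [r] inside [A]; this margin allows
    differentiation in the centre. *)
Lemma circ_polx_derive (m : R -> R) (r : R) : continuous m -> 0 <= r < d ->
  is_derive x e1 (fun x => circ (fun t => m t * f (pol x r t)))
    (circ (fun t => m t * f1 (pol x r t))) /\
  is_derive x e2 (fun x => circ (fun t => m t * f (pol x r t)))
    (circ (fun t => m t * f2 (pol x r t))).
Proof.
move=> mc /andP[r0 rd].
have pb y t : box x (d - r) y -> A (pol y r t).
  move=> yx; apply: xA.
  have := @pol_box y r t r; rewrite ger0_norm// => _.
  have [h1 h2] := cos_sin_le1 t.
  have hb (a b c : R) : `|c| <= 1 -> `|a - b| < d - r -> `|a + r * c - b| < d.
    move=> c1 ab; rewrite addrAC (le_lt_trans (ler_normD _ _))// -ltrBrDr.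
    rewrite (lt_le_trans ab)// lerD2l lerN2 normrM ger0_norm//.
    by rewrite ler_piMr.
  by move: yx => [y1 y2]; split => /=; exact: hb.
have dr0 : 0 < d - r by rewrite subr_gt0.
split.
- apply/is_derive_e1P.
  apply: (@circ_is_derive R (fun s t => m t * f (pol (s, x.2) r t))
     (fun s t => m t * f1 (pol (s, x.2) r t)) x.1 (d - r)) => //.
  + move=> s sx; apply: (circ_pol_cont fc) => // t.
    by apply: pb; split => //=; rewrite subrr normr0.
  + move=> s t sx.
    have Ap : A (pol (s, x.2) r t) by apply: pb; split => //=; rewrite subrr normr0.
    have h1 : is_derive s (1 : R) (fun s => s + r * cos t) 1.
      apply: (is_derive_eq (derD (is_derive_id s 1) (derC s 1 _))).
      by rewrite addr0.
    have h2 : is_derive s (1 : R) (fun s : R => x.2 + r * sin t) 0.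
      exact: derC.
    have h := grad_chain (c1 := fun s => s + r * cos t) (c2 := fun s => x.2 + r * sin t)
      oA fg Ap h1 h2.
    rewrite mul1r mul0r addr0 in h.
    have h3 : is_derive s (1 : R) (fun s => f (pol (s, x.2) r t)) (f1 (pol (s, x.2) r t)).
      exact: h.
    exact: derZ h3.
  + move=> t.
    apply: (@circ_pol_jcont A f1 m R (fun s => (s, x.2)) (fun=> r) x.1 t) => //.
    * by apply: continuous_pair; [exact: cvg_id|exact: cvg_cst].
    * exact: cvg_cst.
    * by apply: pb; split => //=; rewrite subrr normr0.
- apply/is_derive_e2P.
  apply: (@circ_is_derive R (fun s t => m t * f (pol (x.1, s) r t))
     (fun s t => m t * f2 (pol (x.1, s) r t)) x.2 (d - r)) => //.
  + move=> s sx; apply: (circ_pol_cont fc) => // t.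
    by apply: pb; split => //=; rewrite subrr normr0.
  + move=> s t sx.
    have Ap : A (pol (x.1, s) r t) by apply: pb; split => //=; rewrite subrr normr0.
    have h1 : is_derive s (1 : R) (fun s => s + r * sin t) 1.
      apply: (is_derive_eq (derD (is_derive_id s 1) (derC s 1 _))).
      by rewrite addr0.
    have h2 : is_derive s (1 : R) (fun s : R => x.1 + r * cos t) 0.
      exact: derC.
    have h := grad_chain (c1 := fun s => x.1 + r * cos t) (c2 := fun s => s + r * sin t)
      oA fg Ap h2 h1.
    rewrite mul1r mul0r add0r in h.
    have h3 : is_derive s (1 : R) (fun s => f (pol (x.1, s) r t)) (f2 (pol (x.1, s) r t)).
      exact: h.
    exact: derZ h3.
  + move=> t.
    apply: (@circ_pol_jcont A f2 m R (fun s => (x.1, s)) (fun=> r) x.2 t) => //.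
    * by apply: continuous_pair; [exact: cvg_cst|exact: cvg_id].
    * exact: cvg_cst.
    * by apply: pb; split => //=; rewrite subrr normr0.
Qed.

End Radial.
End Helmholtz.

(** * Mean values of solutions of the Helmholtz equation *)

Section MeanValue.
Variable R : realType.
Notation P2 := (R * R)%type.

Definition helm (A : set P2) (mu : R) (u u1 u2 u11 u12 u21 u22 : P2 -> R) :=
  [/\ has_grad A u u1 u2, has_grad A u1 u11 u12, has_grad A u2 u21 u22 &
      forall x, A x -> u11 x + u22 x + mu * u x = 0].

Lemma continuous_cst1 (k : R) : continuous (fun _ : R => k).
Proof. by move=> x; exact: cvg_cst. Qed.

Lemma continuousMf (f g : R -> R) : continuous f -> continuous g -> continuous (fun t => f t * g t).
Proof. by move=> fc gc t; apply: cvgM; [exact: fc|exact: gc]. Qed.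

Lemma continuousDf (f g : R -> R) : continuous f -> continuous g -> continuous (fun t => f t + g t).
Proof. by move=> fc gc t; apply: cvgD; [exact: fc|exact: gc]. Qed.

Lemma continuousNf (f : R -> R) : continuous f -> continuous (fun t => - f t).
Proof. by move=> fc t; apply: cvgN; exact: fc. Qed.

Lemma is_derive_Ncos (t : R) : is_derive t (1 : R) (fun t => - cos t) (sin t).
Proof. by apply: (is_derive_eq (derN (is_derive_cos t))); rewrite opprK. Qed.

Lemma sin_2pi : sin (2 * pi) = 0 :> R.
Proof. by rewrite (_ : 2 * pi = pi *+ 2) ?sin2pi// mulr_natl. Qed.

Lemma cos_2pi : cos (2 * pi) = 1 :> R.
Proof. by rewrite (_ : 2 * pi = pi *+ 2) ?cos2pi// mulr_natl. Qed.

Section Ode.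
Variables (A : set P2) (mu : R) (u u1 u2 u11 u12 u21 u22 : P2 -> R) (x : P2) (d : R).
Hypotheses (oA : open A) (H : helm A mu u u1 u2 u11 u12 u21 u22) (xA : box x d `<=` A).

(** The factor 1 is a weight: the lemmas on circles hold for a weight [m], and this is their
    instance for the constant 1. The integral is not divided by [2 * pi]. *)
Definition cmean (r : R) := circ (fun t => 1 * u (pol x r t)).
Definition cmean1 (r : R) := circ (fun t => 1 * (cos t * u1 (pol x r t) + sin t * u2 (pol x r t))).

Lemma cmean_derive r : `|r| < d -> is_derive r (1 : R) cmean (cmean1 r).
Proof.
by case: H => ug _ _ _ rd; exact: (circ_polr_derive oA ug xA (@continuous_cst1 1) rd).
Qed.

Let kc (f f1 f2 : P2 -> R) (m : R -> R) r : has_grad A f f1 f2 -> `|r| < d -> continuous m ->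
  [/\ continuous (fun t => m t * f (pol x r t)), continuous (fun t => m t * f1 (pol x r t)) &
     continuous (fun t => m t * f2 (pol x r t))].
Proof.
move=> fg rd mc.
have pA t : A (pol x r t) by apply: xA; exact: pol_box.
split; apply: (circ_pol_cont _ mc pA) => y Ay.
- exact: (grad_cont oA fg Ay).
- by case: (fg y Ay).
- by case: (fg y Ay).
Qed.

(** The radial equation for the circle mean M. The derivative of [r * M'] is [M' + r * M'']; an
    angular integration by parts turns M' into r times an integral of second derivatives, and the
    two integrands add up to the Laplacian. *)
Lemma cmean1_derive r : `|r| < d ->
  is_derive r (1 : R) (fun r => r * cmean1 r) (- mu * (r * cmean r)).
Proof.
case: H => ug u1g u2g eqH rd.
have cosc := @continuous_cos R; have sinc := @continuous_sin R.
have Ncosc := continuousNf cosc.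
pose C1 r := circ (fun t => cos t * u1 (pol x r t)).
pose S2 r := circ (fun t => sin t * u2 (pol x r t)).
have M1E s : `|s| < d -> cmean1 s = C1 s + S2 s.
  move=> sd; rewrite /cmean1 /C1 /S2 -circD.
  - by apply: circ_ext => t; rewrite mul1r.
  - by have [] := kc u1g sd cosc.
  - by have [] := kc u2g sd sinc.
have dC := circ_polr_derive oA u1g xA cosc rd.
have dS := circ_polr_derive oA u2g xA sinc rd.
have pC := circ_polt_parts oA u1g xA (@is_derive_sin R) cosc
  (etrans sin_2pi (esym (sin0 R))) rd.
have np : - cos (2 * pi) = - cos 0 :> R by rewrite cos_2pi cos0.
have pS := circ_polt_parts oA u2g xA is_derive_Ncos sinc np rd.
have D : is_derive r (1 : R) (fun r => r * (C1 r + S2 r)) (- mu * (r * cmean r)).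
  apply: (is_derive_eq (derM (is_derive_id r 1) (derD dC dS))).
  rewrite mul1r /= /C1 /S2 pC pS -!mulrDr mulrCA; congr (_ * _).
  have pA t : A (pol x r t) by apply: xA; exact: pol_box.
  have [cc0 cc1 cc2] := kc u1g rd (continuousMf cosc cosc).
  have [cs0 cs1 cs2] := kc u1g rd (continuousMf cosc sinc).
  have [ss0 ss1 ss2] := kc u1g rd (continuousMf sinc sinc).
  have [cc0' cc1' cc2'] := kc u2g rd (continuousMf cosc cosc).
  have [cs0' cs1' cs2'] := kc u2g rd (continuousMf cosc sinc).
  have [ss0' ss1' ss2'] := kc u2g rd (continuousMf sinc sinc).
  have [mm _ _] := kc ug rd (@continuous_cst1 1).
  have a1 : continuous (fun t => sin t * (sin t * u11 (pol x r t) - cos t * u12 (pol x r t))).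
    have -> : (fun t => sin t * (sin t * u11 (pol x r t) - cos t * u12 (pol x r t))) =
      (fun t => sin t * sin t * u11 (pol x r t) + - (cos t * sin t * u12 (pol x r t))).
      by apply/funext => t; move: (u11 _) (u12 _) (cos t) (sin t) => a b c s; ring.
    by apply: continuousDf => //; exact: continuousNf.
  have a2 : continuous (fun t => - cos t * (sin t * u21 (pol x r t) - cos t * u22 (pol x r t))).
    have -> : (fun t => - cos t * (sin t * u21 (pol x r t) - cos t * u22 (pol x r t))) =
      (fun t => - (cos t * sin t * u21 (pol x r t)) + cos t * cos t * u22 (pol x r t)).
      by apply/funext => t; move: (u21 _) (u22 _) (cos t) (sin t) => a b c s; ring.
    by apply: continuousDf => //; exact: continuousNf.
  have a3 : continuous (fun t => cos t * (cos t * u11 (pol x r t) + sin t * u12 (pol x r t))).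
    have -> : (fun t => cos t * (cos t * u11 (pol x r t) + sin t * u12 (pol x r t))) =
      (fun t => cos t * cos t * u11 (pol x r t) + cos t * sin t * u12 (pol x r t)).
      by apply/funext => t; move: (u11 _) (u12 _) (cos t) (sin t) => a b c s; ring.
    exact: continuousDf.
  have a4 : continuous (fun t => sin t * (cos t * u21 (pol x r t) + sin t * u22 (pol x r t))).
    have -> : (fun t => sin t * (cos t * u21 (pol x r t) + sin t * u22 (pol x r t))) =
      (fun t => cos t * sin t * u21 (pol x r t) + sin t * sin t * u22 (pol x r t)).
      by apply/funext => t; move: (u21 _) (u22 _) (cos t) (sin t) => a b c s; ring.
    exact: continuousDf.
  have a12 := continuousDf a1 a2; have a34 := continuousDf a3 a4.
  rewrite /cmean -(circD a1 a2) -(circD a3 a4) -(circD a12 a34) -(circZ _ mm).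
  apply: circ_ext => t.
  have cs := cos2Dsin2 t; have e := eqH _ (pA t).
  move: cs e; move: (u _) (u11 _) (u12 _) (u21 _) (u22 _) (cos t) (sin t) => v a b b' a' c s cs e.
  transitivity ((a + a') * (c ^+ 2 + s ^+ 2)); first ring.
  by rewrite cs mulr1 mul1r mulNr; apply/eqP; rewrite -addr_eq0 e.
refine (near_eq_is_derive _ D).
have d0 : 0 < d - `|r| by rewrite subr_gt0.
apply/nbhs_ballP; exists (d - `|r|) => //= s; rewrite -ball_normE /= => sr.
rewrite M1E// -(ltrD2r (- `|r|)) (le_lt_trans _ sr)// distrC.
exact: lerB_dist.
Qed.

End Ode.

Lemma eq0_derive (f : R -> R) (a b : R) : a <= b ->
  (forall r, a < r < b -> is_derive r (1 : R) f 0) -> {within `[a, b], continuous f} -> f b = f a.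
Proof.
move=> ab fd fc.
have h c : c \in `]a, b[ -> is_derive c (1 : R) f 0 by rewrite in_itv; exact: fd.
have [c _] := @MVT_segment R f (fun=> 0) a b ab h fc.
by rewrite mul0r => /eqP; rewrite subr_eq0 => /eqP.
Qed.

Lemma derive_continuous_at (f : R -> R) (r d : R) : is_derive r (1 : R) f d -> {for r, continuous f}.
Proof.
by move=> fd; apply: differentiable_continuous; apply/derivable1_diffP; case: fd.
Qed.

(* Both [M] and [J] solve the radial equation [(r M')' = - mu r M] and are regular at 0, so their
   Wronskian vanishes. *)
Lemma radial_unique (M M1 J J1 : R -> R) (mu d : R) :
  (forall r, `|r| < d -> is_derive r (1 : R) M (M1 r)) ->
  (forall r, `|r| < d -> is_derive r (1 : R) (fun r => r * M1 r) (- mu * (r * M r))) ->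
  (forall r, `|r| < d -> is_derive r (1 : R) J (J1 r)) ->
  (forall r, `|r| < d -> is_derive r (1 : R) (fun r => r * J1 r) (- mu * (r * J r))) ->
  (forall r, `|r| < d -> 0 < J r) ->
  forall r, 0 <= r < d -> M r * J 0 = M 0 * J r.
Proof.
move=> dM dM1 dJ dJ1 J0 r /andP[r0 rd].
pose W r := (r * M1 r) * J r + - (M r * (r * J1 r)).
have dW s : `|s| < d -> is_derive s (1 : R) W 0.
  move=> sd.
  apply: (is_derive_eq (derD (derM (dM1 _ sd) (dJ _ sd)) (derN (derM (dM _ sd) (dJ1 _ sd))))).
  by move: (M s) (M1 s) (J s) (J1 s) => *; ring.
have sd s : 0 <= s <= r -> `|s| < d.
  by move=> /andP[s0 sr]; rewrite ger0_norm// (le_lt_trans sr).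
have W0 s : 0 <= s <= r -> W s = 0.
  move=> /andP[s0 sr].
  have -> : 0 = W 0 by rewrite /W !mul0r mulr0 oppr0 addr0.
  apply: eq0_derive => // [t /andP[t0 ts]|].
    by apply: dW; apply: sd; rewrite ltW//= (le_trans (ltW ts)).
  apply: continuous_in_subspaceT => t; rewrite inE /= in_itv /= => /andP[t0 ts].
  apply: (derive_continuous_at (dW _ _)).
  by apply: sd; rewrite t0//= (le_trans ts).
have Jn s : 0 <= s <= r -> J s != 0 by move=> /sd /J0; rewrite lt0r => /andP[].
have dV s (h : 0 <= s <= r) : is_derive s (1 : R) (fun s => (J s)^-1) (- (J s) ^- 2 * J1 s).
  exact: (is_deriveV (Jn _ h) (dJ _ (sd _ h))).
pose Q s := M s * (J s)^-1.
have dQ s : 0 <= s <= r -> is_derive s (1 : R) Q (M1 s * (J s)^-1 + M s * (- (J s) ^- 2 * J1 s)).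
  by move=> h; exact: (derM (dM _ (sd _ h)) (dV _ h)).
have : Q r = Q 0.
  apply: eq0_derive => // [s /andP[s0 sr]|].
    have h : 0 <= s <= r by rewrite !ltW.
    apply: (is_derive_eq (dQ _ h)).
    (* The factor [s] of the Wronskian can be divided out because [s > 0]; the endpoint 0 is reached
       by continuity. *)
    have : s * (M1 s * J s - M s * J1 s) = 0.
      by rewrite -(W0 s h) /W; move: (M s) (M1 s) (J s) (J1 s) => *; ring.
    move=> /eqP; rewrite mulf_eq0 (gt_eqF s0)/= subr_eq0 => /eqP E.
    have Js := Jn _ h; move: Js E; move: (M s) (M1 s) (J s) (J1 s) => a a1 b b1 b0 E.
    have -> : a1 / b + a * (- b ^- 2 * b1) = (a1 * b - a * b1) / b ^+ 2 by field.
    by rewrite E subrr mul0r.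
  apply: continuous_in_subspaceT => t; rewrite inE /= in_itv /= => tr.
  exact: (derive_continuous_at (dQ _ tr)).
have z0 : (0 : R) <= 0 <= r by apply/andP; split.
have rr : 0 <= r <= r by apply/andP; split.
rewrite /Q => /(congr1 (fun z => z * (J r * J 0))).
have := Jn _ z0; have := Jn _ rr.
move: (M r) (M 0) (J r) (J 0) => a b p q p0 q0 E.
have <- : a / p * (p * q) = a * q by field.
by rewrite E; field.
Qed.

End MeanValue.

(** * The gradient of a solution as a moment over a circle *)

Section GradientFormula.
Variable R : realType.
Notation P2 := (R * R)%type.

Lemma sinh_cosh_derive (k : R) (s : R) x :
  is_derive x (1 : R) (fun x => expR (k * x) + s * expR (- k * x))
    (k * (expR (k * x) - s * expR (- k * x))).
Proof.
have h (a : R) : is_derive x (1 : R) (fun x => expR (a * x)) (expR (a * x) * a).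
  have ha : is_derive x (1 : R) (fun x => a * x) a.
    by apply: (is_derive_eq (derZ a (is_derive_id x 1))); rewrite mulr1.
  exact: (is_derive1_comp (is_derive_expR (a * x)) ha).
apply: (is_derive_eq (derD (h k) (derZ s (h (- k))))).
by move: (expR _) (expR _) => a b; ring.
Qed.

Lemma trig_derive (k x : R) :
  is_derive x (1 : R) (fun x => sin (k * x)) (k * cos (k * x)) /\
  is_derive x (1 : R) (fun x => cos (k * x)) (- (k * sin (k * x))).
Proof.
have ha : is_derive x (1 : R) (fun x => k * x) k.
  by apply: (is_derive_eq (derZ k (is_derive_id x 1))); rewrite mulr1.
split.
  by apply: (is_derive_eq (is_derive1_comp (is_derive_sin (k * x)) ha)); rewrite mulrC.
by apply: (is_derive_eq (is_derive1_comp (is_derive_cos (k * x)) ha)); rewrite mulNr mulrC.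
Qed.

(** The three cases are sinh(k x) / k, sin(k x) / k and x. Read as functions of the first
    coordinate, [z] and [z1] are solutions in the plane with known values at the origin; they
    calibrate the constants of the mean value formulas. *)
Lemma wave_exists (mu : R) : exists z z1 : R -> R,
  [/\ forall x, is_derive x (1 : R) z (z1 x), forall x, is_derive x (1 : R) z1 (- mu * z x),
      z 0 = 0 & z1 0 = 1].
Proof.
have [mu0|mu0|->] := ltgtP mu 0.
- pose k := Num.sqrt (- mu).
  have k0 : k != 0 by rewrite sqrtr_eq0 -ltNge oppr_gt0.
  have kk : k ^+ 2 = - mu by rewrite sqr_sqrtr// oppr_ge0 ltW.
  exists (fun x => (2 * k)^-1 * (expR (k * x) + (-1) * expR (- k * x))),
    (fun x => 2^-1 * (expR (k * x) + 1 * expR (- k * x))); split => [x|x||].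
  + apply: (is_derive_eq (derZ _ (sinh_cosh_derive k (-1) x))).
    by move: (expR _) (expR _) => a b; field.
  + apply: (is_derive_eq (derZ _ (sinh_cosh_derive k 1 x))); rewrite -kk.
    by move: (expR _) (expR _) => a b; field.
  + by rewrite !mulr0 expR0; field.
  + by rewrite !mulr0 expR0; field.
- pose k := Num.sqrt mu.
  have k0 : k != 0 by rewrite sqrtr_eq0 -ltNge.
  have kk : k ^+ 2 = mu by rewrite sqr_sqrtr// ltW.
  exists (fun x => k^-1 * sin (k * x)), (fun x => cos (k * x)); split => [x|x||].
  + have [h _] := trig_derive k x.
    by apply: (is_derive_eq (derZ _ h)); rewrite mulKf.
  + have [_ h] := trig_derive k x.
    apply: (is_derive_eq h); rewrite -kk.
    by move: (sin _) => a; field.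
  + by rewrite mulr0 sin0 mulr0.
  + by rewrite mulr0 cos0.
- exists id, (fun=> 1); split => [x|x||]; [exact: is_derive_id| |by []|by []].
  by rewrite oppr0 mul0r; exact: derC.
Qed.

Lemma grad_fst (g g' : R -> R) : (forall t, is_derive t (1 : R) g (g' t)) -> continuous g' ->
  has_grad setT (fun x : P2 => g x.1) (fun x => g' x.1) (fun=> 0).
Proof.
move=> dg g'c x _; split.
- exact/(is_derive_e1P (fun x : P2 => g x.1)).
- by apply/(is_derive_e2P (fun x : P2 => g x.1)); exact: (derC x.2 1 (g x.1)).
- by apply: (@continuous_at_comp _ _ _ (fun x : P2 => x.1) g'); [exact: cvg_fst|exact: g'c].
- exact: cvg_cst.
Qed.

Lemma near_eq_derive_unique (V : normedModType R) (f g : V -> R) (x v : V) (a b : R) :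
  (\forall y \near x, f y = g y) -> is_derive x v f a -> is_derive x v g b -> a = b.
Proof.
move=> fg fa gb; have := near_eq_is_derive fg fa => ga.
by rewrite -(@derive_val _ _ _ _ _ _ _ ga) -(@derive_val _ _ _ _ _ _ _ gb).
Qed.

Section Radial.
Variables (A : set P2) (mu : R) (u u1 u2 u11 u12 u21 u22 : P2 -> R) (d : R).
Hypotheses (oA : open A) (H : helm A mu u u1 u2 u11 u12 u21 u22).
(** For positive mu, [J r] is [2 * pi] times the Bessel function of order 0 at sqrt(mu) r. It enters
    through its equation, its value at 0 and its positivity on the interval. *)
Variables (J J1 : R -> R).
Hypothesis dJ : forall r : R, `|r| < d -> is_derive r (1 : R) J (J1 r).
Hypothesis dJ1 : forall r : R, `|r| < d -> is_derive r (1 : R) (fun r => r * J1 r) (- mu * (r * J r)).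
Hypothesis J0 : forall r, `|r| < d -> 0 < J r.
Hypothesis J00 : J 0 = 2 * pi.

Lemma mean_value (x : P2) (s r : R) : s <= d -> box x s `<=` A -> 0 <= r < s -> cmean u x r = u x * J r.
Proof.
move=> sd xA rs.
have ls (t : R) : `|t| < s -> `|t| < d by move/lt_le_trans; apply.
have := radial_unique (fun t ts => cmean_derive oA H xA ts)
  (fun t ts => cmean1_derive oA H xA ts) (fun t ts => dJ (ls t ts)) (fun t ts => dJ1 (ls t ts))
  (fun t ts => J0 (ls t ts)) rs.
have -> : cmean u x 0 = 2 * pi * u x.
  by rewrite -circ_cst; apply: circ_ext => t; rewrite pol0 mul1r.
have pi0 : 2 * pi != 0 :> R by rewrite gt_eqF// mulr_gt0// pi_gt0.
rewrite J00 mulrC -mulrA; exact: mulfI.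
Qed.

(** The mean value identity for [u] is differentiated in the centre. It cannot be applied directly
    to [u1] and [u2], which at this point are only of class C^1. *)
Lemma mean_value_grad (x : P2) (s r : R) : s <= d -> box x s `<=` A -> 0 <= r < s ->
  circ (fun t => 1 * u1 (pol x r t)) = u1 x * J r /\
  circ (fun t => 1 * u2 (pol x r t)) = u2 x * J r.
Proof.
move=> sd xA rs; have [ug _ _ _] := H.
have [r0 rs'] := andP rs.
have s0 : 0 < s by exact: le_lt_trans rs'.
have Ax : A x by apply: xA; split; rewrite subrr normr0.
have N : \forall y \near x, circ (fun t => 1 * u (pol y r t)) = u y * J r.
  (* Half of the margin is given to the centre; the other half keeps [r] below the radius
     [(s + r) / 2] that is left around it. *)
  apply/nbhs_boxP; exists ((s - r) / 2); split; first by rewrite divr_gt0// subr_gt0.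
  move=> y yx; apply: (@mean_value y (s - (s - r) / 2)).
  - by rewrite (le_trans _ sd)// lerBlDr lerDl divr_ge0// subr_ge0 ltW.
  - move=> z zy; apply: xA; apply: (box_sub yx) => //.
    by rewrite divr_ge0// subr_ge0 ltW.
  - rewrite r0 /=; lra.
have [D1 D2] := circ_polx_derive oA ug xA (@continuous_cst1 R 1) rs.
have [g1 g2 _ _] := ug _ Ax.
split.
  apply: (near_eq_derive_unique N D1).
  by apply: (is_derive_eq (derM g1 (derC x _ (J r)))); rewrite mulr0 addr0.
apply: (near_eq_derive_unique N D2).
by apply: (is_derive_eq (derM g2 (derC x _ (J r)))); rewrite mulr0 addr0.
Qed.

(** By the divergence theorem the moment is the integral of the partial derivative [ui] over the
    disc of radius [r]; this is the statement differentiated in [r]. With [m] the cosine or the sine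
    and [n] its primitive, the pointwise identity singles out [u1] or [u2]. *)
Lemma radial_moment_derive (m n : R -> R) (ui : P2 -> R) (x : P2) (s r : R) :
  (forall t : R, is_derive t (1 : R) n (m t)) -> continuous m -> n (2 * pi) = n 0 ->
  (forall t y, m t * (cos t * u1 y + sin t * u2 y) + n t * (sin t * u1 y - cos t * u2 y) = ui y) ->
  box x s `<=` A -> `|r| < s ->
  is_derive r (1 : R) (fun r => r * circ (fun t => m t * u (pol x r t)))
    (r * circ (fun t => 1 * ui (pol x r t))).
Proof.
move=> dn mc np id xA rs; have [ug _ _ _] := H.
have nc : continuous n by move=> t; exact: derive_continuous_at (dn t).
have pA t : A (pol x r t) by apply: xA; exact: pol_box.
have u1c (m' : R -> R) : continuous m' -> continuous (fun t => m' t * u1 (pol x r t)).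
  by move=> m'c; apply: (circ_pol_cont _ m'c pA) => y /ug[].
have u2c (m' : R -> R) : continuous m' -> continuous (fun t => m' t * u2 (pol x r t)).
  by move=> m'c; apply: (circ_pol_cont _ m'c pA) => y /ug[].
have cosc := @continuous_cos R; have sinc := @continuous_sin R.
apply: (is_derive_eq (derM (is_derive_id r 1) (circ_polr_derive oA ug xA mc rs))).
rewrite mul1r (circ_polt_parts oA ug xA dn mc np rs) -mulrDr; congr (_ * _).
rewrite -circD.
- by apply: circ_ext => t; rewrite addrC id mul1r.
- apply: continuousMf => //; apply: continuousDf; first exact: u1c.
  by apply: continuousNf; exact: u2c.
- by apply: continuousMf => //; apply: continuousDf; [exact: u1c|exact: u2c].
Qed.

End Radial.

(** By [radial_moment_derive] and [mean_value_grad], a moment has derivative [r * J r] times the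
    partial derivative at the centre, and it vanishes at [r = 0]. Hence it is that partial
    derivative times one function [c] with derivative [r * J r], the same for all solutions. The
    lower bound on [c] permits division by it. *)
Lemma gradient_formula (mu : R) : exists d0 : R, exists c : R -> R, [/\ 0 < d0,
  forall r : R, 0 < r < d0 -> pi * r ^+ 2 / 2 <= c r &
  forall (A : set P2) (u u1 u2 u11 u12 u21 u22 : P2 -> R) (x : P2) (r : R),
    open A -> helm A mu u u1 u2 u11 u12 u21 u22 ->
    forall s : R, s <= d0 -> box x s `<=` A -> 0 < r < s ->
    r * circ (fun t => cos t * u (pol x r t)) = u1 x * c r /\
    r * circ (fun t => sin t * u (pol x r t)) = u2 x * c r].
Proof.
have [z [z1 [dz dz1 z0 z10]]] := wave_exists mu.
have zc : continuous z by move=> t; exact: derive_continuous_at (dz t).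
have z1c : continuous z1 by move=> t; exact: derive_continuous_at (dz1 t).
have mzc : continuous (fun t => - mu * z t) by apply: continuousMf => //; exact: continuous_cst1.
have mz1c : continuous (fun t => - mu * z1 t) by apply: continuousMf => //; exact: continuous_cst1.
have dmz (t : R) : is_derive t (1 : R) (fun t => - mu * z t) (- mu * z1 t) by exact: derZ.
have dmz1 (t : R) : is_derive t (1 : R) (fun t => - mu * z1 t) (- mu * (- mu * z t)) by exact: derZ.
have g0 : has_grad setT (fun=> 0) (fun=> 0) (fun _ : P2 => 0).
  by move=> x _; split; [exact: derC|exact: derC|exact: cvg_cst|exact: cvg_cst].
have Hz1 : helm setT mu (fun x => z1 x.1) (fun x => - mu * z x.1) (fun=> 0)
    (fun x => - mu * z1 x.1) (fun=> 0) (fun=> 0) (fun=> 0).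
  split; [exact: grad_fst|exact: grad_fst|exact: g0|].
  by move=> x _; rewrite addr0 mulNr addNr.
have Hz : helm setT mu (fun x => z x.1) (fun x => z1 x.1) (fun=> 0)
    (fun x => - mu * z x.1) (fun=> 0) (fun=> 0) (fun=> 0).
  split; [exact: grad_fst|exact: grad_fst|exact: g0|].
  by move=> x _; rewrite addr0 mulNr addNr.
(* [d0] is chosen so that [z1] is at least 1/2 within distance [d0] of 0; then [J] is at least [pi]
   there, in particular positive. *)
have /cvgrPdist_lt /(_ (2^-1)) := z1c 0.
rewrite z10 invr_gt0 ltr0Sn => /(_ isT) /nbhs_ballP[d0 /= d00 Hd].
have z1ge (t : R) : `|t| < d0 -> 2^-1 <= z1 t.
  move=> td; have : `|1 - z1 t| < 2^-1 by apply: Hd; rewrite -ball_normE /= sub0r normrN.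
  by rewrite ltr_norml => /andP[_]; lra.
pose o : P2 := (0, 0).
have sT (s : R) : box o s `<=` setT by [].
pose J := cmean (fun x => z1 x.1) o.
pose J1 := cmean1 (fun x => - mu * z x.1) (fun=> 0) o.
have dJ (r : R) : `|r| < d0 -> is_derive r (1 : R) J (J1 r).
  by move=> rd; exact: (cmean_derive openT Hz1 (sT d0) rd).
have dJ1 (r : R) : `|r| < d0 -> is_derive r (1 : R) (fun r => r * J1 r) (- mu * (r * J r)).
  by move=> rd; exact: (cmean1_derive openT Hz1 (sT d0) rd).
have Jge (r : R) : `|r| < d0 -> pi <= J r.
  move=> rd; have -> : pi = circ (fun=> 2^-1) :> R by rewrite circ_cst mulrAC divff ?mul1r.
  apply: circ_le; first exact: continuous_cst1.
    apply: (@circ_pol_cont R setT (fun x => z1 x.1) (fun=> 1) o r) => //.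
    - move=> y _; apply: (@continuous_at_comp _ _ _ (fun x : P2 => x.1) z1); [exact: cvg_fst|exact: z1c].
    - exact: continuous_cst1.
  move=> t _; rewrite mul1r; apply: z1ge.
  by have [] := pol_box o t rd; rewrite subr0.
have J0 (r : R) : `|r| < d0 -> 0 < J r by move=> /Jge; apply: lt_le_trans; exact: pi_gt0.
have J00 : J 0 = 2 * pi.
  rewrite /J /cmean -[RHS]mulr1 -circ_cst; apply: circ_ext => t.
  by rewrite pol0 mul1r z10.
have cosc := @continuous_cos R; have sinc := @continuous_sin R.
have np : - cos (2 * pi) = - cos 0 :> R by rewrite cos_2pi cos0.
have sp := etrans (sin_2pi R) (esym (sin0 R)).
have cs2 (t : R) := cos2Dsin2 t.
have idc u1 u2 (t : R) (y : P2) : cos t * (cos t * u1 y + sin t * u2 y) +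
    sin t * (sin t * u1 y - cos t * u2 y) = u1 y :> R.
  have := cs2 t; move: (u1 y) (u2 y) (cos t) (sin t) => a b c s e.
  transitivity (a * (c ^+ 2 + s ^+ 2)); first ring.
  by rewrite e mulr1.
have ids u1 u2 (t : R) (y : P2) : sin t * (cos t * u1 y + sin t * u2 y) +
    - cos t * (sin t * u1 y - cos t * u2 y) = u2 y :> R.
  have := cs2 t; move: (u1 y) (u2 y) (cos t) (sin t) => a b c s e.
  transitivity (b * (c ^+ 2 + s ^+ 2)); first ring.
  by rewrite e mulr1.
(* The cosine moment at the origin of the solution [z]. Its derivative is [r * J r], because the
   first partial derivative of that solution is [z1], whose circle integral is [J]. *)
pose c r := r * circ (fun t => cos t * z (pol o r t).1).
have dc (r : R) : 0 <= r < d0 -> is_derive r (1 : R) c (r * J r).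
  move=> /andP[r0 rd].
  have rd' : `|r| < d0 by rewrite ger0_norm.
  exact: (radial_moment_derive openT Hz (@is_derive_sin R) cosc sp
    (idc (fun x => z1 x.1) (fun=> 0)) (sT d0) rd').
have c0 : c 0 = 0 by rewrite /c mul0r.
exists d0, c; split => //.
  move=> r /andP[r0 rd].
  (* Since [r * J r >= pi * r], this difference does not decrease, and it starts at 0. *)
  pose g r := c r - pi / 2 * r ^+ 2.
  have dg (t : R) : 0 <= t < d0 -> is_derive t (1 : R) g (t * J t - pi * t).
    move=> td; have h2 : is_derive t (1 : R) (fun t => t * t) (t + t).
      by apply: (is_derive_eq (derM (is_derive_id t 1) (is_derive_id t 1))); rewrite mul1r mulr1.
    apply: (is_derive_eq (derD (dc t td) (derN (derZ (pi / 2) h2)))).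
    by move: (J t) => a; field.
  have r0' := ltW r0.
  have [t tr|t] := @mvt_abs R g (fun t => t * J t - pi * t) 0 r.
    apply: dg; move: tr; rewrite (min_l r0') (max_r r0') => /andP[-> h].
    exact: le_lt_trans rd.
  rewrite (min_l r0') (max_r r0') => /andP[t0 tr] E.
  rewrite -subr_ge0; have -> : c r - pi * r ^+ 2 / 2 = g r - g 0.
    by rewrite /g c0; field.
  rewrite E subr0; apply: mulr_ge0 => //.
  rewrite (mulrC t) -mulrBl; apply: mulr_ge0 => //; rewrite subr_ge0; apply: Jge.
  by rewrite ger0_norm// (le_lt_trans tr rd).
move=> A u u1 u2 u11 u12 u21 u22 x r oA H s sd xA /andP[r0 rs].
have MG (t : R) (ts : 0 <= t < s) := mean_value_grad oA H dJ dJ1 J0 J00 sd xA ts.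
have fin (m n : R -> R) (ui : P2 -> R) :
  (forall t : R, 0 <= t < s -> is_derive t (1 : R)
     (fun r => r * circ (fun t => m t * u (pol x r t))) (t * (ui x * J t))) ->
  r * circ (fun t => m t * u (pol x r t)) = ui x * c r.
  move=> D; pose Q r := r * circ (fun t => m t * u (pol x r t)) - ui x * c r.
  have dQ (t : R) : 0 <= t < s -> is_derive t (1 : R) Q 0.
    move=> /andP[t0 ts]; have h : 0 <= t < d0 by rewrite t0 (lt_le_trans ts).
    have ts' : 0 <= t < s by rewrite t0.
    apply: (is_derive_eq (derD (D t ts') (derN (derZ (ui x) (dc t h))))).
    by move: (J t) => a; ring.
  have Q0 : Q 0 = 0 by rewrite /Q c0 mul0r mulr0 subrr.
  suff: Q r = Q 0 by rewrite Q0 => /eqP; rewrite subr_eq0 => /eqP.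
  apply: eq0_derive; first by exact: (ltW r0).
    by move=> t /andP[t0 tr]; apply: dQ; apply/andP; split; [exact: ltW|exact: lt_trans tr rs].
  apply: continuous_in_subspaceT => t; rewrite inE /= in_itv /= => /andP[t0 tr].
  by apply: (derive_continuous_at (dQ t _)); apply/andP; split; [exact: t0|exact: le_lt_trans tr rs].
split.
  apply: (fin _ sin) => t /[dup] ts /andP[t0 ts'].
  rewrite -(MG t ts).1.
  apply: (radial_moment_derive oA H (@is_derive_sin R) cosc sp (idc u1 u2) xA).
  by rewrite ger0_norm.
apply: (fin _ (fun t => - cos t)) => t /[dup] ts /andP[t0 ts'].
rewrite -(MG t ts).2.
apply: (radial_moment_derive oA H (@is_derive_Ncos R) sinc np (ids u1 u2) xA).
by rewrite ger0_norm.
Qed.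

End GradientFormula.

(** * Interior regularity and Cauchy estimates for solutions *)

Section Regularity.
Variable R : realType.
Notation P2 := (R * R)%type.
Notation e1 := (e1 R).
Notation e2 := (e2 R).

Lemma grad_ext (B : set P2) (f g f1 f2 : P2 -> R) : open B -> (forall x, B x -> f x = g x) ->
  has_grad B f f1 f2 -> has_grad B g f1 f2.
Proof.
move=> oB fg fG x Bx; have [d1 d2 c1 c2] := fG _ Bx.
have N : \forall y \near x, f y = g y.
  by apply: filterS (open_nbhs_nbhs (conj oB Bx)) => y; exact: fg.
by split; [exact: near_eq_is_derive N d1|exact: near_eq_is_derive N d2| exact: c1|exact: c2].
Qed.

Lemma circ_mean_grad (A B : set P2) (f f1 f2 : P2 -> R) (m : R -> R) (k s r : R) :
  open A -> open B -> has_grad A f f1 f2 -> continuous m ->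
  (forall y, B y -> box y s `<=` A) -> 0 <= r < s ->
  has_grad B (fun x => k * circ (fun t => m t * f (pol x r t)))
    (fun x => k * circ (fun t => m t * f1 (pol x r t)))
    (fun x => k * circ (fun t => m t * f2 (pol x r t))).
Proof.
move=> oA oB fg mc BA rs x Bx.
have rs' : `|r| < s by move: rs => /andP[r0 rs]; rewrite ger0_norm.
have pA y t : B y -> A (pol y r t) by move=> By; apply: (BA _ By); exact: pol_box.
have cc (g : P2 -> R) : (forall y, A y -> {for y, continuous g}) ->
    {for x, continuous (fun x => k * circ (fun t => m t * g (pol x r t)))}.
  move=> gc; apply: (@cvgM _ _ _ _ (fun=> k)); first exact: cvg_cst.
  apply: (@circ_continuous R P2 (fun x t => m t * g (pol x r t)) x).
    move=> t; apply: (@circ_pol_jcont R A g m P2 id (fun=> r) x t) => //.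
    - exact: cvg_cst.
    - exact: pA.
  apply: filterS (open_nbhs_nbhs (conj oB Bx)) => y By.
  by apply: (circ_pol_cont gc mc) => t; exact: pA.
have [d1 d2] := circ_polx_derive oA fg (BA _ Bx) mc rs.
split; [exact: (derZ k d1)|exact: (derZ k d2)| |]; apply: cc => y Ay; by case: (fg y Ay).
Qed.

Definition sol (A : set P2) (mu : R) (u : P2 -> R) :=
  C2 A u /\ forall x, A x -> 'D_e1 ('D_e1 u) x + 'D_e2 ('D_e2 u) x + mu * u x = 0.

Lemma sol_helm A mu u : sol A mu u -> helm A mu u ('D_e1 u) ('D_e2 u)
  ('D_e1 ('D_e1 u)) ('D_e2 ('D_e1 u)) ('D_e1 ('D_e2 u)) ('D_e2 ('D_e2 u)).
Proof.
by move=> [[h h1 h2] e]; split; [exact: C1_grad|exact: C1_grad|exact: C1_grad|exact: e].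
Qed.

Lemma helm_sol A mu (u u1 u2 u11 u12 u21 u22 : P2 -> R) : open A ->
  helm A mu u u1 u2 u11 u12 u21 u22 -> sol A mu u.
Proof.
move=> oA [h h1 h2 e].
have g1 : has_grad A ('D_e1 u) u11 u12.
  by apply: (grad_ext oA _ h1) => x Ax; rewrite (grad_D1 h Ax).
have g2 : has_grad A ('D_e2 u) u21 u22.
  by apply: (grad_ext oA _ h2) => x Ax; rewrite (grad_D2 h Ax).
split; first by split; [exact: (grad_C1 oA h)|exact: (grad_C1 oA g1)|exact: (grad_C1 oA g2)].
by move=> x Ax; rewrite (grad_D1 g1 Ax) (grad_D2 g2 Ax); exact: e.
Qed.

Lemma sol_local A mu u : (forall x, A x -> exists B, B x /\ sol B mu u) -> sol A mu u.
Proof.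
move=> H; split; first split.
- by move=> x /H[B [Bx [[h _ _] _]]]; exact: h.
- by move=> x /H[B [Bx [[_ h _] _]]]; exact: h.
- by move=> x /H[B [Bx [[_ _ h] _]]]; exact: h.
- by move=> x /H[B [Bx [_ h]]]; exact: h.
Qed.

(** The equation has constant coefficients, so a superposition of translates of a solution is again
    a solution. *)
Lemma circ_mean_helm (A B : set P2) (mu : R) (u u1 u2 u11 u12 u21 u22 : P2 -> R) (m : R -> R)
  (k s r : R) : open A -> open B -> helm A mu u u1 u2 u11 u12 u21 u22 -> continuous m ->
  (forall y, B y -> box y s `<=` A) -> 0 <= r < s ->
  sol B mu (fun x => k * circ (fun t => m t * u (pol x r t))).
Proof.
move=> oA oB [h h1 h2 e] mc BA rs.
have := circ_mean_grad k oA oB h mc BA rs.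
have := circ_mean_grad k oA oB h1 mc BA rs.
have := circ_mean_grad k oA oB h2 mc BA rs.
move=> g2 g1 g.
apply: (helm_sol oB (And4 g g1 g2 _)) => x Bx.
have rs' : `|r| < s by move: rs => /andP[r0 rs]; rewrite ger0_norm.
have pA t : A (pol x r t) by apply: (BA _ Bx); exact: pol_box.
have c11 : continuous (fun t => m t * u11 (pol x r t)).
  by apply: (circ_pol_cont _ mc pA) => y /h1[].
have c22 : continuous (fun t => m t * u22 (pol x r t)).
  by apply: (circ_pol_cont _ mc pA) => y /h2[].
have c0 : continuous (fun t => m t * u (pol x r t)).
  by apply: (circ_pol_cont _ mc pA) => y Ay; exact: (grad_cont oA h Ay).
have cs := continuousDf c11 c22.
have cm : continuous (fun t => mu * (m t * u (pol x r t))).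
  by apply: continuousMf => //; exact: continuous_cst1.
rewrite mulrCA -!mulrDr -(circD c11 c22) -(circZ _ c0) -(circD cs cm).
rewrite (circ_ext (g := fun=> 0)) ?circ_cst ?mulr0// => t.
by rewrite mulrCA -!mulrDr e ?mulr0.
Qed.

Lemma sol_ext B mu (f g : P2 -> R) : open B -> (forall x, B x -> f x = g x) -> sol B mu f -> sol B mu g.
Proof.
move=> oB fg /sol_helm[h h1 h2 e].
apply: (helm_sol oB (And4 (grad_ext oB fg h) h1 h2 _)) => x Bx.
by rewrite -fg//; exact: e.
Qed.

(** Locally the gradient formula, divided by [c r], writes each partial derivative as a weighted
    circle mean of [u], and such means are of class C^2 and solve the equation. One order of
    differentiability is gained, and the argument can be repeated. *)
Lemma sol_derive A mu u : open A -> sol A mu u -> sol A mu ('D_e1 u) /\ sol A mu ('D_e2 u).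
Proof.
move=> oA su; have H := sol_helm su.
have [d0 [c [d00 cge gf]]] := gradient_formula mu.
suff loc x : A x -> exists B, [/\ B x, sol B mu ('D_e1 u) & sol B mu ('D_e2 u)].
  by split; apply: sol_local => x /loc[B []]; exists B.
move=> Ax; have /nbhs_boxP[s [s0 sA]] := open_nbhs_nbhs (conj oA Ax).
(* One radius serves all centres in the square of half-side [s / 2]: the formula then holds on an
   open set with a constant [r] and may be differentiated. *)
pose d := Num.min d0 (s / 2).
have dp : 0 < d by rewrite lt_min d00 divr_gt0.
have dd0 : d <= d0 by rewrite ge_min lexx.
have ds : d <= s - s / 2 by rewrite ge_min; apply/orP; right; lra.
have BA y : box x (s / 2) y -> box y d `<=` A.
  move=> yx z [z1 z2]; apply: sA; apply: (box_sub yx); first by rewrite divr_ge0// ltW.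
  by split; [exact: lt_le_trans z1 ds|exact: lt_le_trans z2 ds].
pose r := d / 2.
have rd : 0 < r < d by rewrite /r; apply/andP; split; lra.
have rd' : 0 <= r < d by move: rd => /andP[r0 ->]; rewrite ltW.
have cr : c r != 0.
  rewrite gt_eqF//; apply: (lt_le_trans _ (cge r _)).
    by rewrite divr_gt0// mulr_gt0 ?pi_gt0// exprn_gt0//; case/andP: rd.
  by case/andP: rd => -> /=; move/lt_le_trans; apply.
have oB := @box_open R x (s / 2).
exists (box x (s / 2)); split.
- by split; rewrite subrr normr0 divr_gt0.
- apply: (sol_ext oB _ (circ_mean_helm (r / c r) oA oB H (@continuous_cos R) BA rd')) => y By.
  have [E _] := gf A _ _ _ _ _ _ _ y r oA H d dd0 (BA _ By) rd.
  by rewrite mulrAC E mulfK.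
- apply: (sol_ext oB _ (circ_mean_helm (r / c r) oA oB H (@continuous_sin R) BA rd')) => y By.
  have [_ E] := gf A _ _ _ _ _ _ _ y r oA H d dd0 (BA _ By) rd.
  by rewrite mulrAC E mulfK.
Qed.

(** The moment is at most [2 * pi * r * M] and [c r] is at least [pi * r ^ 2 / 2]; the quotient is
    [4 / r * M]. *)
Lemma sol_derive_bound mu : exists d0 : R, 0 < d0 /\ forall A u x (s r M : R), open A ->
  sol A mu u -> box x s `<=` A -> s <= d0 -> 0 < r < s ->
  (forall y, box x s y -> `|u y| <= M) ->
  `|'D_e1 u x| <= 4 / r * M /\ `|'D_e2 u x| <= 4 / r * M.
Proof.
have [d0 [c [d00 cge gf]]] := gradient_formula mu.
exists d0; split => // A u x s r M oA su xA sd rs uM.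
have H := sol_helm su.
have [E1 E2] := gf A _ _ _ _ _ _ _ x r oA H s sd xA rs.
have [r0 rs'] := andP rs.
have uc y : A y -> {for y, continuous u} by case: su => -[h _ _] _; exact: (C1_continuous oA h).
have pA t : box x s (pol x r t) by apply: pol_box; rewrite gtr0_norm.
have M0 : 0 <= M by apply: le_trans (uM _ (pA 0)).
have cr := cge r; rewrite r0 (lt_le_trans rs' sd) in cr; move: cr => /(_ isT) cr.
have fin (m : R -> R) (a : R) : continuous m -> (forall t, `|m t| <= 1) ->
  r * circ (fun t => m t * u (pol x r t)) = a * c r -> `|a| <= 4 / r * M.
  move=> mc m1 E.
  have : `|circ (fun t => m t * u (pol x r t))| <= 2 * pi * M.
    apply: circ_abs; first by apply: (circ_pol_cont uc mc) => t; apply: xA.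
    by move=> t _; rewrite normrM -[leRHS]mul1r ler_pM//; exact: uM.
  move: E; move: (circ _) => C E hC.
  have p0 : 0 < pi :> R := pi_gt0 R.
  have cp : 0 < c r by apply: lt_le_trans cr; rewrite divr_gt0// mulr_gt0// exprn_gt0.
  have : `|a| * c r <= r * (2 * pi * M).
    by rewrite -(gtr0_norm cp) -normrM -E normrM gtr0_norm// ler_wpM2l// ltW.
  have : `|a| * (pi * r ^+ 2 / 2) <= `|a| * c r by rewrite ler_wpM2l.
  move=> /le_trans h /h {}h.
  have q : 0 < pi * r ^+ 2 / 2 by rewrite divr_gt0// mulr_gt0// exprn_gt0.
  rewrite -(ler_pM2r q) (le_trans h)//.
  have -> : 4 / r * M * (pi * r ^+ 2 / 2) = r * (2 * pi * M) by field; rewrite gt_eqF.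
  exact: lexx.
split.
  by apply: (fin _ _ (@continuous_cos R) _ E1) => t; have [] := cos_sin_le1 t.
by apply: (fin _ _ (@continuous_sin R) _ E2) => t; have [] := cos_sin_le1 t.
Qed.

Definition dir (b : bool) : P2 := if b then e1 else e2.

(** The head of the word is the derivative taken last. [Dw_rcons] exposes the one taken first, on
    which [dbound] and the Taylor polynomials recurse. *)
Definition Dw (w : seq bool) (f : P2 -> R) := Defs.iterD (map dir w) f.

Lemma Dw_cons b w f : Dw (b :: w) f = 'D_(dir b) (Dw w f).
Proof. by []. Qed.

Lemma Dw_rcons b w f : Dw (rcons w b) f = Dw w ('D_(dir b) f).
Proof. by elim: w => [//|c w IH]; rewrite rcons_cons !Dw_cons IH. Qed.

Lemma sol_Dw A mu u w : open A -> sol A mu u -> sol A mu (Dw w u).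
Proof.
move=> oA su; elim: w => [//|b w IH]; rewrite Dw_cons.
by have [h1 h2] := sol_derive oA IH; case: b; [exact: h1|exact: h2].
Qed.

(** Every differentiation gives up a margin [rho]. The circle used inside that margin has radius
    [rho / 2], whence the factor [4 / (rho / 2)]. *)
Lemma sol_Dw_bound mu : exists d0 : R, 0 < d0 /\ forall A u x0 (s rho M : R) w, open A ->
  sol A mu u -> box x0 s `<=` A -> 0 < rho <= d0 ->
  (forall y, box x0 s y -> `|u y| <= M) ->
  forall x, box x0 (s - (size w)%:R * rho) x -> `|Dw w u x| <= (8 / rho) ^+ size w * M.
Proof.
have [d0 [d00 H]] := sol_derive_bound mu.
exists d0; split => // A u x0 s rho M w oA su xA /andP[rho0 rhod] uM.
elim: w => [|b w IH] x.
  by rewrite mul0r subr0 expr0 mul1r; exact: uM.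
move=> xx0; rewrite Dw_cons /=.
have sub y : box x rho y -> box x0 (s - (size w)%:R * rho) y.
  move=> yx.
  have := @box_sub R x0 x (s - (size (b :: w))%:R * rho) (s - (size w)%:R * rho) xx0.
  have -> : s - (size w)%:R * rho - (s - (size (b :: w))%:R * rho) = rho.
    by rewrite /= -natr1; ring.
  apply => //; case: xx0 => h _; apply: ltW; exact: le_lt_trans h.
have sub2 y : box x rho y -> A y.
  move=> /sub [h1 h2]; apply: xA; split.
    by apply: (lt_le_trans h1); rewrite gerBl mulr_ge0// ltW.
  by apply: (lt_le_trans h2); rewrite gerBl mulr_ge0// ltW.
have rr : 0 < rho / 2 < rho by apply/andP; split; lra.
have [B1 B2] := H A (Dw w u) x rho (rho / 2) _ oA (sol_Dw w oA su) sub2 rhod rr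
  (fun y yx => IH y (sub y yx)).
have e : 4 / (rho / 2) * ((8 / rho) ^+ size w * M) = (8 / rho) ^+ (size w).+1 * M.
  rewrite exprS; move: (_ ^+ size w) => z; field.
  by rewrite gt_eqF.
by rewrite -e; case: b {xx0 sub}; [exact: B1|exact: B2].
Qed.

(** [n ^ n] is at most the product of the n factors from n + 1 to 2n. That product is [n!] times the
    middle binomial coefficient of order 2n, which is at most the full row sum [2 ^ (2n)]. *)
Lemma expnn_le n : (n ^ n <= 4 ^ n * n`!)%N.
Proof.
have h : (n ^ n <= (n + n) ^_ n)%N.
  rewrite ffact_prod -[X in (_ ^ X <= _)%N]card_ord -prod_nat_const.
  by apply: leq_prod => i _; rewrite -addnBA ?leq_addr// ltnW.
apply: (leq_trans h); rewrite -bin_ffact leq_mul2r; apply/orP; right.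
rewrite (_ : 4 = 2 ^ 2)%N// -expnM mul2n -addnn.
have := expnDn 1 1 (n + n); rewrite add1n => ->.
have nn : (n < (n + n).+1)%N by rewrite ltnS leq_addr.
by rewrite (bigD1 (Ordinal nn))//= !exp1n !muln1 leq_addr.
Qed.

(* Cauchy-type estimates: the radius lost at each of the [n] differentiations is [r / (2 n)],
   and [n ^ n <= 4 ^ n * n`!]. *)
Lemma sol_cauchy mu A u x0 : open A -> sol A mu u -> A x0 -> exists r M K : R,
  [/\ 0 < r, 0 < K, 0 <= M, box x0 r `<=` A & forall w x, box x0 r x ->
    `|Dw w u x| <= M * K ^+ size w * (size w)`!%:R].
Proof.
move=> oA su Ax.
have [d0 [d00 H]] := sol_Dw_bound mu.
have [[h _ _] _] := su.
have uc : {for x0, continuous u} by exact: (C1_continuous oA h).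
have /cvgrPdist_lt /(_ 1 ltr01) u1 := uc.
have N : nbhs x0 (A `&` [set y | `|u x0 - u y| < 1]).
  exact: (filterI (open_nbhs_nbhs (conj oA Ax)) u1).
case/nbhs_boxP: N => s0 [s00 s0A].
pose s := Num.min s0 d0.
have sp : 0 < s by rewrite lt_min s00.
have sA y : box x0 s y -> A y /\ `|u x0 - u y| < 1.
  by rewrite /s => -[y1 y2]; apply: s0A; split; [move: y1|move: y2]; rewrite lt_min => /andP[].
have uM y : box x0 s y -> `|u y| <= `|u x0| + 1.
  move=> /sA[_ /ltW h1]; rewrite addrC -lerBlDr; apply: le_trans h1.
  by rewrite distrC; exact: lerB_dist.
(* With [rho = s / (2 n)] the factor [8 / rho] is [16 n / s]; replacing [n ^ n] by [4 ^ n * n!]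
   turns [16 / s] into [64 / s]. Order 0 is treated apart, since [rho] divides by [n]. *)
exists (s / 2), (`|u x0| + 1), (64 / s); split.
- by rewrite divr_gt0.
- by rewrite divr_gt0.
- by rewrite addr_ge0.
- move=> y [y1 y2]; apply: (sA y _).1.
  by split; [apply: lt_le_trans y1 _|apply: lt_le_trans y2 _]; lra.
move=> w x xs; have [w0|wn0] := posnP (size w).
  have -> : w = [::] by apply: size0nil.
  rewrite expr0 mulr1 fact0 mulr1; apply: uM.
  by case: xs => x1 x2; split; [apply: lt_le_trans x1 _|apply: lt_le_trans x2 _]; lra.
have wp : 0 < (size w)%:R :> R by rewrite ltr0n.
pose rho := s / (2 * (size w)%:R).
have rho0 : 0 < rho by rewrite divr_gt0// mulr_gt0.
have rhod : rho <= d0.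
  apply: (@le_trans _ _ s); last by rewrite ge_min lexx orbT.
  rewrite ler_pdivrMr ?mulr_gt0// ler_peMr ?ltW//.
  have : 1 <= (size w)%:R :> R by rewrite ler1n.
  by lra.
have rr : 0 < rho <= d0 by rewrite rho0.
have e : s - (size w)%:R * rho = s / 2 by rewrite /rho; field; rewrite gt_eqF.
have := H A u x0 s rho _ w oA su (fun y h => (sA y h).1) rr uM x.
rewrite e => /(_ xs) /le_trans; apply.
have -> : 8 / rho = 16 / s * (size w)%:R.
  by rewrite /rho; field; rewrite !gt_eqF.
rewrite exprMn.
have := expnn_le (size w); rewrite -(ler_nat R) natrM !natrX => h2.
have -> : (64 / s) ^+ size w = (16 / s) ^+ size w * 4 ^+ size w.
  by rewrite -exprMn; congr (_ ^+ _); field; rewrite gt_eqF.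
rewrite mulrC -!mulrA; apply: ler_wpM2l; first by rewrite addr_ge0.
apply: ler_wpM2l; last exact: h2.
by rewrite exprn_ge0// divr_ge0// ltW.
Qed.

End Regularity.

(** * Gevrey estimates and analyticity *)

Section Gevrey.
Variable R : realType.
Notation P2 := (R * R)%type.
Notation e1 := (e1 R).
Notation e2 := (e2 R).

Lemma le_refl_eq (x y : R) : x = y -> x <= y.
Proof. by move=> ->. Qed.

(** The recursion follows the derivative taken first and shifts the sequence of bounds; in this form
    the product rule is an induction on [n]. *)
Fixpoint dbound (B : set P2) (n : nat) (a : nat -> R) (f : P2 -> R) : Prop :=
  (forall x, B x -> `|f x| <= a 0%N) /\
  match n with
  | 0%N => True
  | n'.+1 => [/\ C1 B f, dbound B n' (fun k => a k.+1) ('D_e1 f) &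
                 dbound B n' (fun k => a k.+1) ('D_e2 f)]
  end.

Lemma dbound_le B n (a b : nat -> R) f : (forall k, a k <= b k) -> dbound B n a f -> dbound B n b f.
Proof.
elim: n a b f => [|n IH] a b f ab [fa fD]; split.
- by move=> x /fa /le_trans; apply.
- by [].
- by move=> x /fa /le_trans; apply.
- case: fD => h h1 h2; split; [exact: h|apply: IH h1 => k; exact: ab|apply: IH h2 => k; exact: ab].
Qed.

Lemma C1_ext (B : set P2) (f g : P2 -> R) : open B -> (forall x, B x -> f x = g x) -> C1 B f ->
  [/\ C1 B g, forall x, B x -> 'D_e1 f x = 'D_e1 g x & forall x, B x -> 'D_e2 f x = 'D_e2 g x].
Proof.
move=> oB fg fC; have h := C1_grad fC; have hg := grad_ext oB fg h.
split; first exact: (grad_C1 oB hg).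
- by move=> x Bx; rewrite (grad_D1 hg Bx).
- by move=> x Bx; rewrite (grad_D2 hg Bx).
Qed.

Lemma dbound_ext B n (a : nat -> R) f g : open B -> (forall x, B x -> f x = g x) ->
  dbound B n a f -> dbound B n a g.
Proof.
move=> oB; elim: n a f g => [|n IH] a f g fg [fa fD]; split.
- by move=> x Bx; rewrite -fg//; exact: fa.
- by [].
- by move=> x Bx; rewrite -fg//; exact: fa.
- case: fD => h h1 h2; have [hg e1 e2] := C1_ext oB fg h.
  by split; [exact: hg|exact: IH e1 h1|exact: IH e2 h2].
Qed.

Lemma dbound_words B n (a : nat -> R) f : (forall w, C1 B (Dw w f)) ->
  (forall w x, B x -> `|Dw w f x| <= a (size w)) -> dbound B n a f.
Proof.
elim: n a f => [|n IH] a f fC fa; split; try by [].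
- by move=> x; exact: (fa [::]).
- by move=> x; exact: (fa [::]).
- split; first exact: (fC [::]).
  + apply: IH => [w|w x Bx]; rewrite -(Dw_rcons true); first exact: fC.
    by rewrite -(size_rcons w true); exact: fa.
  + apply: IH => [w|w x Bx]; rewrite -(Dw_rcons false); first exact: fC.
    by rewrite -(size_rcons w false); exact: fa.
Qed.

Lemma gradD B (f g f1 f2 g1 g2 : P2 -> R) : has_grad B f f1 f2 -> has_grad B g g1 g2 ->
  has_grad B (fun x => f x + g x) (fun x => f1 x + g1 x) (fun x => f2 x + g2 x).
Proof.
move=> hf hg x Bx; have [a1 a2 a3 a4] := hf x Bx; have [b1 b2 b3 b4] := hg x Bx.
split; [exact: derD a1 b1|exact: derD a2 b2|exact: cvgD a3 b3|exact: cvgD a4 b4].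
Qed.

Lemma gradM B (f g f1 f2 g1 g2 : P2 -> R) : open B -> has_grad B f f1 f2 -> has_grad B g g1 g2 ->
  has_grad B (fun x => f x * g x) (fun x => f1 x * g x + f x * g1 x)
    (fun x => f2 x * g x + f x * g2 x).
Proof.
move=> oB hf hg x Bx; have [a1 a2 a3 a4] := hf x Bx; have [b1 b2 b3 b4] := hg x Bx.
have fc := grad_cont oB hf Bx; have gc := grad_cont oB hg Bx.
split; [exact: derM a1 b1|exact: derM a2 b2| |].
- exact: (cvgD (cvgM a3 gc) (cvgM fc b3)).
- exact: (cvgD (cvgM a4 gc) (cvgM fc b4)).
Qed.

Lemma dboundD B n (a b : nat -> R) f g : open B -> dbound B n a f -> dbound B n b g ->
  dbound B n (fun k => a k + b k) (fun x => f x + g x).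
Proof.
move=> oB; elim: n a b f g => [|n IH] a b f g [fa fD] [gb gD]; split; try by [].
- by move=> x Bx; apply: le_trans (ler_normD _ _) (lerD (fa x Bx) (gb x Bx)).
- by move=> x Bx; apply: le_trans (ler_normD _ _) (lerD (fa x Bx) (gb x Bx)).
- case: fD => hf f1 f2; case: gD => hg g1 g2.
  have h := gradD (C1_grad hf) (C1_grad hg).
  split; first exact: (grad_C1 oB h).
  + by apply: (dbound_ext oB _ (IH _ _ _ _ f1 g1)) => x Bx; rewrite (grad_D1 h Bx).
  + by apply: (dbound_ext oB _ (IH _ _ _ _ f2 g2)) => x Bx; rewrite (grad_D2 h Bx).
Qed.

(** The rising factorial (p+1)(p+2)...(p+k), which is the k-th derivative at 0 of (1 - t)^-(p+1).
    Multiplying two such powers adds the exponents, which is why the product of weights [p] and [q]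
    has weight [(p + q).+1]. *)
Definition rfact (p k : nat) : R := (k + p)`!%:R / p`!%:R.

Lemma factn0 p : p`!%:R != 0 :> R.
Proof. by rewrite pnatr_eq0 -lt0n fact_gt0. Qed.

Lemma rfactS p k : rfact p k.+1 = p.+1%:R * rfact p.+1 k.
Proof.
rewrite /rfact addSn addnS (factS p) natrM.
have p0 : p.+1%:R != 0 :> R by rewrite pnatr_eq0.
by rewrite invfM mulrCA mulVKf// mulrC.
Qed.

Lemma rfact_le p k : rfact p k <= 2 ^+ (k + p) * k`!%:R.
Proof.
rewrite /rfact ler_pdivrMr ?ltr0n ?fact_gt0// -natrX -!natrM ler_nat.
have pk : (p <= k + p)%N by rewrite leq_addl.
rewrite -(bin_fact pk) addnK mulnAC -mulnA leq_mul2r; apply/orP; right.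
have := expnDn 1 1 (k + p); rewrite add1n => ->.
have nn : (p < (k + p).+1)%N by rewrite ltnS.
by rewrite (bigD1 (Ordinal nn))//= !exp1n !muln1 leq_addr.
Qed.

Lemma dboundS B m (c : nat -> R) f : dbound B m.+1 c f -> dbound B m c f.
Proof.
elim: m c f => [|m IH] c f [h1 h2]; first exact: (conj h1 I).
split; first exact: h1.
by case: h2 => k1 k2 k3; split; [exact: k1|exact: (IH _ _ k2)|exact: (IH _ _ k3)].
Qed.

(* The weights [rfact p k = (k+p)!/p!] reproduce themselves under the Leibniz rule. *)
Lemma dboundM B n (K : R) : open B -> 0 <= K -> forall (a b : R) p q f g,
  0 <= a -> 0 <= b ->
  dbound B n (fun k => a * K ^+ k * rfact p k) f -> dbound B n (fun k => b * K ^+ k * rfact q k) g ->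
  dbound B n (fun k => a * b * K ^+ k * rfact (p + q).+1 k) (fun x => f x * g x).
Proof.
move=> oB K0.
have z (a b : R) p q f g : (forall x, B x -> `|f x| <= a * K ^+ 0 * rfact p 0) ->
    (forall x, B x -> `|g x| <= b * K ^+ 0 * rfact q 0) -> 
    (forall x, B x -> `|f x * g x| <= a * b * K ^+ 0 * rfact (p + q).+1 0).
  rewrite /rfact !add0n !divff ?factn0// expr0 !mulr1 => fa gb x Bx.
  by rewrite normrM ler_pM//; [exact: fa|exact: gb].
elim: n => [|n IH] a b p q f g a0 b0 F G; have [fa fD] := F; have [gb gD] := G.
  exact: (conj (z _ _ _ _ _ _ fa gb) I).
split; first exact: (z _ _ _ _ _ _ fa gb).
- case: fD => hf f1 f2; case: gD => hg g1 g2.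
  have h := gradM oB (C1_grad hf) (C1_grad hg).
  have sh (c : R) r (h0 : P2 -> R) : dbound B n (fun k => c * K ^+ k.+1 * rfact r k.+1) h0 ->
      dbound B n (fun k => (c * K * r.+1%:R) * K ^+ k * rfact r.+1 k) h0.
    apply: dbound_le => k; rewrite exprS rfactS le_eqVlt; apply/orP; left; apply/eqP; ring.
  have nsh (c : R) r (h0 : P2 -> R) : 0 <= c -> 0 <= c * K * r.+1%:R.
    by move=> c0; rewrite !mulr_ge0.
  (* The two terms of the product rule carry the factors p + 1 and q + 1. Their sum is exactly the
     factor p + q + 2 that [rfactS] produces for the product, so no constant is lost in the
     induction. *)
  have E k : a * K * p.+1%:R * b * K ^+ k * rfact (p.+1 + q).+1 k +
      a * (b * K * q.+1%:R) * K ^+ k * rfact (p + q.+1).+1 k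
      = a * b * K ^+ k.+1 * rfact (p + q).+1 k.+1.
    rewrite rfactS addnS addSn exprS.
    have -> : (p + q).+2%:R = p.+1%:R + q.+1%:R :> R by rewrite -natrD addnS addSn.
    by move: (rfact _ _) => w; ring.
  split; first exact: (grad_C1 oB h).
  + have := dboundD oB (IH _ _ _ _ _ _ (nsh a p f a0) b0 (sh _ _ _ f1) (dboundS G))
     (IH _ _ _ _ _ _ a0 (nsh b q g b0) (dboundS F) (sh _ _ _ g1)).
    move=> /(dbound_le (fun k => le_refl_eq (E k))) H.
    apply: (dbound_ext oB _ H) => x Bx; by rewrite (grad_D1 h Bx).
  + have := dboundD oB (IH _ _ _ _ _ _ (nsh a p f a0) b0 (sh _ _ _ f2) (dboundS G))
     (IH _ _ _ _ _ _ a0 (nsh b q g b0) (dboundS F) (sh _ _ _ g2)).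
    move=> /(dbound_le (fun k => le_refl_eq (E k))) H.
    apply: (dbound_ext oB _ H) => x Bx; by rewrite (grad_D2 h Bx).
Qed.

End Gevrey.

(** * Factorial derivative bounds and Taylor polynomials *)

Section Taylor.
Variable R : realType.
Notation P2 := (R * R)%type.
Notation e1 := (e1 R).
Notation e2 := (e2 R).

(** Gevrey bounds of order 1, those of real analytic functions; the constants are uniform in the
    order [n]. *)
Definition gevrey (B : set P2) (f : P2 -> R) := exists M K : R, [/\ 0 <= M, 0 < K &
  forall n, dbound B n (fun k => M * K ^+ k * k`!%:R) f].

Lemma dbound_weaken B n (M K M' K' : R) f : 0 <= M <= M' -> 0 <= K <= K' ->
  dbound B n (fun k => M * K ^+ k * k`!%:R) f -> dbound B n (fun k => M' * K' ^+ k * k`!%:R) f.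
Proof.
move=> /andP[M0 MM] /andP[K0 KK]; apply: dbound_le => k.
rewrite ler_wpM2r// ler_pM ?exprn_ge0//.
by rewrite lerXn2r ?nnegrE// (le_trans K0).
Qed.

Lemma rfact0 k : rfact R 0 k = k`!%:R.
Proof. by rewrite /rfact addn0 fact0 divr1. Qed.

(** The weight exceeds [k!] by a factor of at most [2 ^ (k + p)], which is absorbed by enlarging [M]
    and doubling [K]. *)
Lemma gevrey_rfact B f : (exists M K : R, exists p, [/\ 0 <= M, 0 < K &
  forall n, dbound B n (fun k => M * K ^+ k * rfact R p k) f]) -> gevrey B f.
Proof.
move=> [M [K [p [M0 K0 H]]]]; exists (M * 2 ^+ p), (2 * K); split.
- by rewrite mulr_ge0// exprn_ge0.
- by rewrite mulr_gt0.
- move=> n; apply: dbound_le (H n) => k.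
  have := rfact_le R p k; rewrite exprD => h.
  have -> : M * 2 ^+ p * (2 * K) ^+ k * k`!%:R = M * K ^+ k * (2 ^+ k * 2 ^+ p * k`!%:R).
    by rewrite exprMn; move: (2 ^+ p) (2 ^+ k) (K ^+ k) => x y z; ring.
  by rewrite ler_wpM2l// mulr_ge0// exprn_ge0// ltW.
Qed.

Lemma gevreyM B f g : open B -> gevrey B f -> gevrey B g -> gevrey B (fun x => f x * g x).
Proof.
move=> oB [M [K [M0 K0 F]]] [N [L [N0 L0 G]]]; apply: gevrey_rfact.
pose H := Num.max K L.
have KH : 0 <= K <= H by rewrite ltW//= le_max lexx.
have LH : 0 <= L <= H by rewrite ltW//= le_max lexx orbT.
have H0 : 0 < H by rewrite lt_max K0.
exists (M * N), H, (0 + 0).+1; split => [||n]; [exact: mulr_ge0|exact: H0|].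
have MM : 0 <= M <= M by rewrite M0 /=.
have NN : 0 <= N <= N by rewrite N0 /=.
apply: (dboundM oB (ltW H0) M0 N0).
  by apply: dbound_le (dbound_weaken MM KH (F n)) => k; rewrite rfact0.
by apply: dbound_le (dbound_weaken NN LH (G n)) => k; rewrite rfact0.
Qed.

Lemma gevreyD B f g : open B -> gevrey B f -> gevrey B g -> gevrey B (fun x => f x + g x).
Proof.
move=> oB [M [K [M0 K0 F]]] [N [L [N0 L0 G]]].
pose H := Num.max K L.
have KH : 0 <= K <= H by rewrite ltW//= le_max lexx.
have LH : 0 <= L <= H by rewrite ltW//= le_max lexx orbT.
have H0 : 0 < H by rewrite lt_max K0.
exists (M + N), H; split => [||n]; [exact: addr_ge0|exact: H0|].
have MM : 0 <= M <= M by rewrite M0 /=.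
have NN : 0 <= N <= N by rewrite N0 /=.
have := dboundD oB (dbound_weaken MM KH (F n)) (dbound_weaken NN LH (G n)).
by apply: dbound_le => k; rewrite -!mulrDl.
Qed.

Lemma gevrey_cst B (c : R) : open B -> gevrey B (fun=> c).
Proof.
move=> oB; exists `|c|, 1; split => // n.
have g0 (k : R) : has_grad B (fun=> k) (fun=> 0) (fun=> 0).
  by move=> x _; split; [exact: derC|exact: derC|exact: cvg_cst|exact: cvg_cst].
have z n' (a : nat -> R) : (forall k, 0 <= a k) -> dbound B n' a (fun=> 0).
  elim: n' a => [|n' IH] a a0; first by split=> // x _; rewrite normr0.
  split; first by move=> x _; rewrite normr0.
  split; first exact: (grad_C1 oB (g0 0)).
  - by apply: (dbound_ext oB _ (IH _ (fun k => a0 k.+1))) => x Bx; rewrite (grad_D1 (g0 0) Bx).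
  - by apply: (dbound_ext oB _ (IH _ (fun k => a0 k.+1))) => x Bx; rewrite (grad_D2 (g0 0) Bx).
have p k : 0 <= `|c| * 1 ^+ k * k`!%:R by rewrite !mulr_ge0 ?exprn_ge0.
case: n => [|n]; first by split => // x _; rewrite expr0 fact0 !mulr1.
split; first by move=> x _; rewrite expr0 fact0 !mulr1.
split; first exact: (grad_C1 oB (g0 c)).
- by apply: (dbound_ext oB _ (z _ _ (fun k => p k.+1))) => x Bx; rewrite (grad_D1 (g0 c) Bx).
- by apply: (dbound_ext oB _ (z _ _ (fun k => p k.+1))) => x Bx; rewrite (grad_D2 (g0 c) Bx).
Qed.

Lemma gevrey_derive B f : gevrey B f -> gevrey B ('D_e1 f) /\ gevrey B ('D_e2 f).
Proof.
move=> [M [K [M0 K0 F]]].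
have E k : M * K ^+ k.+1 * k.+1`!%:R <= M * K * K ^+ k * rfact R 1 k.
  by rewrite /rfact addn1 (_ : 1`! = 1)%N// divr1 exprS mulrA.
have MK : 0 <= M * K by rewrite mulr_ge0// ltW.
split; apply: gevrey_rfact; exists (M * K), K, 1%N; split => // n.
- by case: (F n.+1) => _ [_ h1 h2]; exact: (dbound_le E h1).
- by case: (F n.+1) => _ [_ h1 h2]; exact: (dbound_le E h2).
Qed.

Lemma gevrey_ext B f g : open B -> (forall x, B x -> f x = g x) -> gevrey B f -> gevrey B g.
Proof.
by move=> oB fg [M [K [M0 K0 F]]]; exists M, K; split => // n; exact: (dbound_ext oB fg (F n)).
Qed.

Lemma sol_gevrey A (mu : R) u x0 : open A -> sol A mu u -> A x0 ->
  exists r : R, [/\ 0 < r, box x0 r `<=` A & gevrey (box x0 r) u].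
Proof.
move=> oA su Ax; have [r [M [K [r0 K0 M0 rA H]]]] := sol_cauchy oA su Ax.
exists r; split => //; exists M, K; split => // n.
apply: dbound_words => [w|w x]; last exact: H.
by have [[h _ _] _] := sol_Dw w oA su; exact: (C1_sub rA h).
Qed.

Variable x0 : P2.

(** The homogeneous part of degree n of the Taylor expansion: the n-th power of the derivation along
    [h], applied to [f] at [x0] and divided by [n!]. *)
Fixpoint taylor_term (n : nat) (f : P2 -> R) (h : P2) : R :=
  match n with
  | 0%N => f x0
  | n'.+1 => (h.1 * taylor_term n' ('D_e1 f) h + h.2 * taylor_term n' ('D_e2 f) h) / n'.+1%:R
  end.

Lemma taylor_hom n f (h : P2) t : taylor_term n f (t * h.1, t * h.2) = t ^+ n * taylor_term n f h.
Proof.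
elim: n f => [|n IH] f /=; first by rewrite expr0 mul1r.
move: ('D_e1 f) ('D_e2 f) => g1 g2; rewrite !IH exprS.
have aux (a b c d k l m : R) : (a * b * (c * k) + a * d * (c * l)) / m = a * c * ((b * k + d * l) / m).
  by ring.
exact: aux.
Qed.

Lemma derX n (t : R) : is_derive t (1 : R) (fun t => t ^+ n.+1) (n.+1%:R * t ^+ n).
Proof.
elim: n => [|n IH].
  have -> : (fun t : R => t ^+ 1) = id by apply/funext => s; rewrite expr1.
  by apply: (is_derive_eq (is_derive_id t 1)); rewrite expr0 mulr1.
have -> : (fun t : R => t ^+ n.+2) = (fun t => t * t ^+ n.+1) by apply/funext => s; rewrite exprS.
apply: (is_derive_eq (derM (is_derive_id t 1) IH)).
by rewrite -[n.+2%:R]natr1 exprS; move: (t ^+ n) (n.+1%:R) => a b; ring.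
Qed.

Lemma der_psum (c : nat -> R) n (t : R) : is_derive t (1 : R) (fun t => \sum_(i < n.+1) t ^+ i * c i)
  (\sum_(i < n) t ^+ i * (i.+1%:R * c i.+1)).
Proof.
elim: n => [|n IH].
  have -> : (fun t : R => \sum_(i < 1) t ^+ i * c i) = (fun=> c 0%N).
    by apply/funext => s; rewrite big_ord_recl big_ord0 expr0 mul1r addr0.
  by rewrite big_ord0; exact: derC.
have -> : (fun t : R => \sum_(i < n.+2) t ^+ i * c i) =
   (fun t => (\sum_(i < n.+1) t ^+ i * c i) + t ^+ n.+1 * c n.+1).
  by apply/funext => s; rewrite big_ord_recr.
apply: (is_derive_eq (derD IH (derM (derX n t) (derC t 1 (c n.+1))))).
by rewrite mulr0 addr0 [RHS]big_ord_recr /= [n.+1%:R * _]mulrC mulrA.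
Qed.

(** Monotonicity in place of an integral: by the mean value theorem, [C * t ^ N.+1] minus [E] or
    plus [E] does not decrease from 0 to 1. *)
Lemma growth (E E' : R -> R) (C : R) (N : nat) :
  (forall t : R, 0 <= t <= 1 -> is_derive t (1 : R) E (E' t)) ->
  (forall t : R, 0 <= t <= 1 -> `|E' t| <= C * N.+1%:R * t ^+ N) -> `|E 1 - E 0| <= C.
Proof.
move=> dE bE.
have aux (F F' : R -> R) : (forall t : R, 0 <= t <= 1 -> is_derive t (1 : R) F (F' t)) ->
  (forall t : R, 0 <= t <= 1 -> `|F' t| <= C * N.+1%:R * t ^+ N) -> F 1 - F 0 <= C.
  move=> dF bF.
  pose g (t : R) := C * t ^+ N.+1 + - F t.
  have [t|t] := @mvt_abs R g (fun t => C * (N.+1%:R * t ^+ N) + - F' t) 0 1.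
    rewrite min_l// max_r// => t01; exact: (derD (derZ C (derX N t)) (derN (dF t t01))).
  rewrite min_l// max_r// => t01.
  rewrite /g expr1n expr0n /= mulr0 mulr1 subr0 mulr1 => e.
  have := bF t t01; rewrite ler_norml => /andP[_]; rewrite -mulrA => h.
  have : 0 <= C - F 1 - (0 - F 0) by rewrite e subr_ge0.
  by lra.
rewrite ler_norml; apply/andP; split; last exact: (aux E E').
have := aux (fun t => - E t) (fun t => - E' t) (fun t h => derN (dE t h)).
move=> /(_ _) h; rewrite lerNl; have -> : - (E 1 - E 0) = - E 1 - - E 0 by ring.
by apply: h => t t01; rewrite normrN; exact: bE.
Qed.

Lemma normD_le2 (a b p q c : R) : `|p| <= c -> `|q| <= c ->
  `|a * p + b * q| <= (`|a| + `|b|) * c.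
Proof.
move=> pc qc; apply: le_trans (ler_normD _ _) _.
by rewrite !normrM mulrDl lerD// ler_wpM2l.
Qed.

(** Along the segment from [x0] in direction [h], the derivative of the remainder of [f] is the
    combination, with coefficients [h.1] and [h.2], of the remainders of one order less of the two
    partial derivatives at [t h]. The induction bounds it by a multiple of [t ^ N], and [growth]
    concludes. *)
Lemma taylor_bound (r : R) : 0 < r -> forall N (a : nat -> R) f,
  dbound (box x0 r) N a f -> forall h : P2, `|h.1| < r -> `|h.2| < r ->
  `|f (x0.1 + h.1, x0.2 + h.2) - \sum_(n < N) taylor_term n f h|
     <= (`|h.1| + `|h.2|) ^+ N * a N / N`!%:R.
Proof.
move=> r0; elim => [|N IH] a f [fa fD] h h1 h2.
  rewrite big_ord0 subr0 expr0 mul1r fact0 divr1; apply: fa.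
  by split; rewrite /= addrAC subrr add0r.
case: fD => fC f1 f2.
have fg := C1_grad fC; have oB := @box_open R x0 r.
have tb (t : R) : 0 <= t <= 1 -> `|t * h.1| < r /\ `|t * h.2| < r.
  move=> /andP[t0 t1]; rewrite !normrM ger0_norm//; split.
    by apply: le_lt_trans h1; rewrite ler_piMl.
  by apply: le_lt_trans h2; rewrite ler_piMl.
pose s := `|h.1| + `|h.2|.
pose E (t : R) := f (x0.1 + t * h.1, x0.2 + t * h.2) + - \sum_(n < N.+1) t ^+ n * taylor_term n f h.
pose y (t : R) : P2 := (x0.1 + t * h.1, x0.2 + t * h.2).
pose E' (t : R) := h.1 * ('D_e1 f (y t) - \sum_(n < N) taylor_term n ('D_e1 f) (t * h.1, t * h.2)) +
  h.2 * ('D_e2 f (y t) - \sum_(n < N) taylor_term n ('D_e2 f) (t * h.1, t * h.2)).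
have E0 : E 0 = 0.
  rewrite /E big_ord_recl /= expr0 mul1r big1 ?addr0; last first.
    by move=> i _; rewrite /bump /= expr0n mul0r.
  by rewrite !mul0r !addr0 -surjective_pairing subrr.
have dE (t : R) : 0 <= t <= 1 -> is_derive t (1 : R) E (E' t).
  move=> t01; have [t1 t2] := tb t t01.
  have By : box x0 r (y t) by split; rewrite /= addrAC subrr add0r.
  have D1 := grad_chain (c1 := fun t => x0.1 + t * h.1) (c2 := fun t => x0.2 + t * h.2) oB fg By
    (derAff _ _ _) (derAff _ _ _).
  apply: (is_derive_eq (derD D1 (derN (der_psum (fun n => taylor_term n f h) N t)))).
  rewrite /E' !mulrBr addrACA -opprD; congr (_ - _).
  rewrite !mulr_sumr -big_split /=; apply: eq_bigr => i _.
  rewrite /= (mulrC i.+1%:R) divfK ?pnatr_eq0//.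
  move: ('D_e1 f) ('D_e2 f) => g1 g2.
  by rewrite !taylor_hom (mulrCA h.1) (mulrCA h.2) -mulrDr.
have bE (t : R) : 0 <= t <= 1 -> `|E' t| <= (s ^+ N.+1 * a N.+1 / N.+1`!%:R) * N.+1%:R * t ^+ N.
  move=> t01; have [t1 t2] := tb t t01; have [t0 _] := andP t01.
  have B1 := IH _ _ f1 (t * h.1, t * h.2) t1 t2.
  have B2 := IH _ _ f2 (t * h.1, t * h.2) t1 t2.
  have Ns : `|t * h.1| + `|t * h.2| = t * s by rewrite !normrM ger0_norm// -mulrDr.
  rewrite /= Ns in B1; rewrite /= Ns in B2.
  apply: (le_trans (normD_le2 _ _ B1 B2)).
  rewrite -/s exprMn exprS factS natrM; apply: le_refl_eq.
  have n0 : N.+1%:R != 0 :> R by rewrite pnatr_eq0.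
  have := factn0 R N; move: n0.
  move: (N`!%:R) (N.+1%:R) (s ^+ N) (t ^+ N) (a N.+1) => p q v w z q0 p0.
  by field; rewrite p0.
have := growth dE bE; rewrite E0 subr0 /E.
have -> : (x0.1 + 1 * h.1, x0.2 + 1 * h.2) = (x0.1 + h.1, x0.2 + h.2) by rewrite !mul1r.
have -> : \sum_(n < N.+1) 1 ^+ n * taylor_term n f h = \sum_(n < N.+1) taylor_term n f h.
  by apply: eq_bigr => i _; rewrite expr1n mul1r.
by [].
Qed.

(** The coefficient of [h.1 ^ i * h.2 ^ (n - i)] in [taylor_term], computed by a recursion of Pascal
    type. *)
Fixpoint taylor_coef (n : nat) (f : P2 -> R) (i : nat) : R :=
  match n with
  | 0%N => if i is 0%N then f x0 else 0
  | n'.+1 => ((if i is i'.+1 then taylor_coef n' ('D_e1 f) i' else 0) +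
              taylor_coef n' ('D_e2 f) i) / n'.+1%:R
  end.

Lemma taylor_coef_gt n f i : (n < i)%N -> taylor_coef n f i = 0.
Proof.
elim: n f i => [|n IH] f [|i] //= ni.
move: ('D_e1 f) ('D_e2 f) => g1 g2; by rewrite !IH ?addr0 ?mul0r// ltnW.
Qed.

Lemma taylor_termE n f (h : P2) : taylor_term n f h =
  \sum_(i < n.+1) taylor_coef n f i * h.1 ^+ i * h.2 ^+ (n - i).
Proof.
elim: n f => [|n IH] f; first by rewrite big_ord_recl big_ord0 /= expr0 !mulr1 addr0.
rewrite [LHS]/= [taylor_coef n.+1 f]/=.
move: ('D_e1 f) ('D_e2 f) => g1 g2; rewrite !IH.
have -> : \sum_(i < n.+2) ((if (i : nat) is i'.+1 then taylor_coef n g1 i' else 0) + taylor_coef n g2 i)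
     / n.+1%:R * h.1 ^+ i * h.2 ^+ (n.+1 - i) =
  (\sum_(i < n.+2) (if (i : nat) is i'.+1 then taylor_coef n g1 i' else 0)
      * h.1 ^+ i * h.2 ^+ (n.+1 - i) +
  \sum_(i < n.+2) taylor_coef n g2 i * h.1 ^+ i * h.2 ^+ (n.+1 - i)) / n.+1%:R.
  rewrite -big_split mulr_suml; apply: eq_bigr => i _ /=.
  have aux (X Y d p q : R) : (X + Y) / d * p * q = (X * p * q + Y * p * q) / d by ring.
  exact: aux.
congr ((_ + _) / _).
- rewrite [RHS]big_ord_recl /= !mul0r add0r mulr_sumr; apply: eq_bigr => i _.
  rewrite /bump /= add1n subSS exprS.
  by move: (h.1 ^+ i) (h.2 ^+ _) (taylor_coef _ _ _) => a b c; ring.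
- rewrite [RHS]big_ord_recr /= taylor_coef_gt// !mul0r addr0 mulr_sumr; apply: eq_bigr => i _.
  have ni : (i <= n)%N by rewrite -ltnS.
  rewrite (subSn ni) exprS.
  by move: (h.1 ^+ i) (h.2 ^+ _) (taylor_coef _ _ _) => a b c; ring.
Qed.

(** Each step of the recursion adds two terms, hence a factor 2 per order. *)
Lemma taylor_coef_bound B : B x0 -> forall n (a : nat -> R) f, dbound B n a f ->
  forall i, `|taylor_coef n f i| <= 2 ^+ n * a n / n`!%:R.
Proof.
move=> Bx; elim => [|n IH] a f [fa fD] i.
  rewrite fact0 expr0 mul1r divr1; have := fa _ Bx.
  by case: i => //= i; rewrite normr0; apply: le_trans.
case: fD => _ f1 f2.
rewrite [taylor_coef _ _ _]/= normrM normfV normr_nat ler_pdivrMr ?ltr0n//.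
have h1 := IH _ _ f1; have h2 := IH _ _ f2 i.
apply: le_trans (ler_normD _ _) _.
have h0 : 0 <= 2 ^+ n * a n.+1 / n`!%:R by apply: le_trans h2.
have h3 : `|match i with 0%N => 0 | i'.+1 => taylor_coef n ('D_e1 f) i' end| <=
   2 ^+ n * a n.+1 / n`!%:R by case: i {h2} => [|i]; [rewrite normr0|exact: h1].
apply: le_trans (lerD h3 h2) _; apply: le_refl_eq.
have n0 : n.+1%:R != 0 :> R by rewrite pnatr_eq0.
rewrite factS natrM exprS.
have := factn0 R n; move: n0; move: (n`!%:R) (n.+1%:R) (2 ^+ n) (a n.+1) => p q v w q0 p0.
by field; rewrite p0 q0.
Qed.

End Taylor.

(** * From factorial bounds to convergent double power series *)

Section Analytic.
Variable R : realType.
Notation P2 := (R * R)%type.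
Notation e1 := (e1 R).
Notation e2 := (e2 R).

Lemma gevrey_taylor (x0 : P2) (r : R) f : 0 < r -> gevrey (box x0 r) f ->
  exists M eta : R, [/\ 0 <= M, 0 < eta,
   forall (h : P2) N, `|h.1| < eta -> `|h.2| < eta ->
    `|f (x0.1 + h.1, x0.2 + h.2) - \sum_(n < N) taylor_term x0 n f h| <= M * 8^-1 ^+ N &
   forall (h : P2) i j, `|h.1| < eta -> `|h.2| < eta ->
    `|taylor_coef x0 (i + j) f i| * `|h.1| ^+ i * `|h.2| ^+ j <= M * 8^-1 ^+ i * 8^-1 ^+ j].
Proof.
move=> r0 [M [K [M0 K0 F]]].
(* Then [K * |h.1|] and [K * |h.2|] are at most 1/16. This makes 1/8 a bound both for their sum,
   which governs the remainder, and for their doubles, which govern the coefficients. *)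
pose eta := Num.min r (16 * K)^-1.
have K16 : 0 < 16 * K by rewrite mulr_gt0.
have eta0 : 0 < eta by rewrite lt_min r0 invr_gt0.
have er (z : R) : `|z| < eta -> `|z| < r by rewrite lt_min => /andP[].
have eK (z : R) : `|z| < eta -> K * `|z| <= 16^-1.
  rewrite lt_min => /andP[_ /ltW h].
  apply: le_trans (ler_wpM2l (ltW K0) h) _; apply: le_refl_eq; field.
  by rewrite gt_eqF.
exists M, eta; split => // [h N h1 h2|h i j h1 h2].
- have T := taylor_bound r0 (F N) (er _ h1) (er _ h2).
  apply: (le_trans T).
  have -> : (`|h.1| + `|h.2|) ^+ N * (M * K ^+ N * N`!%:R) / N`!%:R =
     M * (K * `|h.1| + K * `|h.2|) ^+ N.
    rewrite -mulrDr exprMn; move: (factn0 R N).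
    by move: (N`!%:R) (_ ^+ N) (_ ^+ N) => a b c a0; field.
  apply: ler_wpM2l => //; rewrite lerXn2r ?nnegrE ?addr_ge0 ?mulr_ge0 ?(ltW K0)//.
  by have := lerD (eK _ h1) (eK _ h2); lra.
- have Bx : box x0 r x0 by split; rewrite subrr normr0.
  have := taylor_coef_bound Bx (F (i + j)%N) i.
  have -> : 2 ^+ (i + j) * (M * K ^+ (i + j) * (i + j)`!%:R) / (i + j)`!%:R =
     M * (2 * K) ^+ i * (2 * K) ^+ j.
    rewrite -[RHS]mulrA -exprD exprMn; move: (factn0 R (i + j)).
    by move: ((i + j)`!%:R) (_ ^+ (i + j)) (_ ^+ (i + j)) => a b c a0; field.
  move=> cb; rewrite -[leLHS]mulrA.
  have hp : 0 <= `|h.1| ^+ i * `|h.2| ^+ j by rewrite mulr_ge0// exprn_ge0.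
  apply: (le_trans (ler_wpM2r hp cb)).
  have -> : M * (2 * K) ^+ i * (2 * K) ^+ j * (`|h.1| ^+ i * `|h.2| ^+ j) =
     M * ((2 * (K * `|h.1|)) ^+ i * (2 * (K * `|h.2|)) ^+ j).
    rewrite !exprMn; move: (2 ^+ i) (2 ^+ j) (K ^+ i) (K ^+ j) (`|h.1| ^+ i) (`|h.2| ^+ j) => *; ring.
  rewrite -mulrA; apply: ler_wpM2l => //.
  have p (z : R) k : `|z| < eta -> (2 * (K * `|z|)) ^+ k <= 8^-1 ^+ k.
    move=> /eK h'; rewrite lerXn2r ?nnegrE ?mulr_ge0 ?(ltW K0)//; lra.
  by rewrite ler_pM ?exprn_ge0 ?mulr_ge0 ?(ltW K0)//; exact: p.
Qed.

Let sK (a b : R) : a + (b - a) = b.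
Proof. by rewrite addrC subrK. Qed.

Lemma cvg_geom_bound (u : nat -> R) (l M q : R) : 0 <= q < 1 ->
  (forall N, `|l - u N| <= M * q ^+ N) -> u @ \oo --> l.
Proof.
move=> /andP[q0 q1] H; apply/cvgrPdist_le => e e0.
have /cvgrPdist_le /(_ e e0) : (M * q ^+ N) @[N --> \oo] --> M * 0.
  apply: cvgM; first exact: cvg_cst.
  by apply: cvg_expr; rewrite ger0_norm.
rewrite mulr0; apply: filterS => N; rewrite sub0r normrN => h.
by apply: le_trans (H N) _; apply: le_trans h; exact: ler_norm.
Qed.

Lemma triangle_sum (t : nat -> nat -> R) N :
  \sum_(n < N) \sum_(i < n.+1) t i (n - i)%N =
  \sum_(i < N) \sum_(j < N | (i + j < N)%N) t i j.
Proof.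
transitivity (\sum_(n < N) \sum_(i < N | (i <= n)%N) t i (n - i)%N).
  apply: eq_bigr => n _.
  rewrite (big_ord_widen_cond N xpredT (fun i => t i (n - i)%N)) ?ltn_ord//=.
rewrite (exchange_big_dep xpredT)//=; apply: eq_bigr => i _.
rewrite -(big_mkord (fun n => (i <= n)%N) (fun n => t i (n - i)%N)).
rewrite -(big_mkord (fun j => (i + j < N)%N) (fun j => t i j)).
rewrite -(big_nat_widenl i 0 N xpredT) //=.
have iN := ltnW (ltn_ord i).
rewrite -{1}[nat_of_ord i]add0n big_addn.
rewrite (big_nat_widen 0 (N - i) N) ?leq_subr//=.
rewrite big_nat_cond [RHS]big_nat_cond; apply: eq_big => [j|j /andP[_ _]].
  by rewrite ltn_subRL; case: (0 <= j < N)%N.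
by rewrite addnK.
Qed.

Lemma square_le_pow4 N : (N * N <= 4 ^ N)%N.
Proof.
have h : (N <= 2 ^ N)%N by apply: ltnW; exact: ltn_expl.
by rewrite (_ : 4 = 2 * 2)%N// expnMn leq_mul.
Qed.

Lemma geom_sum8 N : \sum_(i < N) (8^-1 : R) ^+ i <= 2.
Proof.
suff -> : \sum_(i < N) (8^-1 : R) ^+ i = 8 / 7 * (1 - 8^-1 ^+ N).
  have : 0 <= (8^-1 : R) ^+ N by rewrite exprn_ge0.
  by lra.
elim: N => [|N IH]; first by rewrite big_ord0 expr0 subrr mulr0.
by rewrite big_ord_recr /= IH exprS; move: (_ ^+ N) => z; field.
Qed.

(** Taylor polynomials sum over the triangle i + j < N, while analyticity is defined with sums over
    squares. The difference has at most N * N terms, each at most [M * 8^-N] because i + j >= N, and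
    [N * N <= 4 ^ N] leaves [M * 2^-N]. *)
Lemma gevrey_analytic (A : set P2) f :
  (forall x0, A x0 -> exists r : R, 0 < r /\ gevrey (box x0 r) f) -> analytic2_on A f.
Proof.
move=> H x0 /H[r [r0 /(gevrey_taylor r0)[M [eta [M0 eta0 tb cb]]]]].
exists eta; split => //; pose c i j := taylor_coef x0 (i + j) f i; exists c => x x1 x2.
pose h : P2 := (x.1 - x0.1, x.2 - x0.2).
have {}cb i j := cb h i j x1 x2.
have g0 k : 0 <= (8^-1 : R) ^+ k by rewrite exprn_ge0.
split.
- apply: nondecreasing_is_cvgn.
    apply/nondecreasing_seqP => N.
    rewrite big_ord_recr /= -[leLHS]addr0 lerD//; last first.
      by apply: sumr_ge0 => j _; rewrite !mulr_ge0// exprn_ge0.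
    apply: ler_sum => i _; rewrite big_ord_recr /= lerDl.
    by rewrite !mulr_ge0// exprn_ge0.
  exists (M * (2 * 2)) => _ [N _ <-].
  apply: le_trans (_ : \sum_(i < N) \sum_(j < N) M * 8^-1 ^+ i * 8^-1 ^+ j <= _).
    by apply: ler_sum => i _; apply: ler_sum => j _; exact: cb.
  under eq_bigr => i _ do rewrite -mulr_sumr.
  rewrite -mulr_suml -mulr_sumr -mulrA ler_wpM2l// ler_pM ?sumr_ge0//; exact: geom_sum8.
- apply: (@cvg_geom_bound _ _ (2 * M) 2^-1); first lra.
  move=> N; pose t i j := c i j * h.1 ^+ i * h.2 ^+ j.
  have tle i j : `|t i j| <= M * 8^-1 ^+ i * 8^-1 ^+ j.
    by rewrite /t !normrM !normrX; exact: cb.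
  have := tb h N x1 x2.
  have -> : (x0.1 + h.1, x0.2 + h.2) = x by rewrite /h /= !sK -surjective_pairing.
  have -> : \sum_(n < N) taylor_term x0 n f h = \sum_(n < N) \sum_(i < n.+1) t i (n - i)%N.
    apply: eq_bigr => n _; rewrite taylor_termE; apply: eq_bigr => i _.
    by rewrite /t /c subnKC// -ltnS.
  rewrite triangle_sum => T.
  have S : `|\sum_(i < N) \sum_(j < N | (i + j < N)%N) t i j - \sum_(i < N) \sum_(j < N) t i j|
     <= M * 2^-1 ^+ N.
    rewrite -sumrB.
    apply: le_trans (ler_norm_sum _ _ _) _.
    apply: le_trans (_ : \sum_(i < N) \sum_(j < N) M * 8^-1 ^+ N <= _); last first.
      have -> : \sum_(i < N) \sum_(j < N) M * (8^-1 : R) ^+ N = M * (8^-1 ^+ N * (N * N)%:R).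
        by rewrite !sumr_const !card_ord -mulrnA mulrA mulr_natr.
      rewrite ler_wpM2l//.
      have -> : (8^-1 : R) ^+ N = 2^-1 ^+ N * 4^-1 ^+ N by rewrite -exprMn; congr (_ ^+ _); field.
      rewrite -mulrA ler_piMr ?exprn_ge0// exprVn mulrC ler_pdivrMr ?exprn_gt0// mul1r.
      by rewrite -natrX ler_nat square_le_pow4.
    apply: ler_sum => i _; rewrite [X in `|_ - X|](bigID (fun j : 'I_N => (i + j < N)%N)) /=.
    rewrite opprD addrA subrr add0r normrN.
    apply: le_trans (ler_norm_sum _ _ _) _.
    rewrite [leRHS](bigID (fun j : 'I_N => (i + j < N)%N)) /= -[leLHS]add0r lerD//.
      by apply: sumr_ge0 => j _; rewrite mulr_ge0.
    apply: ler_sum => j; rewrite -leqNgt => ij; apply: le_trans (tle i j) _.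
    rewrite -mulrA ler_wpM2l// -exprD ler_wiXn2l//; lra.
  apply: (le_trans (ler_distD (\sum_(i < N) \sum_(j < N | (i + j < N)%N) t i j) _ _)).
  have -> : 2 * M * 2^-1 ^+ N = M * 2^-1 ^+ N + M * 2^-1 ^+ N by ring.
  apply: lerD S; apply: le_trans T _; rewrite ler_wpM2l// lerXn2r ?nnegrE//; lra.
Qed.

Lemma taylor_term_flat (x0 : P2) n f h : (forall w, Dw w f x0 = 0) -> taylor_term x0 n f h = 0.
Proof.
elim: n f => [|n IH] f H /=; first exact: (H [::]).
have H1 w : Dw w ('D_e1 f) x0 = 0 by rewrite -(Dw_rcons true); exact: H.
have H2 w : Dw w ('D_e2 f) x0 = 0 by rewrite -(Dw_rcons false); exact: H.
by rewrite (IH _ H1) (IH _ H2) !mulr0 addr0 mul0r.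
Qed.

Lemma gevrey_flat (x0 : P2) (r : R) f : 0 < r -> gevrey (box x0 r) f -> (forall w, Dw w f x0 = 0) ->
  exists s : R, 0 < s /\ forall x, box x0 s x -> f x = 0.
Proof.
move=> r0 /(gevrey_taylor r0)[M [eta [M0 eta0 tb _]]] H; exists eta; split => // x [x1 x2].
have q : 0 <= (8^-1 : R) < 1 by lra.
have h0 : (fun _ : nat => 0 : R) @ \oo --> f x.
  apply: (cvg_geom_bound q (M := M)) => N.
  have := tb (x.1 - x0.1, x.2 - x0.2) N x1 x2.
  have -> : (x0.1 + (x.1 - x0.1), x0.2 + (x.2 - x0.2)) = x.
    by rewrite !sK -surjective_pairing.
  by rewrite big1// => i _; exact: taylor_term_flat.
exact: (cvg_unique _ h0 (cvg_cst (0 : R))).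
Qed.

End Analytic.

(** * Integration in the plane and removable curves *)

Section Plane.
Variable R : realType.
Notation P2 := (R * R)%type.
Notation e1 := (e1 R).
Notation e2 := (e2 R).
Notation mu := (@lebesgue_measure R).
Notation lam2 := (@lebesgue_measure R \x @lebesgue_measure R)%E.

Lemma measurable_box (x : P2) r : measurable (box x r).
Proof.
have -> : box x r = `]x.1 - r, x.1 + r[%classic `*` `]x.2 - r, x.2 + r[%classic.
  by apply/seteqP; split=> y; rewrite /box /= !in_itv /= -!ltr_distl.
by apply: measurableX; exact: measurable_itv.
Qed.

(** Measurability refers to the product sigma-algebra, so an open set is written as a countable
    union of squares with rational centres. *)
Lemma open_measurable2 (U : set P2) : open U -> measurable U.
Proof.
move=> oU.
pose F (t : rat * rat * nat) : set P2 :=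
  if `[< box (ratr t.1.1, ratr t.1.2) (t.2.+1%:R^-1 : R) `<=` U >]
  then box (ratr t.1.1, ratr t.1.2) (t.2.+1%:R^-1 : R) else set0.
have -> : U = \bigcup_t F t.
  apply/seteqP; split=> [x Ux|x [t _]]; last first.
    by rewrite /F; case: asboolP => // sU /sU.
  have /nbhs_boxP[r [r0 rU]] := open_nbhs_nbhs (conj oU Ux).
  have [n nr] : exists n : nat, n.+1%:R^-1 < r / 2 :> R.
    have := near_infty_natSinv_lt (PosNum (divr_gt0 r0 (ltr0Sn R 1))).
    by move=> [n _ /(_ n (leqnn n))] /= h; exists n.
  have n0 : 0 < n.+1%:R^-1 :> R by rewrite invr_gt0.
  have dens (a : R) : exists q : rat, `|a - ratr q| < n.+1%:R^-1.
    have aa : a - n.+1%:R^-1 < a + n.+1%:R^-1 by rewrite ltrD2l gtrN.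
    have [q] := rat_in_itvoo aa.
    by rewrite in_itv /= -ltr_distlC => h; exists q.
  have [q1 h1] := dens x.1; have [q2 h2] := dens x.2.
  exists (q1, q2, n) => //; rewrite /F /=.
  case: asboolP => [_|]; first by split.
  case => y [/= y1 y2]; apply: rU; split.
    apply: le_lt_trans (ler_distD (ratr q1) _ _) _; rewrite (splitr r) ltrD ?(lt_trans y1 nr)//.
    by rewrite distrC (lt_trans h1 nr).
  apply: le_lt_trans (ler_distD (ratr q2) _ _) _; rewrite (splitr r) ltrD ?(lt_trans y2 nr)//.
    by rewrite distrC (lt_trans h2 nr).
apply: countable_bigcupT_measurable => // t; rewrite /F; case: ifP => // _.
exact: measurable_box.
Qed.

Lemma closed_measurable2 (U : set P2) : closed U -> measurable U.
Proof. by move/closed_openC/open_measurable2/measurableC; rewrite setCK. Qed.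

Lemma continuous_measurable2 (f : P2 -> R) : continuous f -> measurable_fun setT f.
Proof.
move=> /continuousP cf; apply: (measurability _ (RGenOpens.measurableE R)).
move=> _ [_ [a [b ->] <-]]; rewrite setTI; apply: open_measurable2.
exact/cf/interval_open.
Qed.

(** Closed squares have two roles: large ones about the origin contain supports, small ones cover
    the boundary curves. *)
Definition csq (p : P2) (e : R) : set P2 :=
  `[p.1 - e, p.1 + e]%classic `*` `[p.2 - e, p.2 + e]%classic.

Lemma csqP p e x : csq p e x <-> `|x.1 - p.1| <= e /\ `|x.2 - p.2| <= e.
Proof. by rewrite /csq /= !in_itv /= -!ler_distl. Qed.

Lemma measurable_csq p e : measurable (csq p e).
Proof. by apply: measurableX; exact: measurable_itv. Qed.

Lemma compact_csq p e : compact (csq p e).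
Proof. by apply: compact_setX; exact: segment_compact. Qed.

Lemma csq_measure p (e : R) : 0 <= e -> lam2 (csq p e) = ((2 * e) ^+ 2)%:E.
Proof.
move=> e0; rewrite /csq.
have h (a : R) : mu `[a - e, a + e]%classic = (2 * e)%:E.
  rewrite lebesgue_measure_itv /= lte_fin; case: ltP => h.
    by rewrite -EFinB; congr (_%:E); ring.
  by congr (_%:E); lra.
rewrite expr2 EFinM -[X in (X * _)%E](h p.1) -[X in (_ * X)%E](h p.2).
by apply: product_measure1E; exact: measurable_itv.
Qed.

Lemma int_abs_le (f : P2 -> R) (ps : seq P2) (C e : R) : measurable_fun setT f -> 0 <= C -> 0 <= e ->
  (forall x, `|f x| <= \sum_(p <- ps) C * \1_(csq p e) x) ->
  (\int[lam2]_x `|f x|%:E <= ((size ps)%:R * (C * (2 * e) ^+ 2))%:E)%E.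
Proof.
move=> mf C0 e0 fb.
have mi p : measurable_fun [set: P2] (fun x => (C * \1_(csq p e) x)%:E).
  by apply/measurable_EFinP; apply: measurable_funM => //; apply: measurable_indic; exact: measurable_csq.
apply: (@le_trans _ _ (\int[lam2]_x (\sum_(p <- ps) (C * \1_(csq p e) x)%:E))%E).
  apply: ge0_le_integral => //.
  - by apply/measurable_EFinP; exact: measurableT_comp.
  - by apply: emeasurable_sum => p; exact: mi.
  - by move=> x _; rewrite sumEFin lee_fin.
have -> : (\int[lam2]_x (\sum_(p <- ps) (C * \1_(csq p e) x)%:E) =
    \sum_(p <- ps) \int[lam2]_x (C * \1_(csq p e) x)%:E)%E.
  apply: ge0_integral_sum; [exact: measurableT|exact: mi|].
  by move=> p x _; rewrite lee_fin mulr_ge0.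
have I p : (\int[lam2]_x (C * \1_(csq p e) x)%:E = (C * (2 * e) ^+ 2)%:E)%E.
  under eq_integral do rewrite EFinM.
  rewrite ge0_integralZl ?lee_fin//.
  - rewrite integral_indic ?setIT; last exact: measurable_csq.
    by rewrite [X in (_ * X)%E]csq_measure.
  - exact: measurableT.
  - by apply/measurable_EFinP; apply: measurable_indic; exact: measurable_csq.
rewrite (eq_bigr (fun=> (C * (2 * e) ^+ 2)%:E)); last by move=> p _; exact: I.
by rewrite sumEFin lee_fin big_const_seq count_predT iter_addr_0 [leRHS]mulr_natl.
Qed.

Lemma csupp_bounded (f : P2 -> R) (L : R) : continuous f -> (forall x, ~ csq (0, 0) L x -> f x = 0) ->
  exists M : R, 0 <= M /\ forall x, `|f x| <= M.
Proof.
move=> fc fL.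
have : compact (f @` csq (0, 0) L).
  by apply: continuous_compact; [exact: continuous_subspaceT|exact: compact_csq].
move=> /compact_bounded[M [_ Mf]].
exists (Num.max 0 (M + 1)); split; first by rewrite le_max lexx.
move=> x; rewrite le_max; have [h|h] := pselect (csq (0, 0) L x).
  by apply/orP; right; apply: (Mf (M + 1)); [rewrite ltrDl|exists x].
by rewrite fL// normr0 lexx.
Qed.

Lemma csupp_int_fin (f : P2 -> R) (L : R) : 0 <= L -> continuous f ->
  (forall x, ~ csq (0, 0) L x -> f x = 0) -> (\int[lam2]_x `|f x|%:E < +oo)%E.
Proof.
move=> L0 fc fL; have [M [M0 fM]] := csupp_bounded fc fL.
apply: le_lt_trans (int_abs_le (ps := [:: (0, 0)]) (continuous_measurable2 fc) M0 L0 _) _.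
  move=> x; rewrite big_seq1 indicE; have [h|h] := pselect (csq (0, 0) L x).
    by rewrite mem_set// mulr1.
  by rewrite fL// normr0 mulr_ge0.
exact: ltry.
Qed.

Lemma csupp_integrable (f : P2 -> R) (L : R) : 0 <= L -> continuous f ->
  (forall x, ~ csq (0, 0) L x -> f x = 0) -> (lam2).-integrable setT (EFin \o f).
Proof.
move=> L0 fc fL; apply/integrableP; split.
  by apply/measurable_EFinP; exact: continuous_measurable2.
exact: (csupp_int_fin L0 fc fL).
Qed.

Lemma csupp_L1loc (f : P2 -> R) (L : R) : 0 <= L -> continuous f ->
  (forall x, ~ csq (0, 0) L x -> f x = 0) -> L1loc f.
Proof.
move=> L0 fc fL; have mf := continuous_measurable2 fc; split => // K cK.
apply: le_lt_trans (csupp_int_fin L0 fc fL).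
apply: ge0_subset_integral => //.
- by apply: closed_measurable2; apply: compact_closed => //; exact: norm_hausdorff.
- by apply/measurable_EFinP; exact: measurableT_comp.
Qed.

Lemma csupp_L2loc (f : P2 -> R) (L : R) : 0 <= L -> continuous f ->
  (forall x, ~ csq (0, 0) L x -> f x = 0) -> L2loc f.
Proof.
move=> L0 fc fL; split; first exact: continuous_measurable2.
move=> K cK.
have f2c : continuous (fun x => f x ^+ 2) by move=> x; apply: cvgM; exact: fc.
have f2L x : ~ csq (0, 0) L x -> f x ^+ 2 = 0 by move=> /fL ->; rewrite expr0n.
have [_ /(_ K cK)] := csupp_L1loc L0 f2c f2L.
by under eq_integral do rewrite ger0_norm ?sqr_ge0//.
Qed.

Lemma int_slice (h h' : R -> R) (L : R) : 0 <= L -> (forall t, is_derive t (1 : R) h (h' t)) ->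
  continuous h' -> (forall t, L < `|t| -> h t = 0 /\ h' t = 0) -> (\int[mu]_t (h' t)%:E = 0)%E.
Proof.
move=> L0 dh h'c hL; pose K := L + 1.
have K0 : 0 < K by rewrite ltr_pwDr.
have hK : h K = 0 /\ h (- K) = 0.
  by split; apply: (hL _ _).1; rewrite ?normrN gtr0_norm// ltrDl.
have -> : (\int[mu]_t (h' t)%:E = \int[mu]_(t in `[(- K)%R, K]) (h' t)%:E)%E.
  rewrite [RHS]integral_mkcond; apply: eq_integral => t _ /=.
  rewrite patchE; case: ifPn => //; rewrite notin_setE /= in_itv /= => tK.
  rewrite (hL t _).2//; rewrite ltNge; apply/negP => tL; apply: tK.
  rewrite -ler_norml (le_trans tL)// lerDl//.
rewrite (@continuous_FTC2 _ h' h).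
- by rewrite hK.1 hK.2 sube0.
- by rewrite gtrN.
- exact: continuous_subspaceT.
- have hc : continuous h by move=> t; exact: derive_continuous_at (dh t).
  split.
  + by move=> t _; exact: ex_derive.
  + by apply: cvg_at_right_filter; exact: hc.
  + by apply: cvg_at_left_filter; exact: hc.
- by move=> t _; rewrite derive1E; exact: derive_val.
Qed.

(** Fubini with the inner integral along the direction of differentiation, where the fundamental
    theorem of calculus makes it vanish. *)
Lemma int_D1 (H H1 : P2 -> R) (L : R) : 0 <= L -> (forall x, is_derive x e1 H (H1 x)) ->
  continuous H1 -> (forall x, ~ csq (0, 0) L x -> H x = 0 /\ H1 x = 0) ->
  (\int[lam2]_x (H1 x)%:E = 0)%E.
Proof.
move=> L0 dH H1c HL.
have I := csupp_integrable L0 H1c (fun x h => (HL x h).2).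
rewrite -(integral21_prod_meas1 I) /fubini_G /=.
rewrite integral0_eq// => y _.
apply: (@int_slice (fun t => H (t, y)) (fun t => H1 (t, y)) L L0).
- by move=> t; exact: (is_derive_e1P H (t, y) _).1.
- move=> t; apply: (@continuous_at_comp _ _ _ (fun t => (t, y)) H1); last exact: H1c.
  by apply: continuous_pair; [exact: cvg_id|exact: cvg_cst].
- move=> t tL; apply: HL; rewrite csqP /= !subr0 => -[h _].
  by move: tL; rewrite ltNge h.
Qed.

Lemma int_D2 (H H2 : P2 -> R) (L : R) : 0 <= L -> (forall x, is_derive x e2 H (H2 x)) ->
  continuous H2 -> (forall x, ~ csq (0, 0) L x -> H x = 0 /\ H2 x = 0) ->
  (\int[lam2]_x (H2 x)%:E = 0)%E.
Proof.
move=> L0 dH H2c HL.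
have I := csupp_integrable L0 H2c (fun x h => (HL x h).2).
rewrite -(integral12_prod_meas1 I) /fubini_F /=.
rewrite integral0_eq// => y _.
apply: (@int_slice (fun t => H (y, t)) (fun t => H2 (y, t)) L L0).
- by move=> t; exact: (is_derive_e2P H (y, t) _).1.
- move=> t; apply: (@continuous_at_comp _ _ _ (fun t => (y, t)) H2); last exact: H2c.
  by apply: continuous_pair; [exact: cvg_cst|exact: cvg_id].
- move=> t tL; apply: HL; rewrite csqP /= !subr0 => -[_ h].
  by move: tL; rewrite ltNge h.
Qed.

End Plane.

(** * Cutoff functions adapted to finite families of squares *)

Section Cutoff.
Variable R : realType.
Notation P2 := (R * R)%type.

Definition possq (t : R) : R := Num.max 0 t ^+ 2.

Lemma possq_derive (t : R) : is_derive t (1 : R) possq (2 * Num.max 0 t).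
Proof.
have [t0|t0|t0] : [\/ t < 0, 0 < t | t = 0] by case: (ltgtP t 0) => h; constructor.
- rewrite max_l ?ltW// mulr0; apply: (near_eq_is_derive _ (derC t 1 0)).
  near=> s; rewrite /possq max_l ?expr0n//.
  by apply: ltW; near: s; exact: lt_nbhsl.
- rewrite max_r ?ltW//.
  have h : is_derive t (1 : R) (fun t => t * t) (2 * t).
    by apply: (is_derive_eq (derM (is_derive_id t 1) (is_derive_id t 1))); rewrite mul1r mulr1 mulr_natl.
  apply: (near_eq_is_derive _ h).
  near=> s; rewrite /possq max_r ?expr2//.
  by apply: ltW; near: s; exact: lt_nbhsr.
- rewrite t0 maxxx mulr0.
  have C : (fun h : R => h^-1 *: ((possq \o shift 0) (h *: (1 : R)) - possq 0)) @ 0^' --> (0 : R).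
    apply/cvgrPdist_le => e e0; near=> h.
    have h0 : h != 0 by near: h; exact: nbhs_dnbhs_neq.
    rewrite sub0r normrN /= /shift addr0 /GRing.scale /= mulr1 {2}/possq maxxx expr0n subr0.
    rewrite normrM normfV ler_pdivrMl ?normr_gt0//.
    apply: (@le_trans _ _ (`|h| * `|h|)).
      rewrite /possq normrX -expr2 lerXn2r ?nnegrE//.
      by case: (leP 0 h) => // _; rewrite normr0.
    rewrite ler_wpM2l//; near: h; apply: nbhs_dnbhs.
    apply/nbhs_ballP; exists e => //= s; rewrite -ball_normE /= sub0r normrN; exact: ltW.
  split; first by apply/cvg_ex; exists 0.
  by apply/cvg_lim => //.
Unshelve. all: by end_near. Qed.

Lemma continuous_pospart : continuous (fun t : R => Num.max 0 t).
Proof. by move=> t; apply: continuous_max; [exact: cvg_cst|exact: cvg_id]. Qed.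

(** A piecewise polynomial step, 0 for [t <= 0] and 1 for [t >= 1]. Squares of positive parts are of
    class C^1, which is enough for cutoffs that are differentiated once. *)
Definition sstep (t : R) : R := 1 - possq (1 - possq t).
Definition sstep' (t : R) : R := 2 * Num.max 0 (1 - possq t) * (2 * Num.max 0 t).

Lemma sstep_derive (t : R) : is_derive t (1 : R) sstep (sstep' t).
Proof.
have h1 : is_derive t (1 : R) (fun t => 1 + - possq t) (- (2 * Num.max 0 t)).
  by apply: (is_derive_eq (derD (derC t 1 1) (derN (possq_derive t)))); rewrite add0r.
have h2 := @is_derive1_comp R possq (fun t => 1 + - possq t) t _ _ (possq_derive (1 - possq t)) h1.
apply: (is_derive_eq (derD (derC t 1 1) (derN h2))).
by rewrite add0r mulrN opprK.
Qed.

Lemma sstep'_continuous : continuous sstep'.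
Proof.
have pc : continuous possq by move=> t; exact: derive_continuous_at (possq_derive t).
move=> t; apply: cvgM; apply: cvgM; try exact: cvg_cst; last exact: continuous_pospart.
apply: (@continuous_at_comp _ _ _ (fun t => 1 - possq t) (fun t => Num.max 0 t)).
  by apply: cvgB; [exact: cvg_cst|exact: pc].
exact: continuous_pospart.
Qed.

Lemma possq_ge0 t : 0 <= possq t. Proof. exact: sqr_ge0. Qed.

Lemma possq_le0 t : t <= 0 -> possq t = 0.
Proof. by move=> t0; rewrite /possq max_l// expr0n. Qed.

Lemma possq_ge1 t : 1 <= t -> 1 <= possq t.
Proof. by move=> t1; rewrite /possq max_r ?(le_trans ler01)// exprn_ege1. Qed.

Lemma possq_le1 t : t <= 1 -> possq t <= 1.
Proof.
move=> t1; rewrite /possq exprn_ile1//; first by rewrite le_max lexx.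
by rewrite ge_max ler01.
Qed.

Lemma sstep_le0 t : t <= 0 -> sstep t = 0 /\ sstep' t = 0.
Proof.
move=> t0; rewrite /sstep /sstep' (possq_le0 t0) subr0 (max_l t0) !mulr0; split => //.
by rewrite /possq max_r// expr1n subrr.
Qed.

Lemma sstep_ge1 t : 1 <= t -> sstep t = 1 /\ sstep' t = 0.
Proof.
move=> t1; have h : 1 - possq t <= 0 by rewrite subr_le0 possq_ge1.
by rewrite /sstep /sstep' (possq_le0 h) subr0 (max_l h) mulr0 mul0r.
Qed.

Lemma sstep_itv t : 0 <= sstep t <= 1.
Proof.
have h : possq (1 - possq t) <= 1 by apply: possq_le1; rewrite gerBl possq_ge0.
by rewrite /sstep subr_ge0 h gerBl possq_ge0.
Qed.

Lemma sstep'_le t : `|sstep' t| <= 4.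
Proof.
have [t1|t1] := leP 1 t; first by rewrite (sstep_ge1 t1).2 normr0.
have a0 : 0 <= Num.max 0 t by rewrite le_max lexx.
have a1 : Num.max 0 t <= 1 by rewrite ge_max ler01 ltW.
have b0 : 0 <= Num.max 0 (1 - possq t) by rewrite le_max lexx.
have b1 : Num.max 0 (1 - possq t) <= 1 by rewrite ge_max ler01/= gerBl possq_ge0.
rewrite /sstep'; move: a0 a1 b0 b1; move: (Num.max 0 t) (Num.max 0 _) => a b a0 a1 b0 b1.
have := mulr_ile1 b0 a0 b1 a1; have := mulr_ge0 b0 a0.
by move=> h0 h1; rewrite ger0_norm; nra.
Qed.

(** Calibrated for [sstep]: in the open square of half-side [e] the squared distance is below
    [2 * e ^ 2], so the value is at most 0; outside the closed square of half-side [2 * e] it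
    exceeds [4 * e ^ 2], so the value is at least 1. *)
Definition dist2 (p : P2) (e : R) (x : P2) := ((x.1 - p.1) ^+ 2 + (x.2 - p.2) ^+ 2) / e ^+ 2 - 2.

Lemma dist2_grad p e : has_grad setT (dist2 p e) (fun x => 2 * (x.1 - p.1) / e ^+ 2)
  (fun x => 2 * (x.2 - p.2) / e ^+ 2).
Proof.
have h (s t c : R) : is_derive t (1 : R) (fun t => (t - s) ^+ 2) (2 * (t - s)).
  have hh := derD (is_derive_id t 1) (derN (derC t 1 s)).
  have -> : (fun t : R => (t - s) ^+ 2) = (fun t => (t - s) * (t - s)).
    by apply/funext => z; rewrite expr2.
  by apply: (is_derive_eq (derM hh hh)) => /=; ring.
move=> x _; split.
- apply/is_derive_e1P; rewrite /dist2 /=.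
  have := derD (derM (derD (h p.1 x.1 0) (derC x.1 1 ((x.2 - p.2) ^+ 2))) (derC x.1 1 (e ^- 2)))
     (derC x.1 1 (-2)).
  by move=> /is_derive_eq; apply; rewrite mulr0 !addr0.
- apply/is_derive_e2P; rewrite /dist2 /=.
  have := derD (derM (derD (derC x.2 1 ((x.1 - p.1) ^+ 2)) (h p.2 x.2 0)) (derC x.2 1 (e ^- 2)))
     (derC x.2 1 (-2)).
  by move=> /is_derive_eq; apply; rewrite mulr0 !addr0 add0r.
- apply: cvgM; last exact: cvg_cst.
  apply: cvgM; first exact: cvg_cst.
  by apply: cvgB; [exact: cvg_fst|exact: cvg_cst].
- apply: cvgM; last exact: cvg_cst.
  apply: cvgM; first exact: cvg_cst.
  by apply: cvgB; [exact: cvg_snd|exact: cvg_cst].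
Qed.

Lemma grad_comp (A : set P2) (s s' : R -> R) (f f1 f2 : P2 -> R) : open A ->
  (forall t, is_derive t (1 : R) s (s' t)) -> continuous s' -> has_grad A f f1 f2 ->
  has_grad A (fun x => s (f x)) (fun x => s' (f x) * f1 x) (fun x => s' (f x) * f2 x).
Proof.
move=> oA ds s'c fg x Ax; have [d1 d2 c1 c2] := fg x Ax.
have fc := grad_cont oA fg Ax.
split.
- apply/is_derive_e1P.
  have := (is_derive_e1P f x (f1 x)).1 d1 => D.
  have := ds (f x); rewrite [in X in is_derive X](surjective_pairing x) => D2.
  exact: (@is_derive1_comp R s _ _ _ _ D2 D).
- apply/is_derive_e2P.
  have := (is_derive_e2P f x (f2 x)).1 d2 => D.
  have := ds (f x); rewrite [in X in is_derive X](surjective_pairing x) => D2.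
  exact: (@is_derive1_comp R s _ _ _ _ D2 D).
- apply: cvgM; last exact: c1.
  exact: (@continuous_at_comp _ _ _ f s' x fc (s'c _)).
- apply: cvgM; last exact: c2.
  exact: (@continuous_at_comp _ _ _ f s' x fc (s'c _)).
Qed.

Lemma cutoff1 (p : P2) (e : R) : 0 < e -> exists psi psi1 psi2 : P2 -> R,
  [/\ has_grad setT psi psi1 psi2, forall x, 0 <= psi x <= 1,
      forall x, box p e x -> [/\ psi x = 0, psi1 x = 0 & psi2 x = 0],
      forall x, 1 - psi x <= \1_(csq p (2 * e)) x &
      forall x, `|psi1 x| <= 16 / e * \1_(csq p (2 * e)) x /\
                `|psi2 x| <= 16 / e * \1_(csq p (2 * e)) x].
Proof.
move=> e0; have e2p : 0 < e ^+ 2 by rewrite exprn_gt0.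
exists (fun x => sstep (dist2 p e x)), (fun x => sstep' (dist2 p e x) * (2 * (x.1 - p.1) / e ^+ 2)),
  (fun x => sstep' (dist2 p e x) * (2 * (x.2 - p.2) / e ^+ 2)).
have out x : ~ csq p (2 * e) x -> 1 <= dist2 p e x.
  move=> nx; rewrite /dist2 lerBrDr ler_pdivlMr//.
  have far (a : R) : 2 * e < `|a| -> (1 + 2) * e ^+ 2 <= a ^+ 2.
    move=> h; rewrite -[leRHS]real_normK ?num_real//.
    apply: (@le_trans _ _ ((2 * e) ^+ 2)); first by rewrite exprMn; nra.
    by rewrite lerXn2r ?nnegrE ?(ltW h)// mulr_ge0// ltW.
  have [h1|h1] := leP `|x.1 - p.1| (2 * e); last first.
    by rewrite -[leLHS]addr0 lerD ?sqr_ge0//; exact: far.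
  have [h2|h2] := leP `|x.2 - p.2| (2 * e); last first.
    by rewrite -[leLHS]add0r lerD ?sqr_ge0//; exact: far.
  by exfalso; apply: nx; apply/csqP.
split.
- exact: (grad_comp openT sstep_derive sstep'_continuous (dist2_grad p e)).
- by move=> x; exact: sstep_itv.
- move=> x [x1 x2].
  have h : dist2 p e x <= 0.
    rewrite /dist2 subr_le0 ler_pdivrMr// mulr_natl mulr2n.
    have sq (a : R) : `|a| < e -> a ^+ 2 <= e ^+ 2.
      move=> /ltW h; rewrite -[leLHS]real_normK ?num_real// lerXn2r ?nnegrE//.
      exact: ltW.
    by rewrite lerD//; exact: sq.
  by have [-> ->] := sstep_le0 h; rewrite !mul0r.
- move=> x; rewrite indicE; have [h|h] := pselect (csq p (2 * e) x).
    by rewrite mem_set//= gerBl; case/andP: (sstep_itv (dist2 p e x)).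
  by rewrite memNset//= (sstep_ge1 (out x h)).1 subrr.
- move=> x; rewrite indicE; have [h|h] := pselect (csq p (2 * e) x); last first.
    by rewrite memNset//= (sstep_ge1 (out x h)).2 !mul0r mulr0 normr0.
  rewrite mem_set//= mulr1; move/csqP: h => [h1 h2].
  have b (a : R) : `|a| <= 2 * e -> `|sstep' (dist2 p e x) * (2 * a / e ^+ 2)| <= 16 / e.
    (* 4 bounds [sstep'], and on the square the partial derivatives of [dist2] are at most
       [2 * (2 * e) / e ^ 2]. *)
    move=> ae; have -> : 16 / e = 4 * (2 * (2 * e) / e ^+ 2) by field; rewrite gt_eqF.
    rewrite normrM ler_pM// ?sstep'_le// normrM normfV [`|e ^+ 2|]gtr0_norm//.
    apply: ler_wpM2r; first by rewrite invr_ge0 ltW.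
    by rewrite normrM (ger0_norm (ler0n R 2)); apply: ler_wpM2l.
  by split; exact: b.
Qed.

(** The product of the cutoffs of the single squares. All factors lie in [0, 1], so the product rule
    bounds its derivatives by the sum of theirs, and 1 - f g is at most (1 - f) + (1 - g). *)
Lemma cutoff_list (ps : seq P2) (e : R) : 0 < e -> exists psi psi1 psi2 : P2 -> R,
  [/\ has_grad setT psi psi1 psi2, forall x, 0 <= psi x <= 1,
      forall p x, p \in ps -> box p e x -> [/\ psi x = 0, psi1 x = 0 & psi2 x = 0],
      forall x, 1 - psi x <= \sum_(p <- ps) \1_(csq p (2 * e)) x &
      forall x, `|psi1 x| <= \sum_(p <- ps) 16 / e * \1_(csq p (2 * e)) x /\
                `|psi2 x| <= \sum_(p <- ps) 16 / e * \1_(csq p (2 * e)) x].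
Proof.
move=> e0; elim: ps => [|p ps [f [f1 [f2 [fg f01 fz fI fD]]]]].
  exists (fun=> 1), (fun=> 0), (fun=> 0); split => //.
  - by move=> x _; split; [exact: derC|exact: derC|exact: cvg_cst|exact: cvg_cst].
  - by move=> x; rewrite ler01 lexx.
  - by move=> x; rewrite big_nil subrr.
  - by move=> x; rewrite !big_nil normr0.
have [g [g1 [g2 [gg g01 gz gI gD]]]] := cutoff1 p e0.
exists (fun x => g x * f x), (fun x => g1 x * f x + g x * f1 x), (fun x => g2 x * f x + g x * f2 x).
have pm (a b c d : R) : 0 <= a <= 1 -> 0 <= b <= 1 -> `|c * a + b * d| <= `|c| + `|d|.
  move=> /andP[a0 a1] /andP[b0 b1]; apply: le_trans (ler_normD _ _) _.
  by rewrite !normrM lerD// ?(ger0_norm a0) ?(ger0_norm b0) ?ler_piMr ?ler_piMl.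
split.
- exact: (gradM openT gg fg).
- move=> x; have /andP[a0 a1] := g01 x; have /andP[b0 b1] := f01 x.
  by rewrite mulr_ge0//= mulr_ile1.
- move=> q x; rewrite in_cons => /orP[/eqP -> /gz[-> -> ->]|qps /(fz q x qps)[-> -> ->]].
    by rewrite !mul0r addr0.
  by rewrite !mulr0 addr0.
- move=> x; rewrite big_cons.
  apply: le_trans (lerD (gI x) (fI x)); have /andP[a0 a1] := g01 x; have /andP[b0 b1] := f01 x.
  by move: (g x) (f x) a0 a1 b0 b1 => a b *; nra.
- move=> x; rewrite !big_cons; have [k1 k2] := gD x; have [l1 l2] := fD x; split.
    by apply: le_trans (pm _ _ _ _ (f01 x) (g01 x)) (lerD k1 l1).
  by apply: le_trans (pm _ _ _ _ (f01 x) (g01 x)) (lerD k2 l2).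
Qed.

(** Compactness gives the modulus for [p] in the square of half-side [L + 1]. For other [p] the two
    points, less than 1 apart, both lie where [f] vanishes. *)
Lemma csupp_unif_cont (f : P2 -> R) (L : R) : continuous f -> (forall x, ~ csq (0, 0) L x -> f x = 0) ->
  forall d : R, 0 < d -> exists eta : R, 0 < eta /\ forall p x, box p eta x -> `|f x - f p| < d.
Proof.
move=> fc fL d d0.
pose P (n : nat) (p : P2) := forall x, box p n.+1%:R^-1 x -> `|f x - f p| < d.
have cov := (compact_near_coveringP _).1 (@compact_csq R (0, 0) (L + 1)) nat \oo P _.
have [n _ Hn] : \forall n \near \oo, csq (0, 0) (L + 1) `<=` P n.
  apply: cov => p _.
  have /cvgrPdist_lt /(_ (d / 2)) := fc p.
  rewrite divr_gt0// => /(_ isT) /nbhs_boxP[r [r0 Hr]].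
  have r2 : 0 < r / 2 by rewrite divr_gt0.
  have [N _ HN] := near_infty_natSinv_lt (PosNum r2).
  exists (box p (r / 2), [set n | (N <= n)%N]) => /=.
    split; last by exists N.
    by apply/(nbhs_boxP p); exists (r / 2); split.
  move=> [q n] /= [[q1 q2] Nn] x [x1 x2].
  have hn : n.+1%:R^-1 < r / 2 :> R := HN n Nn.
  have hq : `|f p - f q| < d / 2.
    by apply: Hr; split; [apply: lt_trans q1 _|apply: lt_trans q2 _]; lra.
  have hx : `|f p - f x| < d / 2.
    apply: Hr; split.
      apply: le_lt_trans (ler_distD q.1 _ _) _; rewrite (splitr r) ltrD//.
      exact: lt_trans x1 hn.
    apply: le_lt_trans (ler_distD q.2 _ _) _; rewrite (splitr r) ltrD//.
    exact: lt_trans x2 hn.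
  apply: le_lt_trans (ler_distD (f p) _ _) _; rewrite (splitr d) ltrD//.
  by rewrite distrC.
exists n.+1%:R^-1; split; first by rewrite invr_gt0.
move=> p x px; have [h|h] := pselect (csq (0, 0) (L + 1) p).
  exact: (Hn n (leqnn n) p h x px).
have n1 : n.+1%:R^-1 <= 1 :> R by rewrite invf_le1// ler1n.
have out : forall a b : R, `|b - a| < n.+1%:R^-1 -> `|b| <= L -> `|a| <= L + 1.
  move=> a b ab bL; rewrite -(subrK b a); apply: le_trans (ler_normD _ _) _.
  by rewrite addrC lerD// distrC (le_trans (ltW ab)).
have fp : f p = 0.
  apply: fL => /csqP[/= h1 h2]; apply: h; apply/csqP.
  by split; [apply: le_trans h1 _|apply: le_trans h2 _]; rewrite lerDl.
have fx : f x = 0.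
  apply: fL => /csqP /=; rewrite !subr0 => -[h1 h2]; apply: h; apply/csqP; rewrite /= !subr0.
  by case: px => px1 px2; split; [exact: out px1 h1|exact: out px2 h2].
by rewrite fp fx subrr normr0.
Qed.

End Cutoff.

(** * Divergence identities across a thin set *)

Section Removable.
Variable R : realType.
Notation P2 := (R * R)%type.
Notation e1 := (e1 R).
Notation e2 := (e2 R).
Notation lam2 := (@lebesgue_measure R \x @lebesgue_measure R)%E.

(** Finite length, in the form that is used: of the order of 1/e squares of half-side [e] cover [G].
    Their centres lie on [G], so a field that vanishes on [G] is zero at the centres and small on
    the squares. *)
Definition thin (G : set P2) := exists C : R, forall e : R, 0 < e < 1 -> exists ps : seq P2,
  [/\ forall p, p \in ps -> G p, (size ps)%:R * e <= C &
      forall x, G x -> exists2 p, p \in ps & box p e x].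

Definition csupp (L : R) (f : P2 -> R) := forall x, ~ csq (0, 0) L x -> f x = 0.

Lemma csupp_int_split (f g : P2 -> R) L : 0 <= L -> continuous f -> continuous g ->
  csupp L f -> csupp L g ->
  (\int[lam2]_x (f x + g x)%:E = \int[lam2]_x (f x)%:E + \int[lam2]_x (g x)%:E)%E.
Proof.
move=> L0 fc gc fL gL; under eq_integral do rewrite EFinD.
by apply: integralD => //; [exact: (csupp_integrable L0 fc fL)|exact: (csupp_integrable L0 gc gL)].
Qed.

Lemma continuousM2 (f g : P2 -> R) : continuous f -> continuous g -> continuous (fun x => f x * g x).
Proof. by move=> fc gc x; apply: cvgM; [exact: fc|exact: gc]. Qed.

Lemma continuousD2 (f g : P2 -> R) : continuous f -> continuous g -> continuous (fun x => f x + g x).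
Proof. by move=> fc gc x; apply: cvgD; [exact: fc|exact: gc]. Qed.

Lemma gradT_continuous (f f1 f2 : P2 -> R) : has_grad setT f f1 f2 ->
  [/\ continuous f, continuous f1 & continuous f2].
Proof.
move=> fg; split => x; first exact: (grad_cont openT fg I).
- by case: (fg x I).
- by case: (fg x I).
Qed.

Lemma derM0 (V : normedModType R) (f g : V -> R) (x v : V) : (\forall y \near x, f y = 0) ->
  is_derive x v (fun y => f y * g y) 0.
Proof.
move=> f0; apply: (near_eq_is_derive _ (derC x v 0)).
by apply: filterS f0 => y ->; rewrite mul0r.
Qed.

Section Divergence.
Variables (G : set P2) (F1 F2 F11 F22 g : P2 -> R) (L : R).
Hypotheses (L0 : 0 <= L) (F1c : continuous F1) (F2c : continuous F2) (gc : continuous g).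
Hypotheses (F1L : csupp L F1) (F2L : csupp L F2) (gL : csupp L g).
Hypotheses (F11L : csupp L F11) (F22L : csupp L F22).
Hypothesis off : forall x, ~ G x -> [/\ is_derive x e1 F1 (F11 x), is_derive x e2 F2 (F22 x),
  {for x, continuous F11}, {for x, continuous F22} & F11 x + F22 x = g x].

(** The integrand is the divergence of the field multiplied by [chi], whose divergence terms are
    continuous on the whole plane because [chi] vanishes near [G]. *)
Lemma divergence_off (chi chi1 chi2 : P2 -> R) : has_grad setT chi chi1 chi2 ->
  (forall x, G x -> \forall y \near x, [/\ chi y = 0, chi1 y = 0 & chi2 y = 0]) ->
  (\int[lam2]_x (F1 x * chi1 x + F2 x * chi2 x + g x * chi x)%:E = 0)%E.
Proof.
move=> cg c0; have [cc c1c c2c] := gradT_continuous cg.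
pose H1 x := chi1 x * F1 x + chi x * F11 x.
pose H2 x := chi2 x * F2 x + chi x * F22 x.
have d1 x : is_derive x e1 (fun y => chi y * F1 y) (H1 x).
  have [a1 _ _ _] := cg x I.
  have [Gx|nGx] := pselect (G x); last by have [b1 _ _ _ _] := off nGx; exact: (derM a1 b1).
  have N := c0 x Gx; have [z z1 z2] := nbhs_singleton N.
  rewrite /H1 z z1 !mul0r addr0; apply: derM0.
  by apply: filterS N => y [].
have d2 x : is_derive x e2 (fun y => chi y * F2 y) (H2 x).
  have [_ a2 _ _] := cg x I.
  have [Gx|nGx] := pselect (G x); last by have [_ b2 _ _ _] := off nGx; exact: (derM a2 b2).
  have N := c0 x Gx; have [z z1 z2] := nbhs_singleton N.
  rewrite /H2 z z2 !mul0r addr0; apply: derM0.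
  by apply: filterS N => y [].
have near0 (h : P2 -> R) x : (\forall y \near x, 0 = h y) -> {for x, continuous h}.
  by move=> N; apply: (for_continuous_near N); exact: cvg_cst.
have H1c : continuous H1.
  move=> x; have [Gx|nGx] := pselect (G x).
    by apply: near0; apply: filterS (c0 x Gx) => y [z z1 z2]; rewrite /H1 z z1 !mul0r addr0.
  have [_ _ b3 _ _] := off nGx.
  by apply: cvgD; apply: cvgM; [exact: c1c|exact: F1c|exact: cc|exact: b3].
have H2c : continuous H2.
  move=> x; have [Gx|nGx] := pselect (G x).
    by apply: near0; apply: filterS (c0 x Gx) => y [z z1 z2]; rewrite /H2 z z2 !mul0r addr0.
  have [_ _ _ b4 _] := off nGx.
  by apply: cvgD; apply: cvgM; [exact: c2c|exact: F2c|exact: cc|exact: b4].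
have H1L x : ~ csq (0, 0) L x -> chi x * F1 x = 0 /\ H1 x = 0.
  by move=> h; rewrite /H1 (F1L h) (F11L h) !mulr0 addr0.
have H2L x : ~ csq (0, 0) L x -> chi x * F2 x = 0 /\ H2 x = 0.
  by move=> h; rewrite /H2 (F2L h) (F22L h) !mulr0 addr0.
have I1 := int_D1 L0 d1 H1c H1L; have I2 := int_D2 L0 d2 H2c H2L.
have := csupp_int_split L0 H1c H2c (fun x h => (H1L x h).2) (fun x h => (H2L x h).2).
rewrite I1 I2 add0e => <-; apply: eq_integral => x _; congr (_%:E).
rewrite /H1 /H2; have [Gx|nGx] := pselect (G x).
  by have [-> -> ->] := nbhs_singleton (c0 x Gx); rewrite !mul0r !mulr0 !addr0.
have [_ _ _ _ <-] := off nGx.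
by move: (F1 x) (F2 x) (F11 x) (F22 x) (chi x) (chi1 x) (chi2 x) => *; ring.
Qed.

Hypothesis on : forall x, G x -> F1 x = 0 /\ F2 x = 0.
Hypothesis tG : thin G.

(* The error committed by cutting off a neighbourhood of [G] of width [e] is bounded by the area
   [O(e)] of the neighbourhood times the gradient [O(1/e)] of the cutoff times the size of the
   field there, which is small because the field vanishes on [G]. *)
Lemma divergence_removable (phi phi1 phi2 : P2 -> R) : has_grad setT phi phi1 phi2 ->
  (\int[lam2]_x (F1 x * phi1 x + F2 x * phi2 x + g x * phi x)%:E = 0)%E.
Proof.
move=> pg; have [pc p1c p2c] := gradT_continuous pg.
pose Phi x := F1 x * phi1 x + F2 x * phi2 x + g x * phi x.
have Phic : continuous Phi by apply: continuousD2; [apply: continuousD2|]; exact: continuousM2.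
have PhiL : csupp L Phi by move=> x h; rewrite /Phi (F1L h) (F2L h) (gL h) !mul0r !addr0.
have [M [M0 PhiM]] := csupp_bounded Phic PhiL.
have [M' [M'0 phiM]] : exists M' : R, 0 <= M' /\ forall x, csq (0, 0) L x -> `|phi x| <= M'.
  have : compact (phi @` csq (0, 0) L).
    by apply: continuous_compact; [exact: continuous_subspaceT|exact: compact_csq].
  move=> /compact_bounded[m [_ mf]]; exists (Num.max 0 (m + 1)); split; first by rewrite le_max lexx.
  move=> x xL; rewrite le_max; apply/orP; right.
  by apply: (mf (m + 1)); [rewrite ltrDl|exists x].
have [C HC] := tG.
have C0 : 0 <= C.
  have [|ps [_ h _]] := HC 2^-1; first by lra.
  by apply: le_trans h; rewrite mulr_ge0.
have int0 := csupp_integrable L0 Phic PhiL.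
apply/eqP; rewrite -abse_eq0 eq_le abse_ge0 andbT.
apply/lee_addgt0Pr => eps eps0; rewrite add0e.
(* The final estimate is [16 * C * (M * e + 32 * M' * d)]. [D] and [E] dominate the coefficients of
   [d] and [e] in it, the added 1 keeps them positive, and each of the two terms is made at most
   [eps / 2]. *)
pose D := 32 * (16 * C) * M' + 1.
have D0 : 0 < D by rewrite ltr_wpDl ?ltr01// !mulr_ge0.
pose E := 32 * C * M + 1.
have E0 : 0 < E by rewrite ltr_wpDl// !mulr_ge0.
pose d := eps / (2 * D).
have d0 : 0 < d by rewrite divr_gt0// mulr_gt0.
have [eta1 [eta10 H1]] := csupp_unif_cont F1c F1L d0.
have [eta2 [eta20 H2]] := csupp_unif_cont F2c F2L d0.
pose e := Num.min (Num.min (eta1 / 4) (eta2 / 4)) (Num.min 2^-1 (eps / (2 * E))).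
have e0 : 0 < e.
  rewrite /e !lt_min; apply/andP; split; apply/andP; split.
  - by rewrite divr_gt0.
  - by rewrite divr_gt0.
  - by rewrite invr_gt0.
  - by rewrite divr_gt0// mulr_gt0.
have [ee1 ee2 ee3 ee4] : [/\ e <= eta1 / 4, e <= eta2 / 4, e <= 2^-1 & e <= eps / (2 * E)].
  by rewrite /e; split; rewrite !ge_min lexx ?orbT.
have e4 : 2 * e < e * 4 by rewrite mulrC ltr_pM2l// ltr_nat.
have eta1e : 2 * e < eta1 by move: ee1; rewrite ler_pdivlMr// => h; exact: lt_le_trans h.
have eta2e : 2 * e < eta2 by move: ee2; rewrite ler_pdivlMr// => h; exact: lt_le_trans h.
have [|ps [psG psC cov]] := HC e; first by rewrite e0 (le_lt_trans ee3)//; lra.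
have [psi [psi1 [psi2 [sg s01 sz sI sD]]]] := cutoff_list ps e0.
pose chi x := psi x * phi x.
have cg := gradM openT sg pg.
have near0 x : G x -> \forall y \near x, [/\ psi y * phi y = 0, psi1 y * phi y + psi y * phi1 y = 0 &
    psi2 y * phi y + psi y * phi2 y = 0].
  move=> Gx; have [p pps px] := cov x Gx.
  have N := open_nbhs_nbhs (conj (@box_open R p e) px).
  apply: (filterS _ N) => y /(sz p y pps)[-> -> ->].
  by rewrite !mul0r addr0.
have Z := divergence_off cg near0.
pose Th x := F1 x * (psi1 x * phi x + psi x * phi1 x) + F2 x * (psi2 x * phi x + psi x * phi2 x)
   + g x * (psi x * phi x).
have [cc c1c c2c] := gradT_continuous cg.
have Thc : continuous Th by apply: continuousD2; [apply: continuousD2|]; exact: continuousM2.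
have ThL : csupp L Th by move=> x h; rewrite /Th (F1L h) (F2L h) (gL h) !mul0r !addr0.
pose Er x := Phi x + (-1) * Th x.
have mThc : continuous (fun x => (-1) * Th x) by apply: continuousM2 => //; move=> x; exact: cvg_cst.
have mThL : csupp L (fun x => (-1) * Th x) by move=> x h; rewrite (ThL x h) mulr0.
have Erc : continuous Er by exact: continuousD2.
have split1 := csupp_int_split L0 Phic mThc PhiL mThL.
have : (\int[lam2]_x (-1 * Th x)%:E = 0)%E.
  under eq_integral do rewrite EFinM.
  rewrite integralZl//; last exact: (csupp_integrable L0 Thc ThL).
  by rewrite Z mule0.
move=> mT0; rewrite mT0 adde0 in split1; rewrite -/(Phi _) in split1 *.
rewrite -split1.
apply: le_trans (le_abse_integral _ measurableT _) _.
  by apply/measurable_EFinP; exact: continuous_measurable2.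
have Md0 : 0 <= 32 * M' * d by apply: mulr_ge0; [exact: mulr_ge0|exact: ltW].
have K0 : 0 <= M + 32 * M' * d / e by apply: addr_ge0 => //; apply: divr_ge0 => //; exact: ltW.
have e20 : 0 <= 2 * e by rewrite mulr_ge0// ltW.
apply: le_trans (int_abs_le (ps := ps) (continuous_measurable2 Erc) K0 e20 _) _.
  move=> x; have := sI x; have [k1 k2] := sD x; have [s0 s1] := andP (s01 x).
  rewrite -mulr_sumr in k1; rewrite -mulr_sumr in k2; rewrite -mulr_sumr.
  (* Off the squares the cutoff is 1 with zero gradient, so the error vanishes there. *)
  have [S0|S0] := eqVneq (\sum_(p <- ps) \1_(csq p (2 * e)) x : R) 0.
    move: k1 k2; rewrite S0 !mulr0 !normr_le0 => /eqP z1 /eqP z2; rewrite subr_le0 => s1'.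
    have z : psi x = 1 by apply/eqP; rewrite eq_le s1.
    rewrite /Er /Phi /Th z z1 z2.
    by rewrite (_ : _ + _ = 0) ?normr0//; ring.
  set S := \sum_(p <- ps) _ in S0 k1 k2 *.
  move=> sS.
  have S1 : 0 <= S by apply: sumr_ge0 => p _; rewrite indicE.
  have [p pps px] : exists2 p, p \in ps & csq p (2 * e) x.
    apply: contrapT => nex; move/eqP: S0; apply.
    rewrite /S big_seq big1// => p pps; rewrite indicE memNset// => px; apply: nex.
    by exists p.
  have [Gp1 Gp2] := on (psG p pps).
  have [px1 px2] := (csqP p (2 * e) x).1 px.
  have f1 : `|F1 x| <= d.
    rewrite -[F1 x]subr0 -Gp1; apply: ltW; apply: H1; split; [exact: le_lt_trans px1 eta1e|exact: le_lt_trans px2 eta1e].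
  have f2 : `|F2 x| <= d.
    rewrite -[F2 x]subr0 -Gp2; apply: ltW; apply: H2; split; [exact: le_lt_trans px1 eta2e|exact: le_lt_trans px2 eta2e].
  have [xL|xL] := pselect (csq (0, 0) L x); last first.
    by rewrite /Er PhiL// ThL// mulr0 addr0 normr0 mulr_ge0.
  (* The first term is bounded and lives on a set of area O(e); in the second, the gradient O(1/e)
     of the cutoff meets a field of size at most [d]. *)
  have -> : Er x = (1 - psi x) * Phi x - phi x * (F1 x * psi1 x + F2 x * psi2 x).
    rewrite /Er /Th /Phi; move: (F1 x) (F2 x) (psi x) (psi1 x) (psi2 x) (phi x) (phi1 x) (phi2 x) (g x) => *; ring.
  apply: le_trans (ler_normB _ _) _; rewrite [leRHS]mulrDl; apply: lerD.
    rewrite normrM mulrC ler_pM// ger0_norm ?subr_ge0//.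
  have b12 : `|F1 x * psi1 x + F2 x * psi2 x| <= d * (16 / e * S) + d * (16 / e * S).
    by apply: le_trans (ler_normD _ _) _; rewrite !normrM lerD// ler_pM.
  rewrite normrM; apply: le_trans (ler_pM (normr_ge0 _) (normr_ge0 _) (phiM x xL) b12) _.
  apply: le_refl_eq; have aux (m s t z : R) : t != 0 ->
    m * (z * (16 / t * s) + z * (16 / t * s)) = 32 * m * z / t * s by move=> t0; field.
  by apply: aux; rewrite gt_eqF.
rewrite lee_fin.
have -> : (size ps)%:R * ((M + 32 * M' * d / e) * (2 * (2 * e)) ^+ 2) =
   16 * ((size ps)%:R * e) * (M * e + 32 * M' * d).
  by move: ((size ps)%:R) => n; field; rewrite gt_eqF.
have h1 : 0 <= M * e + 32 * M' * d by apply: addr_ge0 => //; apply: mulr_ge0 => //; exact: ltW.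
apply: (@le_trans _ _ (16 * C * (M * e + 32 * M' * d))).
  by apply: ler_wpM2r => //; apply: ler_wpM2l.
have -> : 16 * C * (M * e + 32 * M' * d) = 16 * C * M * e + 32 * (16 * C) * M' * d by ring.
have h2 : E * e <= eps / 2.
  have := ler_wpM2l (ltW E0) ee4; move=> /le_trans; apply; apply: le_refl_eq.
  by field; rewrite gt_eqF.
have h3 : D * d = eps / 2 by rewrite /d; field; rewrite gt_eqF.
rewrite (splitr eps); apply: lerD.
  apply: le_trans h2; apply: ler_wpM2r; first exact: ltW.
  have : 0 <= C * M by rewrite mulr_ge0.
  by rewrite /E; move: (C * M) (mulrA 16 C M) (mulrA 32 C M) => z <- <- h; lra.
rewrite -h3; apply: ler_wpM2r; first exact: ltW.
by rewrite /D lerDl.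
Qed.

End Divergence.
End Removable.

(** * Divergence identities for a field that is constant on one of two curves *)

Section TwoCurves.
Variable R : realType.
Notation P2 := (R * R)%type.
Notation e1 := (e1 R).
Notation e2 := (e2 R).
Notation lam2 := (@lebesgue_measure R \x @lebesgue_measure R)%E.

Lemma csq_sub (L M : R) x : L <= M -> csq (0, 0) L x -> csq (0, 0) M x.
Proof. by move=> LM /csqP[h1 h2]; apply/csqP; split; [apply: le_trans h1 _|apply: le_trans h2 _]. Qed.

Lemma csupp_le (L M : R) f : L <= M -> csupp L f -> csupp M f.
Proof. by move=> LM fL x h; apply: fL => /(csq_sub LM). Qed.

(* If the field is a constant vector on [G1] and vanishes on [G2], subtract the constant times a
   bump function equal to 1 on [G1] and to 0 on [G2]. *)
Lemma divergence_two (G1 G2 : set P2) (F1 F2 F11 F22 : P2 -> R) (L c1 c2 sep : R)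
  (phi phi1 phi2 : P2 -> R) :
  0 <= L -> 0 < sep -> continuous F1 -> continuous F2 ->
  csupp L F1 -> csupp L F2 -> csupp L F11 -> csupp L F22 ->
  (forall x, ~ (G1 `|` G2) x -> [/\ is_derive x e1 F1 (F11 x), is_derive x e2 F2 (F22 x),
    {for x, continuous F11}, {for x, continuous F22} & F11 x + F22 x = 0]) ->
  (forall x, G1 x -> F1 x = c1 /\ F2 x = c2) ->
  (forall x, G2 x -> F1 x = 0 /\ F2 x = 0) ->
  thin G1 -> thin (G1 `|` G2) -> G1 `<=` csq (0, 0) L ->
  (forall p x, G1 p -> csq p sep x -> ~ G2 x) ->
  has_grad setT phi phi1 phi2 ->
  (\int[lam2]_x (F1 x * phi1 x + F2 x * phi2 x)%:E = 0)%E.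
Proof.
move=> L0 sep0 F1c F2c F1L F2L F11L F22L off on1 on2 tG1 tG G1L sepP pg.
have [pc p1c p2c] := gradT_continuous pg.
(* The bump lives on squares of half-side [2 * e] about points of [G1]: [2 * e <= sep] keeps them
   away from [G2], and [2 * e <= 1] keeps them in the square of half-side [L + 1]. *)
pose e := Num.min 2^-1 (sep / 2).
have e0 : 0 < e by rewrite lt_min invr_gt0 ltr0n divr_gt0.
have e1l : e < 1 by rewrite gt_min; apply/orP; left; rewrite invf_lt1 ?ltr1n.
have e2l : 2 * e <= 1 by rewrite mulrC -ler_pdivlMr// ge_min div1r lexx.
have es : 2 * e <= sep by rewrite mulrC -ler_pdivlMr// ge_min lexx orbT.
have [C HC] := tG1; have [|ps [psG _ cov]] := HC e; first by rewrite e0.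
have [psi [psi1 [psi2 [sg s01 sz sI sD]]]] := cutoff_list ps e0.
have far x : (forall p, p \in ps -> ~ csq p (2 * e) x) -> [/\ psi x = 1, psi1 x = 0 & psi2 x = 0].
  move=> h; have z (c : R) : \sum_(p <- ps) c * \1_(csq p (2 * e)) x = 0.
    rewrite big_seq big1// => p /h px; by rewrite indicE memNset// mulr0.
  have := sI x; have [] := sD x; rewrite !z !normr_le0 => /eqP -> /eqP ->.
  have := z 1; under eq_bigr do rewrite mul1r.
  move=> ->; rewrite subr_le0 => s1; split => //.
  by apply/eqP; rewrite eq_le s1; case/andP: (s01 x) => _ ->.
pose M := L + 1.
have M0 : 0 <= M by rewrite addr_ge0.
have LM : L <= M by rewrite lerDl.
have out x : ~ csq (0, 0) M x -> [/\ psi x = 1, psi1 x = 0 & psi2 x = 0].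
  move=> nx; apply: far => p /psG /G1L /csqP[/= p1 p2] /csqP[x1 x2]; apply: nx; apply/csqP.
  move: p1 p2; rewrite /= !subr0 => p1 p2.
  have h (a b : R) : `|b| <= L -> `|a - b| <= 2 * e -> `|a| <= M.
    move=> bL ab; rewrite -(subrK b a) (le_trans (ler_normD _ _))// /M addrC lerD//.
    exact: le_trans ab e2l.
  by split; [exact: h p1 x1|exact: h p2 x2].
have [sc s1c s2c] := gradT_continuous sg.
have cstc (c : R) : continuous (fun _ : P2 => c) by move=> x; exact: cvg_cst.
pose eta x := 1 + (-1) * psi x.
have etac : continuous eta by apply: continuousD2 => //; exact: continuousM2.
have eg c x : is_derive x e1 (fun x => c * eta x) (- (c * psi1 x)) /\
    is_derive x e2 (fun x => c * eta x) (- (c * psi2 x)).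
  have [a1 a2 _ _] := sg x I; split.
    apply: (is_derive_eq (derZ c (derD (derC x _ 1) (derZ (-1) a1)))).
    by rewrite add0r mulN1r mulrN.
  apply: (is_derive_eq (derZ c (derD (derC x _ 1) (derZ (-1) a2)))).
  by rewrite add0r mulN1r mulrN.
have etaM : csupp M eta by move=> x /out[h _ _]; rewrite /eta h mulN1r subrr.
have s1M : csupp M psi1 by move=> x /out[].
have s2M : csupp M psi2 by move=> x /out[].
have csM c f : csupp M f -> csupp M (fun x => c * f x) by move=> fM x h; rewrite fM// mulr0.
have csN f : csupp M f -> csupp M (fun x => - f x) by move=> fM x h; rewrite fM// oppr0.
have csD f g : csupp M f -> csupp M g -> csupp M (fun x => f x + g x).
  by move=> fM gM x h; rewrite fM// gM// addr0.
have cM c (f : P2 -> R) : continuous f -> continuous (fun x => c * f x).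
  by move=> fc; apply: continuousM2.
have cN (f : P2 -> R) : continuous f -> continuous (fun x => - f x).
  by move=> fc x; apply: cvgN; exact: fc.
pose g x := c1 * psi1 x + c2 * psi2 x.
have gc : continuous g by apply: continuousD2; exact: cM.
have gM : csupp M g by apply: csD; exact: csM.
(* The subtracted field is of class C^1 on the whole plane with divergence [- g], so the exceptional
   set is empty here. The terms in [g] cancel against those of [B]. *)
have A : (\int[lam2]_x ((c1 * eta x) * phi1 x + (c2 * eta x) * phi2 x + (- g x) * phi x)%:E = 0)%E.
  apply: (@divergence_off R set0 (fun x => c1 * eta x) (fun x => c2 * eta x)
    (fun x => - (c1 * psi1 x)) (fun x => - (c2 * psi2 x)) (fun x => - g x) M M0) => //.
  - exact: cM.
  - exact: cM.
  - exact: csM.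
  - exact: csM.
  - by apply: csN; exact: csM.
  - by apply: csN; exact: csM.
  - move=> x _; split; [exact: (eg c1 x).1|exact: (eg c2 x).2| | |].
    + by apply: cvgN; apply: cvgM; [exact: cvg_cst|exact: s1c].
    + by apply: cvgN; apply: cvgM; [exact: cvg_cst|exact: s2c].
    + by rewrite /g opprD.
have B : (\int[lam2]_x ((F1 x + - (c1 * eta x)) * phi1 x + (F2 x + - (c2 * eta x)) * phi2 x
    + g x * phi x)%:E = 0)%E.
  apply: (@divergence_removable R (G1 `|` G2) (fun x => F1 x + - (c1 * eta x))
    (fun x => F2 x + - (c2 * eta x)) (fun x => F11 x + c1 * psi1 x)
    (fun x => F22 x + c2 * psi2 x) g M M0) => //.
  - by apply: continuousD2 => //; apply: cN; exact: cM.
  - by apply: continuousD2 => //; apply: cN; exact: cM.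
  - by apply: csD; [exact: (csupp_le LM F1L)|apply: csN; exact: csM].
  - by apply: csD; [exact: (csupp_le LM F2L)|apply: csN; exact: csM].
  - by apply: csD; [exact: (csupp_le LM F11L)|exact: csM].
  - by apply: csD; [exact: (csupp_le LM F22L)|exact: csM].
  - move=> x nG; have [a1 a2 a3 a4 a5] := off x nG; split.
    + by apply: (is_derive_eq (derD a1 (derN (eg c1 x).1))); rewrite opprK.
    + by apply: (is_derive_eq (derD a2 (derN (eg c2 x).2))); rewrite opprK.
    + by apply: cvgD; [exact: a3|apply: cvgM; [exact: cvg_cst|exact: s1c]].
    + by apply: cvgD; [exact: a4|apply: cvgM; [exact: cvg_cst|exact: s2c]].
    + by rewrite addrACA a5 add0r.
  - move=> x [Gx|Gx].
      have [p pps px] := cov x Gx; have [z _ _] := sz p x pps px.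
      by have [-> ->] := on1 x Gx; rewrite /eta z mulr0 addr0 !mulr1 !subrr.
    have [z _ _] : [/\ psi x = 1, psi1 x = 0 & psi2 x = 0].
      apply: far => p /psG Gp /csqP[h1 h2]; apply: (sepP p x Gp _ Gx); apply/csqP.
      by split; [exact: le_trans h1 es|exact: le_trans h2 es].
    by have [-> ->] := on2 x Gx; rewrite /eta z mulr1 subrr !mulr0 subrr.
have ABL f : csupp M f -> csupp M (fun x => f x * phi1 x) /\ csupp M (fun x => f x * phi2 x) /\
   csupp M (fun x => f x * phi x).
  by move=> fM; split; [|split] => x h; rewrite fM// mul0r.
have H := csupp_int_split M0 (f := fun x => (c1 * eta x) * phi1 x + (c2 * eta x) * phi2 x + (- g x) * phi x)
  (g := fun x => (F1 x + - (c1 * eta x)) * phi1 x + (F2 x + - (c2 * eta x)) * phi2 x + g x * phi x).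
rewrite A B adde0 in H.
rewrite -H.
- apply: eq_integral => x _; congr (_%:E).
  by move: (F1 x) (F2 x) (eta x) (g x) (phi x) (phi1 x) (phi2 x) => *; ring.
- apply: continuousD2; [apply: continuousD2|].
  + by apply: continuousM2 => //; exact: cM.
  + by apply: continuousM2 => //; exact: cM.
  + by apply: continuousM2 => //; exact: cN.
- apply: continuousD2; [apply: continuousD2|].
  + by apply: continuousM2 => //; apply: continuousD2 => //; apply: cN; exact: cM.
  + by apply: continuousM2 => //; apply: continuousD2 => //; apply: cN; exact: cM.
  + exact: continuousM2.
- by move=> x h; rewrite etaM// gM// oppr0 !mulr0 !mul0r !addr0.
- move=> x h; rewrite etaM// gM// (csupp_le LM F1L h) (csupp_le LM F2L h).
  by rewrite !mulr0 oppr0 !addr0 !mul0r !addr0.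
Qed.

End TwoCurves.

(** * Polar coordinates and annular domains *)

Section Polar.
Variable R : realType.
Notation P2 := (R * R)%type.
Notation per f := (forall t : R, f (t + 2 * pi) = f t).

(** The quantification over all periodic functions comes after the choice of [t'], so that a single
    reduced angle serves cosine, sine and the radii at once. *)
Lemma angle_reduce (t : R) : exists2 t' : R, 0 <= t' < 2 * pi &
  forall (T : Type) (f : R -> T), per f -> f t = f t'.
Proof.
have p0 : 0 < 2 * pi :> R by rewrite mulr_gt0 ?pi_gt0.
have /andP[h1 h2] := floor_itv (t / (2 * pi)).
exists (t - (Num.floor (t / (2 * pi)))%:~R * (2 * pi)).
  rewrite subr_ge0 ltrBlDl -ler_pdivlMr// h1/=.
  by move: h2; rewrite intrD ltr_pdivrMr// mulrDl mul1r.
move=> T f fp; have fn n s : f (s + n%:R * (2 * pi)) = f s.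
  elim: n s => [|n IH] s; first by rewrite mul0r addr0.
  by rewrite -addn1 natrD mulrDl mul1r addrA fp IH.
case: (Num.floor _) => n.
  by rewrite -[RHS](fn n) subrK.
by rewrite NegzE mulrNz mulNr opprK -pmulrn fn.
Qed.

Lemma cos_per : per (@cos R).
Proof. by move=> t; rewrite mulr_natl cosD2pi. Qed.

Lemma sin_per : per (@sin R).
Proof. by move=> t; rewrite mulr_natl sinD2pi. Qed.

Lemma cos_eq1 (t : R) : 0 <= t < 2 * pi -> cos t = 1 -> t = 0.
Proof.
move=> /andP[t0 t2] c1; have p0 : 0 < pi :> R := pi_gt0 R.
have [tp|tp] := leP t pi.
  by apply: cos_inj; rewrite ?in_itv/= ?t0 ?tp ?lexx ?pi_ge0// cos0.
suff : 2 * pi - t = 0 by move/eqP; rewrite subr_eq0 => /eqP e; move: t2; rewrite e ltxx.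
apply: cos_inj; rewrite ?in_itv/= ?lexx ?pi_ge0//.
  by rewrite subr_ge0 ltW//=; lra.
by rewrite cos0 addrC cos_per cosN.
Qed.

(** The difference of the angles has cosine 1, so it reduces to 0 modulo [2 * pi]. *)
Lemma same_angle (t t' : R) (T : Type) (f : R -> T) : cos t = cos t' -> sin t = sin t' ->
  per f -> f t = f t'.
Proof.
move=> ct st fp; have [d d2 H] := angle_reduce (t' - t).
have d0 : d = 0.
  apply: cos_eq1 => //; rewrite -(H _ _ cos_per) cosB ct st -!expr2.
  exact: cos2Dsin2.
have := H _ (fun s => f (t + s)) (fun s => _).
by rewrite d0 addr0 (addrC t) subrK => -> // s; rewrite addrA fp.
Qed.

Notation opol := (@pol R (0, 0)).

Lemma pol_sqr (r t : R) : (opol r t).1 ^+ 2 + (opol r t).2 ^+ 2 = r ^+ 2.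
Proof. by rewrite /pol /= !add0r !exprMn -mulrDr cos2Dsin2 mulr1. Qed.

Lemma pol_inj (r r' t t' : R) : 0 <= r -> 0 <= r' -> opol r t = opol r' t' ->
  r = r' /\ (0 < r -> forall (T : Type) (f : R -> T), per f -> f t = f t').
Proof.
move=> r0 r'0 e; have rr : r = r'.
  by apply/eqP; rewrite -(eqrXn2 (ltn0Sn 1))// -(pol_sqr r t) -(pol_sqr r' t') e.
split => // rp T f; move: e; rewrite -rr /pol /= !add0r => -[].
move=> /(mulfI (lt0r_neq0 rp)) h1 /(mulfI (lt0r_neq0 rp)) h2; exact: same_angle.
Qed.

Lemma pol_surj x : exists r t, [/\ 0 <= r, 0 <= t <= 2 * pi & x = opol r t].
Proof.
have p0 : 0 < pi :> R := pi_gt0 R.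
have n0 : 0 <= x.1 ^+ 2 + x.2 ^+ 2 by rewrite addr_ge0// sqr_ge0.
pose r := Num.sqrt (x.1 ^+ 2 + x.2 ^+ 2); exists r.
have r0 : 0 <= r by exact: sqrtr_ge0.
have rE : r ^+ 2 = x.1 ^+ 2 + x.2 ^+ 2 by exact: sqr_sqrtr.
have [rz|rn] := eqVneq r 0.
  exists 0; split => //; first by rewrite lexx mulr_ge0 ?pi_ge0.
  move/eqP: rE; rewrite rz expr0n/= eq_sym paddr_eq0 ?sqr_ge0// !sqrf_eq0 => /andP[/eqP a /eqP b].
  by rewrite /pol /= !mul0r !addr0 [LHS]surjective_pairing a b.
have rp : 0 < r by rewrite lt_neqAle eq_sym rn.
pose c := x.1 / r; pose s := x.2 / r.
have cs : c ^+ 2 + s ^+ 2 = 1.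
  by rewrite /c /s !exprMn -mulrDl -rE -exprMn divff// expr1n.
have c1 : -1 <= c <= 1.
  rewrite -ler_norml -(ler_pXn2r (ltn0Sn 1)) ?nnegrE// expr1n real_normK ?num_real//.
  by rewrite -cs lerDl sqr_ge0.
have [a0 ap] := (acos_ge0 c1, acos_lepi c1).
have ac : cos (acos c) = c by apply: acosK; rewrite in_itv.
have xs (t : R) : cos t = c -> sin t = s -> x = opol r t.
  move=> h1 h2; rewrite /pol /= h1 h2 !add0r [LHS]surjective_pairing /c /s.
  by rewrite ![r * _]mulrC !divfK.
have as2 : sin (acos c) = `|s|.
  apply/eqP; rewrite -(eqrXn2 (ltn0Sn 1)) ?normr_ge0 ?sin_ge0_pi ?a0//.
  by rewrite sin2cos2 ac -cs real_normK ?num_real// addrAC subrr add0r.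
have [s0|s0] := leP 0 s.
  exists (acos c); split => //; first by rewrite a0/=; lra.
  by apply: xs => //; rewrite as2 ger0_norm.
exists (2 * pi - acos c); split => //; first by apply/andP; split; lra.
apply: xs; first by rewrite addrC cos_per cosN.
by rewrite addrC sin_per sinN as2 ltr0_norm// opprK.
Qed.

(** A plane set given by a condition on polar coordinates, satisfied by some representative of the
    point. [radE] gives the conditions under which the choice of representative is immaterial, the
    origin included. *)
Definition rad (Q : R -> R -> bool) : set P2 :=
  [set x | exists r t, [/\ 0 <= r, x = opol r t & Q r t]].

Lemma radE (Q : R -> R -> bool) (r t : R) : (forall r t, Q r (t + 2 * pi) = Q r t) ->
  (forall t t', Q 0 t = Q 0 t') -> 0 <= r -> rad Q (opol r t) <-> Q r t.
Proof.
move=> Qp Q0 r0; split; last by move=> q; exists r, t.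
move=> [r' [t' [r'0 e q]]]; have [rr H] := pol_inj r0 r'0 e.
have [rz|rn] := eqVneq r 0; first by rewrite rz (Q0 t t') -rz rr.
by rewrite (H _ _ (Q r) (Qp r)) ?rr// lt_neqAle -rr eq_sym rn.
Qed.

Lemma per_bounded (f : R -> R) : continuous f -> per f -> exists2 M, 0 <= M & forall t, `|f t| <= M.
Proof.
move=> fc fp; have : compact (f @` `[0, 2 * pi]).
  by apply: continuous_compact; [exact: continuous_subspaceT|exact: segment_compact].
move=> /compact_bounded[m [_ mf]]; exists (Num.max 0 (m + 1)); first by rewrite le_max lexx.
move=> t; have [t' /andP[h1 h2] H] := angle_reduce t; rewrite (H _ f fp) le_max; apply/orP; right.
by apply: (mf (m + 1)); [rewrite ltrDl|exists t' => //; rewrite /= in_itv/= h1 ltW].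
Qed.

(** The band is the continuous image of a rectangle: the angle, and a parameter in [0, 1] that
    interpolates linearly between the two radii. *)
Lemma compact_band (f h : R -> R) : continuous f -> continuous h -> per f -> per h ->
  (forall t, 0 <= f t <= h t) -> compact (rad (fun r t => f t <= r <= h t)).
Proof.
move=> fc hc fp hp fh.
pose F (z : P2) := opol (f z.2 + z.1 * (h z.2 - f z.2)) z.2.
have -> : rad (fun r t => f t <= r <= h t) = F @` (`[0, 1]%classic `*` `[0, 2 * pi]%classic).
  apply/seteqP; split => x.
    move=> [r [t [r0 -> /andP[q1 q2]]]].
    have [t' /andP[t0 t1] H] := angle_reduce t.
    rewrite /pol (H _ _ cos_per) (H _ _ sin_per).
    move: q1 q2; rewrite (H _ _ fp) (H _ _ hp) => q1 q2.
    (* The radii may coincide, as they do when the band is a curve; the parameter is then taken to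
       be 0. *)
    have [e|ne] := eqVneq (h t' - f t') 0.
      exists (0, t'); first by rewrite /= !in_itv/= lexx ler01 t0 ltW.
      rewrite /F /= mul0r addr0 (_ : r = f t')//; apply/eqP; rewrite eq_le q1 andbT.
      by move/eqP: e; rewrite subr_eq0 => /eqP <-.
    have d0 : 0 < h t' - f t' by rewrite lt_neqAle eq_sym ne subr_ge0; case/andP: (fh t').
    exists ((r - f t') / (h t' - f t'), t').
      rewrite /= !in_itv/= t0 (ltW t1) ler_pdivrMr// mul1r lerD2r q2 divr_ge0 ?subr_ge0 ?(ltW d0)//.
      by move: d0; rewrite subr_gt0 => /ltW.
    by rewrite /F /= divfK// addrC subrK.
  move=> [[s t] /= []]; rewrite !in_itv/= => /andP[s0 s1] _ <-.
  have /andP[f0 fht] := fh t; have d0 : 0 <= h t - f t by rewrite subr_ge0.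
  have sd : 0 <= s * (h t - f t) by rewrite mulr_ge0.
  have sd1 : s * (h t - f t) <= h t - f t by rewrite ler_piMl.
  exists (f t + s * (h t - f t)), t; split => //; first by rewrite addr_ge0.
  by rewrite lerDl sd/=; lra.
apply: continuous_compact; last by apply: compact_setX; exact: segment_compact.
apply: continuous_subspaceT => z; apply: (@pol_continuous R _ (fun _ : P2 => (0, 0)) (fun z => f z.2 + z.1 * (h z.2 - f z.2)) (fun z => z.2)); [exact: cvg_cst| |exact: cvg_snd].
have c2 (k : R -> R) : continuous k -> {for z, continuous (fun z : P2 => k z.2)}.
  by move=> kc; apply: (@continuous_at_comp _ _ _ (fun z : P2 => z.2) k); [exact: cvg_snd|exact: kc].
apply: cvgD; first exact: c2.
apply: cvgM; first exact: cvg_fst.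
by apply: cvgB; exact: c2.
Qed.

(** The set is unbounded. It is split into a compact band and the complement of an open disc whose
    radius bounds [f]. *)
Lemma closed_outer (f : R -> R) : continuous f -> per f -> (forall t, 0 <= f t) ->
  closed (rad (fun r t => f t <= r)).
Proof.
move=> fc fp f0; have [M M0 fM] := per_bounded fc fp.
have -> : rad (fun r t => f t <= r) =
    rad (fun r t => f t <= r <= M) `|` [set x | M ^+ 2 <= x.1 ^+ 2 + x.2 ^+ 2].
  have fm t : f t <= M by rewrite (le_trans (ler_norm _)).
  apply/seteqP; split => x.
    move=> [r [t [r0 -> q]]]; have [rM|rM] := leP r M; first by left; exists r, t; rewrite q rM.
    by right; rewrite /= pol_sqr lerXn2r ?nnegrE// ltW.
  move=> [[r [t [r0 -> /andP[q _]]]]|/=]; first by exists r, t.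
  have [r [t [r0 _ ->]]] := pol_surj x; rewrite pol_sqr ler_pXn2r ?nnegrE// => h.
  by exists r, t; rewrite (le_trans (fm t) h).
apply: closedU.
  apply: compact_closed; first exact: norm_hausdorff.
  apply: compact_band => //; first by move=> ?; exact: cvg_cst.
  by move=> t; rewrite f0 (le_trans (ler_norm _)).
apply: (@preimage_closed _ _ (fun x : P2 => x.1 ^+ 2 + x.2 ^+ 2) [set y | M ^+ 2 <= y]); last exact: closed_ge.
move=> x _; have sq (k : P2 -> R) : {for x, continuous k} -> {for x, continuous (fun x => k x ^+ 2)}.
  by move=> kc; exact: (cvgM kc kc).
by apply: cvgD; apply: sq; [exact: cvg_fst|exact: cvg_snd].
Qed.

End Polar.

(** * Curves in polar form and the domain between two of them *)

Section Annulus.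
Variable R : realType.
Notation P2 := (R * R)%type.
Notation per f := (forall t : R, f (t + 2 * pi) = f t).
Notation opol := (@pol R (0, 0)).

Definition curve (f : R -> R) := rad (fun r t => r == f t).

Section OneCurve.
Variable f : R -> R.
Hypotheses (fc : continuous f) (fp : per f) (f0 : forall t, 0 < f t).

Lemma rad_leE r t : 0 <= r -> rad (fun r t => r <= f t) (opol r t) <-> r <= f t.
Proof. by apply: radE => [s u|s u]; rewrite ?fp// !ltW. Qed.

Lemma rad_geE r t : 0 <= r -> rad (fun r t => f t <= r) (opol r t) <-> f t <= r.
Proof. by apply: radE => [s u|s u]; rewrite ?fp// !leNgt !f0. Qed.

Lemma curveE r t : 0 <= r -> curve f (opol r t) <-> r = f t.
Proof.
move=> r0; split; last by move=> e; exists r, t; rewrite -e.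
move=> h; apply/eqP; apply/(@radE R (fun r t => r == f t) r t) => // [s u|s u]; rewrite ?fp//.
by rewrite !lt_eqF.
Qed.

Lemma compact_inner : compact (rad (fun r t => r <= f t)).
Proof.
have -> : rad (fun r t => r <= f t) = rad (fun r t => 0 <= r <= f t).
  apply/seteqP; split => x [r [t [r0 -> q]]]; exists r, t; split => //; first by rewrite r0.
  by case/andP: q.
apply: compact_band => //; first by move=> ?; exact: cvg_cst.
by move=> t; rewrite lexx ltW.
Qed.

Lemma compact_curve : compact (curve f).
Proof.
have -> : curve f = rad (fun r t => f t <= r <= f t).
  by apply/seteqP; split => x [r [t [r0 -> q]]]; exists r, t; split => //; rewrite -eq_le eq_sym in q *.
by apply: compact_band => // t; rewrite lexx ltW.
Qed.

Lemma closed_inner : closed (rad (fun r t => r <= f t)).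
Proof. by apply: compact_closed; [exact: norm_hausdorff|exact: compact_inner]. Qed.

Lemma nbhs_inner x : rad (fun r t => r <= f t) x -> ~ curve f x ->
  \forall y \near x, rad (fun r t => r <= f t) y.
Proof.
have [r [t [r0 _ ->]]] := pol_surj x; move=> /(rad_leE _ r0) h nc.
have oC : open (~` rad (fun r t => f t <= r)).
  by apply: closed_openC; apply: closed_outer => // s; exact: ltW.
have : (~` rad (fun r t => f t <= r)) (opol r t).
  by move=> /(rad_geE _ r0) h'; apply: nc; apply/(curveE _ r0)/eqP; rewrite eq_le h h'.
move=> /(conj oC)/open_nbhs_nbhs; apply: filterS => y.
have [s [u [s0 _ ->]]] := pol_surj y => h'; apply/(rad_leE _ s0).
by case: (leP s (f u)) => // /ltW fs; case: h'; apply/(rad_geE _ s0).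
Qed.

Lemma nbhs_outer x : rad (fun r t => f t <= r) x -> ~ curve f x ->
  \forall y \near x, rad (fun r t => f t <= r) y.
Proof.
have [r [t [r0 _ ->]]] := pol_surj x; move=> /(rad_geE _ r0) h nc.
have oC := closed_openC closed_inner.
have : (~` rad (fun r t => r <= f t)) (opol r t).
  by move=> /(rad_leE _ r0) h'; apply: nc; apply/(curveE _ r0)/eqP; rewrite eq_le h h'.
move=> /(conj oC)/open_nbhs_nbhs; apply: filterS => y.
have [s [u [s0 _ ->]]] := pol_surj y => h'; apply/(rad_geE _ s0).
by case: (leP (f u) s) => // /ltW fs; case: h'; apply/(rad_leE _ s0).
Qed.

(** Sampling at equally spaced angles: both cartesian coordinates of the curve are Lipschitz in the
    angle with constant [K'], so about [2 * pi * K' / e] samples suffice. *)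
Lemma thin_curve (K : R) : (forall s t : R, 0 <= s <= 2 * pi -> 0 <= t <= 2 * pi ->
  `|f s - f t| <= K * `|s - t|) -> thin (curve f).
Proof.
move=> fK; have [M M0 fM] := per_bounded fc fp.
have p0 : 0 < 2 * pi :> R by rewrite mulr_gt0 ?pi_gt0.
pose K' := `|K| + M + 1.
have K0 : 0 < K' by rewrite ltr_wpDl// addr_ge0.
have lip (k k' : R -> R) (s t : R) : (forall t : R, is_derive t (1 : R) k (k' t)) -> (forall t, `|k' t| <= 1) ->
    `|k s - k t| <= `|s - t|.
  move=> dk k1; have [c _ ->] := mvt_abs (a := t) (b := s) (fun t _ => dk t).
  by rewrite normrM ler_piMl.
have lipf (k : R -> R) (s t : R) : (forall s t : R, `|k s - k t| <= `|s - t|) -> (forall t, `|k t| <= 1) ->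
    0 <= s <= 2 * pi -> 0 <= t <= 2 * pi -> `|f s * k s - f t * k t| <= K' * `|s - t|.
  move=> lk k1 hs ht.
  have -> : f s * k s - f t * k t = (f s - f t) * k s + f t * (k s - k t) by ring.
  apply: le_trans (ler_normD _ _) _; rewrite !normrM.
  have h1 : `|f s - f t| * `|k s| <= `|K| * `|s - t|.
    apply: (@le_trans _ _ `|f s - f t|); first exact: ler_piMr.
    by apply: le_trans (fK s t hs ht) _; apply: ler_wpM2r => //; exact: ler_norm.
  have h2 : `|f t| * `|k s - k t| <= M * `|s - t| by apply: ler_pM.
  have h3 : 0 <= `|s - t| by [].
  by rewrite /K' !mulrDl mul1r; move: h1 h2 h3; lra.
have cs1 t := (cos_sin_le1 t).1; have sn1 t := (cos_sin_le1 t).2.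
have lc (s t : R) : `|cos s - cos t| <= `|s - t|.
  by apply: (lip _ (fun u => - sin u)) => u; rewrite normrN; exact: sn1.
have ls (s t : R) : `|sin s - sin t| <= `|s - t|.
  by apply: (lip _ (@cos R)) => u; exact: cs1.
exists (2 * pi * K' + 2) => e /andP[e0 e1].
(* There are [N.+1] steps of length [h] with [K' * h < e], and both endpoints are sampled, which
   makes [N.+2] points; since [e < 1], this is the [+ 2] in the constant. *)
pose N : nat := Num.truncn (2 * pi * K' / e); pose n := N.+1.
have x0 : 0 <= 2 * pi * K' / e by rewrite ltW// divr_gt0// mulr_gt0.
have /andP[N1 N2] := truncn_itv x0.
have n0 : 0 < n%:R :> R by rewrite ltr0n.
pose h : R := 2 * pi / n%:R; have h0 : 0 < h by rewrite divr_gt0.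
have Kh : K' * h < e.
  by rewrite /h mulrA ltr_pdivrMr// [ltRHS]mulrC -ltr_pdivrMr// [K' * _]mulrC.
pose P (i : nat) := opol (f (i%:R * h)) (i%:R * h).
exists [seq P i | i <- iota 0 n.+1]; split.
- by move=> p /mapP[i _ ->]; exists (f (i%:R * h)), (i%:R * h); split => //; exact: ltW.
- rewrite size_map size_iota /n -addn2 natrD mulrDl; apply: lerD.
    by rewrite -ler_pdivlMr.
  by rewrite ler_piMr// ltW.
- move=> x [r [t [r0 -> /eqP ->]]]; have [t' /andP[t0 t1] H] := angle_reduce t.
  rewrite /pol (H _ _ (@cos_per R)) (H _ _ (@sin_per R)) (H _ _ fp) -/(opol (f t') t').
  have q0 : 0 <= t' / h by rewrite divr_ge0// ltW.
  have /andP[i1 i2] := truncn_itv q0; set i := Num.truncn _ in i1 i2.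
  have ih : i%:R * h <= t' by rewrite -ler_pdivlMr.
  have ih2 : t' - i%:R * h < h by move: i2; rewrite -addn1 natrD ltr_pdivrMr// mulrDl mul1r ltrBlDl.
  have ib : 0 <= i%:R * h <= 2 * pi by rewrite (le_trans ih (ltW t1)) mulr_ge0// ltW.
  have tb : 0 <= t' <= 2 * pi by rewrite t0 ltW.
  have nt : `|t' - i%:R * h| < h by rewrite ger0_norm// subr_ge0.
  have bd (k : R -> R) : (forall s t : R, `|k s - k t| <= `|s - t|) -> (forall t, `|k t| <= 1) ->
      `|f t' * k t' - f (i%:R * h) * k (i%:R * h)| < e.
    move=> lk k1; apply: le_lt_trans (lipf k _ _ lk k1 tb ib) _; apply: lt_trans Kh.
    by rewrite ltr_pM2l.
  exists (P i).
    apply: map_f; rewrite mem_iota add0n ltnS /=.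
    rewrite -(ler_nat R) (le_trans i1)// ler_pdivrMr// /h mulrC divfK ?gt_eqF//.
    exact: ltW.
  by split; rewrite /P /pol /= !add0r; apply: bd.
Qed.

End OneCurve.

Lemma thinU (A B : set P2) : thin A -> thin B -> thin (A `|` B).
Proof.
move=> [C HC] [D HD]; exists (C + D) => e e01.
have [ps [p1 p2 p3]] := HC e e01; have [qs [q1 q2 q3]] := HD e e01.
exists (ps ++ qs); split.
- by move=> p; rewrite mem_cat => /orP[/p1|/q1]; [left|right].
- by rewrite size_cat natrD mulrDl lerD.
- move=> x [/p3[p pp px]|/q3[p pp px]]; exists p => //; rewrite mem_cat pp ?orbT//.
Qed.

(** The distance takes a compact, hence closed, set of values on the product of the two sets, and
    this set misses 0. *)
Lemma compact_separation (A B : set P2) : compact A -> compact B -> (forall x, A x -> ~ B x) ->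
  exists2 d : R, 0 < d & forall p x, A p -> csq p d x -> ~ B x.
Proof.
move=> cA cB AB; pose D (z : P2 * P2) := `|z.2.1 - z.1.1| + `|z.2.2 - z.1.2|.
have Dc : continuous D.
  move=> z.
  have p1 : {for z, continuous (fun z : P2 * P2 => z.1)} by exact: cvg_fst.
  have p2 : {for z, continuous (fun z : P2 * P2 => z.2)} by exact: cvg_snd.
  apply: cvgD; apply: cvg_norm; apply: cvgB.
  - exact: continuous_fst p2.
  - exact: continuous_fst p1.
  - exact: continuous_snd p2.
  - exact: continuous_snd p1.
have cD : closed (D @` (A `*` B)).
  apply: compact_closed; first exact: Rhausdorff.
  by apply: continuous_compact; [exact: continuous_subspaceT|exact: compact_setX].
have n0 : (~` (D @` (A `*` B))) 0.
  move=> [[x y] [/= Ax By]]; rewrite /D /= => /eqP; rewrite paddr_eq0// !normr_eq0 !subr_eq0.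
  by move=> /andP[/eqP a /eqP b]; apply: (AB x Ax); rewrite [x]surjective_pairing -a -b -surjective_pairing.
have /nbhs_ballP[e e0 eD] := open_nbhs_nbhs (conj (closed_openC cD) n0).
exists (e / 3); first by rewrite divr_gt0.
move=> p x Ap /csqP[h1 h2] Bx; apply: (eD (D (p, x))); last by exists (p, x).
rewrite -ball_normE /= sub0r normrN ger0_norm ?addr_ge0// /D /=.
have e0' : 0 < e by exact: e0.
by move: h1 h2; move: (`|_|) (`|_|) => u v h1 h2; lra.
Qed.

Section TwoRadii.
Variables g G : R -> R.
Hypotheses (gc : continuous g) (Gc : continuous G) (gp : per g) (Gp : per G).
Hypotheses (g0 : forall t, 0 < g t) (gG : forall t, g t < G t).

Let G0 t : 0 < G t. Proof. exact: lt_trans (g0 t) (gG t). Qed.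

Definition annulus := rad (fun r t => g t < r < G t).
(** The two complementary regions are closed and contain the boundary curves, so that together with
    the open annulus they partition the plane. *)
Definition hole := rad (fun r t => r <= g t).
Definition exterior := rad (fun r t => G t <= r).

Lemma ringE r t : 0 <= r -> annulus (opol r t) <-> g t < r < G t.
Proof.
apply: radE => [s u|s u]; rewrite ?gp ?Gp//.
by rewrite !ltNge (ltW (g0 s)) (ltW (g0 u)).
Qed.

Lemma annulus_cases x : [\/ annulus x, hole x | exterior x].
Proof.
have [r [t [r0 _ ->]]] := pol_surj x.
have [h|h] := leP r (g t); first by apply: Or32; apply/rad_leE.
have [h'|h'] := leP (G t) r; first by apply: Or33; apply/rad_geE.
by apply: Or31; apply/ringE => //; rewrite h h'.
Qed.

Lemma annulus_hole x : annulus x -> ~ hole x.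
Proof.
have [r [t [r0 _ ->]]] := pol_surj x => /(ringE _ r0)/andP[h _] /(rad_leE gp g0 _ r0).
by rewrite leNgt h.
Qed.

Lemma annulus_exterior x : annulus x -> ~ exterior x.
Proof.
have [r [t [r0 _ ->]]] := pol_surj x => /(ringE _ r0)/andP[_ h] /(rad_geE Gp G0 _ r0).
by rewrite leNgt h.
Qed.

Lemma hole_exterior x : hole x -> ~ exterior x.
Proof.
have [r [t [r0 _ ->]]] := pol_surj x => /(rad_leE gp g0 _ r0) h /(rad_geE Gp G0 _ r0).
by rewrite leNgt (le_lt_trans h).
Qed.

Lemma closed_hole : closed hole. Proof. exact: closed_inner. Qed.

Lemma closed_exterior : closed exterior. Proof. by apply: closed_outer => // t; exact: ltW. Qed.

Lemma annulus_setC : annulus = ~` (hole `|` exterior).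
Proof.
apply/seteqP; split => x; first by move=> rx [/(annulus_hole rx)|/(annulus_exterior rx)].
by move=> nx; have [//|h|h] := annulus_cases x; case: nx; [left|right].
Qed.

Lemma open_annulus : open annulus.
Proof. by rewrite annulus_setC; apply: closed_openC; apply: closedU; [exact: closed_hole|exact: closed_exterior]. Qed.

Lemma curve_hole x : curve g x -> hole x.
Proof. by have [r [t [r0 _ ->]]] := pol_surj x => /(curveE gp g0 _ r0) e; apply/(rad_leE gp g0 _ r0); rewrite e. Qed.

Lemma curve_exterior x : curve G x -> exterior x.
Proof. by have [r [t [r0 _ ->]]] := pol_surj x => /(curveE Gp G0 _ r0) e; apply/(rad_geE Gp G0 _ r0); rewrite e. Qed.

Lemma off_curves x : ~ (curve g `|` curve G) x ->
  [\/ annulus x, \forall y \near x, hole y | \forall y \near x, exterior y].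
Proof.
move=> nc; have [h|h|h] := annulus_cases x; first exact: Or31.
- by apply: Or32; apply: nbhs_inner => // c; apply: nc; left.
- by apply: Or33; apply: nbhs_outer => // c; apply: nc; right.
Qed.

Lemma nbhs_not_exterior x : hole x -> \forall y \near x, ~ exterior y.
Proof. by move=> /hole_exterior h; apply: open_nbhs_nbhs; split => //; apply: closed_openC; exact: closed_exterior. Qed.

Lemma nbhs_not_hole x : exterior x -> \forall y \near x, ~ hole y.
Proof.
move=> ex; apply: open_nbhs_nbhs; split; first by apply: closed_openC; exact: closed_hole.
by move=> h; exact: (hole_exterior h ex).
Qed.

Lemma annulus_bounded : exists2 L, 0 <= L & annulus `|` hole `<=` csq (0, 0) L.
Proof.
have [L L0 GL] := per_bounded Gc Gp; exists L => // x rh.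
have [r [t [r0 rt ->]]] : exists r t, [/\ 0 <= r, r <= G t & x = opol r t].
  case: rh => -[r [t [r0 -> q]]]; exists r, t; split => //.
    by apply: ltW; case/andP: q.
  by apply: ltW; exact: le_lt_trans q (gG t).
have rL : r <= L by apply: le_trans rt _; apply: le_trans (GL t); exact: ler_norm.
have [c1 s1] := cos_sin_le1 t.
apply/csqP; rewrite /pol /= !subr0 !add0r !normrM (ger0_norm r0).
by split; apply: le_trans rL; apply: ler_piMr.
Qed.

(** Both orders of the radii are allowed, so that letting [s] tend to 0 reaches either boundary
    curve, the one of radius [f0]. *)
Lemma annulus_path (f0 f1 : R -> R) (s t : R) : (f0 = g /\ f1 = G) \/ (f0 = G /\ f1 = g) ->
  0 < s < 1 -> annulus (opol (f0 t + s * (f1 t - f0 t)) t).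
Proof.
move=> fs /andP[s0 s1]; have d0 : 0 < G t - g t by rewrite subr_gt0.
have w0 : 0 < s * (G t - g t) by rewrite mulr_gt0.
have w1 : s * (G t - g t) < G t - g t by rewrite gtr_pMl.
have h : g t < f0 t + s * (f1 t - f0 t) < G t.
  case: fs => -[-> ->]; first by apply/andP; split; lra.
  by rewrite -(opprB (G t)) mulrN; apply/andP; split; lra.
by apply/ringE => //; apply: ltW; apply: lt_trans (g0 t) _; case/andP: h.
Qed.

Lemma path_cvg (f0 f1 : R -> R) (t : R) :
  opol (f0 t + s * (f1 t - f0 t)) t @[s --> (0 : R)^'+] --> opol (f0 t) t.
Proof.
apply: cvg_at_right_filter.
have : {for 0, continuous (fun s : R => opol (f0 t + s * (f1 t - f0 t)) t)}.
  apply: (@pol_continuous R R (fun _ : R => (0, 0)) (fun s : R => f0 t + s * (f1 t - f0 t)) (fun _ : R => t)).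
  - exact: cvg_cst.
  - by apply: cvgD; [exact: cvg_cst|apply: cvgM; [exact: cvg_id|exact: cvg_cst]].
  - exact: cvg_cst.
by rewrite /prop_for /continuous_at mul0r addr0.
Qed.

Lemma curve_closure x : (curve g `|` curve G) x -> closure annulus x.
Proof.
have aux (f0 f1 : R -> R) t : (f0 = g /\ f1 = G) \/ (f0 = G /\ f1 = g) -> closure annulus (opol (f0 t) t).
  move=> fs U NU0; have NU := @path_cvg f0 f1 t U NU0.
  have N1 : \forall s \near (0 : R)^'+, s < 1 by exact: nbhs_right_lt.
  have N0 : \forall s \near (0 : R)^'+, 0 < s by exact: nbhs_right_gt.
  have [s [[s0 s1] Us]] := filter_ex (filterI (filterI N0 N1) NU).
  by exists (opol (f0 t + s * (f1 t - f0 t)) t); split => //; apply: annulus_path => //; rewrite s0.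
case=> -[r [t [r0 -> /eqP ->]]].
  by apply: (aux g G); left.
by apply: (aux G g); right.
Qed.

End TwoRadii.
End Annulus.

(** * Analytic functions of the angle have continuous derivatives *)

Section Analytic.
Variable R : realType.

(** Comparison with a geometric series. Two radii w < w' are inserted between [|z|] and [|K|]: the
    terms are bounded at w', and passing from [|z|] to w pays for the factor n + 1 of the derived
    series. *)
Lemma cvg_pseries_diffs (c : R^nat) (K z : R) : cvgn (pseries c K) -> `|z| < `|K| ->
  cvgn (pseries (pseries_diffs c) z).
Proof.
move=> cK zK; have [w1 w2] := midf_lt zK; set w := (`|z| + `|K|) / 2 in w1 w2.
have [w3 w4] := midf_lt w2; set w' := (w + `|K|) / 2 in w3 w4.
clearbody w w'; have z0 := normr_ge0 z; have w0 : 0 < w := le_lt_trans z0 w1.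
have w'0 : 0 < w' := lt_trans w0 w3.
have cw : cvgn (pseries c w') by apply: is_cvg_pseries_inside cK _; rewrite gtr0_norm.
have [M [_ MB]] := cvg_series_bounded cw.
have cM n : `|c n| * w' ^+ n <= M + 1.
  by have := MB (M + 1); rewrite ltrDl ltr01 => /(_ isT n I); rewrite /= normrM normrX (gtr0_norm w'0).
have key n : n.+1%:R * `|z| ^+ n * (w - `|z|) <= w ^+ n.+1.
  have d0 : 0 <= w - `|z| by rewrite subr_ge0 ltW.
  elim: n => [|n IH]; first by rewrite expr0 !mul1r expr1 gerBl.
  have h1 : `|z| * (n.+1%:R * `|z| ^+ n * (w - `|z|)) <= `|z| * w ^+ n.+1 by rewrite ler_wpM2l.
  have h2 : `|z| ^+ n.+1 * (w - `|z|) <= w ^+ n.+1 * (w - `|z|).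
    by rewrite ler_wpM2r// lerXn2r ?nnegrE ?(ltW w0) ?(ltW w1).
  have -> : n.+2%:R * `|z| ^+ n.+1 * (w - `|z|) = `|z| * (n.+1%:R * `|z| ^+ n * (w - `|z|)) +
      `|z| ^+ n.+1 * (w - `|z|) by rewrite [`|z| ^+ n.+1]exprS -(addn1 n.+1) natrD; ring.
  by apply: le_trans (lerD h1 h2) _; rewrite [w ^+ n.+2]exprS; apply: le_refl_eq; ring.
apply: normed_cvg.
apply: (@series_le_cvg _ _ (geometric ((M + 1) / (w - `|z|) * (w / w')) (w / w'))).
- by move=> n; exact: normr_ge0.
- move=> n; rewrite /= mulr_ge0 ?exprn_ge0 ?divr_ge0 ?(ltW w0) ?(ltW w'0)//.
  rewrite mulr_ge0 ?divr_ge0 ?(ltW w0) ?(ltW w'0) ?subr_ge0 ?(ltW w1)//.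
  by apply: le_trans (cM 0%N); rewrite mulr_ge0// exprn_ge0// ltW.
- move=> n; rewrite /= /pseries_diffs normrM normrM normr_nat normrX.
  have d0 : 0 < w - `|z| by rewrite subr_gt0.
  have h1 : n.+1%:R * `|z| ^+ n <= w ^+ n.+1 / (w - `|z|) by rewrite ler_pdivlMr.
  have h2 : `|c n.+1| <= (M + 1) / w' ^+ n.+1 by rewrite ler_pdivlMr ?exprn_gt0.
  apply: (@le_trans _ _ ((M + 1) / w' ^+ n.+1 * (w ^+ n.+1 / (w - `|z|)))).
    rewrite mulrAC mulrC; apply: ler_pM => //.
  apply: le_refl_eq; rewrite -[RHS]mulrA -exprS expr_div_n.
  by rewrite [X in _ * X = _]mulrC mulrACA; congr (_ * _); rewrite mulrC.
- apply: is_cvg_geometric_series; rewrite ger0_norm ?divr_ge0 ?(ltW w0) ?(ltW w'0)//.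
  by rewrite ltr_pdivrMr// mul1r.
Qed.

(** Termwise differentiation at a point requires convergence of the derived series at a larger one,
    so the radius is halved with each derivation. Continuity of the derivative at 0 follows from its
    own differentiability there. *)
Lemma pseries_C1 (c : R^nat) (r : R) : (forall x, `|x| < r -> cvgn (pseries c x)) -> 0 < r ->
  exists2 f' : R -> R, {for 0, continuous f'} &
    \forall x \near 0, is_derive x (1 : R) (fun x => limn (pseries c x)) (f' x).
Proof.
move=> cr r0; pose k n := r / 2 ^+ n.+1.
have k0 n : 0 < k n by rewrite divr_gt0// exprn_gt0.
have kS n : k n.+1 < k n.
  by rewrite /k ltr_pM2l// ltf_pV2 ?posrE ?exprn_gt0// [ltRHS]exprS ltr_pMl ?exprn_gt0// ltr1n.
have nk n : `|k n| = k n by rewrite gtr0_norm.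
have down (d : R^nat) n : cvgn (pseries d (k n)) -> cvgn (pseries d (k n.+1)).
  by move=> h; apply: is_cvg_pseries_inside h _; rewrite !nk.
have diff (d : R^nat) n : cvgn (pseries d (k n)) -> cvgn (pseries (pseries_diffs d) (k n.+1)).
  by move=> h; apply: cvg_pseries_diffs h _; rewrite !nk.
have h0 : cvgn (pseries c (k 0%N)).
  by apply: cr; rewrite nk /k expr1 ltr_pdivrMr// ltr_pMr// ltr1n.
have h1 := diff _ _ h0; have h2 := diff _ _ h1; have h3 := diff _ _ h2.
exists (fun x => limn (pseries (pseries_diffs c) x)).
  have D : is_derive (0 : R) (1 : R) (fun x => limn (pseries (pseries_diffs c) x))
      (limn (pseries (pseries_diffs (pseries_diffs c)) 0)).
    apply: (pseries_snd_diffs (down _ 2%N (down _ 1%N h1)) (down _ 2%N h2) h3).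
    by rewrite normr0 nk.
  exact: derive_continuous_at D.
have /= N := @nbhsx_ballx R R 0 (k 2%N) (k0 _).
apply: filterS N => x; rewrite -ball_normE /= sub0r normrN => xk.
by apply: (pseries_snd_diffs (down _ 1%N (down _ 0%N h0)) (down _ 1%N h1) h2); rewrite nk.
Qed.

Lemma analytic_C1 (b : R -> R) : analytic_on_T b ->
  exists2 b' : R -> R, continuous b' & forall t : R, is_derive t (1 : R) b (b' t).
Proof.
move=> [_ ab].
have loc (t0 : R) : exists2 f' : R -> R, {for t0, continuous f'} &
    nbhs (t0 : R) (fun t : R => is_derive t (1 : R) b (f' t)).
  have [r [r0 [c hc]]] := ab t0.
  have cl x : `|x| < r -> pseries c x @ \oo --> b (x + t0).
    move=> xr; have -> : pseries c x = fun N : nat => \sum_(k < N) c k * (x + t0 - t0) ^+ k.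
      by apply/funext => n; rewrite /pseries /series /= big_mkord addrK.
    by apply: hc; rewrite addrK.
  have [f' f'c fd] := @pseries_C1 c r (fun x xr => cvgP _ (cl x xr)) r0.
  exists (fun t => f' (t - t0)).
    apply: (@continuous_at_comp _ _ _ (fun t => t - t0) f').
      by apply: cvgB; [exact: cvg_id|exact: cvg_cst].
    by rewrite /prop_for subrr.
  have sh : (fun t => t - t0) @ t0 --> (0 : R).
    by rewrite -[0](subrr t0); apply: cvgB; [exact: cvg_id|exact: cvg_cst].
  have N1 : \forall t \near t0, is_derive (t - t0) (1 : R) (fun x => limn (pseries c x)) (f' (t - t0)).
    exact: (sh _ fd).
  have N2 : \forall t \near (t0 : R), `|t - t0| < r.
    have /= N := @nbhsx_ballx R R t0 r r0.
    by apply: filterS N => t; rewrite -ball_normE /= distrC.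
  have N : nbhs (t0 : R) (fun t : R => is_derive (t - t0) (1 : R) (fun x => limn (pseries c x)) (f' (t - t0)) /\
      `|t - t0| < r) by exact: filterI N1 N2.
  apply: (@filterS _ (nbhs (t0 : R)) _ _ _ _ (nbhs_interior N)) => t tN; have [d _] := nbhs_singleton tN.
  have d1 : is_derive t (1 : R) (fun t => t - t0) 1.
    by apply: (is_derive_eq (derD (is_derive_id t 1) (derC t 1 (- t0)))); rewrite addr0.
  have D := @is_derive1_comp R _ (fun t => t - t0) t _ _ d d1.
  rewrite mulr1 in D.
  apply: (near_eq_is_derive _ D).
  apply: filterS tN => s [_ sr]; rewrite /=.
  have E : limn (pseries c (s - t0)) = b s.
    by have := cl _ sr; rewrite subrK => /cvg_lim; apply.
  by rewrite E.
exists ('D_1 b) => t.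
  have [f' f'c N] := loc t.
  have N' : nbhs (t : R) (fun s : R => f' s = 'D_1 b s).
    by apply: (@filterS _ (nbhs (t : R)) _ _ _ _ N) => s d; rewrite (@derive_val _ _ _ _ _ _ _ d).
  exact: (for_continuous_near N' f'c).
have [f' _ N] := loc t; have d := nbhs_singleton N.
by rewrite (@derive_val _ _ _ _ _ _ _ d).
Qed.

End Analytic.

(** * Constancy of the solution on a boundary curve *)

Section BoundaryValues.
Variable R : realType.
Notation P2 := (R * R)%type.
Notation opol := (@pol R (0, 0)).

(* Along the curves of constant relative radius [s], the tangential derivative of [u] is at most a
   constant times its gradient, which tends to 0 uniformly as [s] tends to 0. *)
Lemma boundary_const (A : set P2) (u u1 u2 V1 V2 : P2 -> R) (f0 f1 f0' f1' : R -> R) (M L : R) :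
  open A -> has_grad A u u1 u2 -> {within closure A, continuous u} ->
  continuous V1 -> continuous V2 -> csupp L V1 -> csupp L V2 ->
  (forall x, A x -> V1 x = u1 x /\ V2 x = u2 x) ->
  (forall t, is_derive t (1 : R) f0 (f0' t)) -> (forall t, is_derive t (1 : R) f1 (f1' t)) ->
  (forall t, `|f0 t| <= M) -> (forall t, `|f1 t| <= M) ->
  (forall t, `|f0' t| <= M) -> (forall t, `|f1' t| <= M) ->
  (forall s t : R, 0 < s < 1 -> A (opol (f0 t + s * (f1 t - f0 t)) t)) ->
  (forall t, V1 (opol (f0 t) t) = 0 /\ V2 (opol (f0 t) t) = 0) ->
  forall t, 0 <= t -> u (opol (f0 t) t) = u (opol (f0 0) 0).
Proof.
move=> oA ug uc V1c V2c V1L V2L Vu d0 d1 b0 b1 b0' b1' inA V0 t1 t10.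
have M0 : 0 <= M := le_trans (normr_ge0 _) (b0 0).
pose X (s t : R) := opol (f0 t + s * (f1 t - f0 t)) t.
have lim (t : R) : u (X s t) @[s --> (0 : R)^'+] --> u (opol (f0 t) t).
  have Xin : \forall s \near (0 : R)^'+, A (X s t).
    have N1 : \forall s \near (0 : R)^'+, s < 1 by exact: nbhs_right_lt.
    have N0 : \forall s \near (0 : R)^'+, 0 < s by exact: nbhs_right_gt.
    by apply: filterS (filterI N0 N1) => s [s0 s1]; apply: inA; rewrite s0.
  have Xc := @path_cvg R f0 f1 t.
  have cl : closure A (opol (f0 t) t).
    move=> U NU0; have NU : \forall s \near (0 : R)^'+, U (X s t) by exact: (Xc U NU0).
    have N2 : \forall s \near (0 : R)^'+, A (X s t) /\ U (X s t) by exact: filterI Xin NU.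
    have [s [h1 h2]] := @filter_ex _ _ (at_right_proper_filter (0 : R)) _ N2.
    by exists (X s t).
  have uc' := (subspace_continuousP _ _).1 uc _ cl.
  move=> U NU0; have NU := uc' U NU0.
  have NU' : \forall s \near (0 : R)^'+, closure A (X s t) -> U (u (X s t)) by exact: (Xc _ NU).
  by apply: filterS (filterI Xin NU') => s [h1 h2]; apply: h2; exact: subset_closure.
move: t1 t10 => t t0; apply/eqP; rewrite -subr_eq0; apply/eqP.
apply: (@cvg_unique _ (@Rhausdorff R) ((u (X s t) - u (X s 0)) @[s --> (0 : R)^'+])).
  by apply: cvgB; exact: lim.
apply/cvgrPdist_le => e e0.
(* Each coordinate of the path of relative radius [s] has derivative at most [6 * M], and on it each
   partial derivative of [u] is at most [d]; over the angles from 0 to [t] this gives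
   [12 * M * d * t]. *)
pose D := 12 * M * t + 1.
have D0 : 0 < D by rewrite ltr_wpDl// !mulr_ge0.
pose d := e / D; have dd : 0 < d by rewrite divr_gt0.
have [eta1 [eta10 H1]] := csupp_unif_cont V1c V1L dd.
have [eta2 [eta20 H2]] := csupp_unif_cont V2c V2L dd.
pose eta := Num.min eta1 eta2.
have eta0 : 0 < eta by rewrite lt_min eta10 eta20.
(* For [s < s1] the path is at distance at most [2 * M * s < eta] from the boundary curve, where the
   gradient vanishes. *)
pose s1 := eta / (2 * M + 1).
have M1 : 0 < 2 * M + 1 by rewrite ltr_wpDl// mulr_ge0.
have s10 : 0 < s1 by rewrite divr_gt0.
have N1 : \forall s \near (0 : R)^'+, s < Num.min 1 s1 by apply: nbhs_right_lt; rewrite lt_min ltr01.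
have N0 : \forall s \near (0 : R)^'+, 0 < s by exact: nbhs_right_gt.
apply: filterS (filterI N0 N1) => s [s0]; rewrite lt_min => /andP[sl1 ss1].
rewrite sub0r normrN.
have ff (tau : R) : `|f1 tau - f0 tau| <= 2 * M.
  by apply: le_trans (ler_normB _ _) _; rewrite mulr2n mulrDl mul1r lerD.
have ff' (tau : R) : `|f1' tau - f0' tau| <= 2 * M.
  by apply: le_trans (ler_normB _ _) _; rewrite mulr2n mulrDl mul1r lerD.
have small (tau : R) : `|V1 (X s tau)| <= d /\ `|V2 (X s tau)| <= d.
  have [c1 sn1] := cos_sin_le1 tau.
  have sf : `|s * (f1 tau - f0 tau)| < eta.
    rewrite normrM gtr0_norm//; apply: (@le_lt_trans _ _ (s * (2 * M))).
      by apply: ler_wpM2l; [exact: ltW|exact: ff].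
    apply: (@lt_trans _ _ (s * (2 * M + 1))); first by rewrite ltr_pM2l// ltrDl.
    by rewrite -ltr_pdivlMr.
  have bx : box (opol (f0 tau) tau) eta (X s tau).
    have E (k : R) : 0 + (f0 tau + s * (f1 tau - f0 tau)) * k - (0 + f0 tau * k) =
        s * (f1 tau - f0 tau) * k by ring.
    split; rewrite /X /pol /= E normrM.
      by apply: le_lt_trans sf; apply: ler_piMr.
    by apply: le_lt_trans sf; apply: ler_piMr.
  have [z1 z2] := V0 tau.
  have [l1 l2] : eta <= eta1 /\ eta <= eta2 by rewrite /eta !ge_min !lexx orbT.
  case: bx => bx1 bx2; split; apply: ltW.
    rewrite -[V1 _]subr0 -z1; apply: H1.
    by split; [exact: lt_le_trans bx1 l1|exact: lt_le_trans bx2 l1].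
  rewrite -[V2 _]subr0 -z2; apply: H2.
  by split; [exact: lt_le_trans bx1 l2|exact: lt_le_trans bx2 l2].
pose r (tau : R) := f0 tau + s * (f1 tau - f0 tau).
pose r' (tau : R) := f0' tau + s * (f1' tau - f0' tau).
have rd (tau : R) : is_derive tau (1 : R) r (r' tau).
  exact: (derD (d0 tau) (derZ s (derD (d1 tau) (derN (d0 tau))))).
have bnd (a b : R) : `|a| <= M -> `|b| <= 2 * M -> `|a + s * b| <= 3 * M.
  move=> h1 h2; apply: le_trans (ler_normD _ _) _.
  rewrite normrM (gtr0_norm s0).
  have : s * `|b| <= 2 * M by apply: le_trans h2; apply: ler_piMl => //; exact: ltW.
  by move: h1; lra.
have rM (tau : R) : `|r tau| <= 3 * M by exact: bnd.
have r'M (tau : R) : `|r' tau| <= 3 * M by exact: bnd.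
have c1d (tau : R) : is_derive tau (1 : R) (fun tau => 0 + r tau * cos tau)
    (r' tau * cos tau + r tau * - sin tau).
  by apply: (is_derive_eq (derD (derC tau 1 0) (derM (rd tau) (is_derive_cos tau)))); rewrite add0r.
have c2d (tau : R) : is_derive tau (1 : R) (fun tau => 0 + r tau * sin tau)
    (r' tau * sin tau + r tau * cos tau).
  by apply: (is_derive_eq (derD (derC tau 1 0) (derM (rd tau) (is_derive_sin tau)))); rewrite add0r.
have ud (tau : R) : is_derive tau (1 : R) (fun tau => u (X s tau))
   ((r' tau * cos tau + r tau * - sin tau) * u1 (X s tau) +
    (r' tau * sin tau + r tau * cos tau) * u2 (X s tau)).
  by apply: (grad_chain oA ug _ (c1d tau) (c2d tau)); apply: inA; rewrite s0.
have [c _ ->] := mvt_abs (a := 0) (b := t) (fun tau _ => ud tau).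
rewrite subr0 normrM (ger0_norm t0).
have [cc sn1] := cos_sin_le1 c.
have AX : A (X s c) by apply: inA; rewrite s0.
have [v1 v2] := small c; have [e1 e2] := Vu _ AX; rewrite e1 in v1; rewrite e2 in v2.
have six (a b p q : R) : `|a| <= 3 * M -> `|b| <= 3 * M -> `|p| <= 1 -> `|q| <= 1 ->
    `|a * p + b * q| <= 6 * M.
  move=> h1 h2 h3 h4; apply: le_trans (ler_normD _ _) _; rewrite !normrM.
  have k1 : `|a| * `|p| <= 3 * M by apply: le_trans h1; apply: ler_piMr.
  have k2 : `|b| * `|q| <= 3 * M by apply: le_trans h2; apply: ler_piMr.
  by move: k1 k2; lra.
have k1 : `|r' c * cos c + r c * - sin c| <= 6 * M by apply: six => //; rewrite normrN.
have k2 : `|r' c * sin c + r c * cos c| <= 6 * M by apply: six.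
apply: (@le_trans _ _ (12 * M * d * t)).
  apply: ler_wpM2r => //; apply: le_trans (ler_normD _ _) _; rewrite !normrM.
  have := ler_pM (normr_ge0 _) (normr_ge0 _) k1 v1.
  have := ler_pM (normr_ge0 _) (normr_ge0 _) k2 v2.
  by rewrite -!mulrA; move: (M * d) => w; lra.
have <- : D * d = e by rewrite /d mulrC divfK// gt_eqF.
by rewrite (mulrAC _ d t) [in leRHS]/D [leRHS]mulrDl mul1r lerDl ltW.
Qed.

End BoundaryValues.

(** * The flow *)

Section Glue.
Variable R : realType.
Notation P2 := (R * R)%type.
Notation e1 := (e1 R).
Notation e2 := (e2 R).
Notation per f := (forall t : R, f (t + 2 * pi) = f t).
Notation lam2 := (@lebesgue_measure R \x @lebesgue_measure R)%E.

Variables g G : R -> R.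
Hypotheses (gc : continuous g) (Gc : continuous G) (gp : per g) (Gp : per G).
Hypotheses (g0 : forall t, 0 < g t) (gG : forall t, g t < G t).

Notation annulus := (annulus g G).
Notation hole := (hole g).
Notation exterior := (exterior G).

Definition glue (c : R) (f : P2 -> R) (x : P2) : R :=
  if `[< annulus x >] then f x else if `[< hole x >] then c else 0.

Lemma glue_annulus c f x : annulus x -> glue c f x = f x.
Proof. by move=> rx; rewrite /glue asboolT. Qed.

Lemma glue_hole c f x : hole x -> glue c f x = c.
Proof. by move=> hx; rewrite /glue asboolF ?asboolT// => /(annulus_hole gp Gp g0). Qed.

Lemma glue_exterior c f x : exterior x -> glue c f x = 0.
Proof.
move=> ex; rewrite /glue !asboolF// => [h|h]; first exact: (hole_exterior gp Gp g0 gG h ex).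
exact: (annulus_exterior gp Gp g0 gG h ex).
Qed.

(** With [P] the graph of a sum or a product, this shows that sums and products of glued functions
    are themselves glued, with the matching constant in the hole. *)
Lemma glue_ind (P : R -> R -> R -> Prop) c d k f1 f2 f3 x : P 0 0 0 -> P c d k ->
  (annulus x -> P (f1 x) (f2 x) (f3 x)) -> P (glue c f1 x) (glue d f2 x) (glue k f3 x).
Proof.
move=> p0 pc pr; have [h|h|h] := annulus_cases gp Gp g0 gG x.
- by rewrite !glue_annulus//; exact: pr.
- by rewrite !glue_hole.
- by rewrite !glue_exterior.
Qed.

Lemma glue_continuous c f : (forall x, annulus x -> {for x, continuous f}) ->
  (forall z, curve g z -> f y @[y --> within annulus (nbhs z)] --> c) ->
  (forall z, curve G z -> f y @[y --> within annulus (nbhs z)] --> 0) -> continuous (glue c f).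
Proof.
move=> fr fg fG x; have [[h|h]|nc] := pselect ((curve g `|` curve G) x).
- have hx := curve_hole gp g0 h; rewrite /continuous_at glue_hole// => U Uc.
  have NU : \forall y \near x, annulus y -> U (f y) by exact: (fg x h U Uc).
  have Ne := nbhs_not_exterior Gc gp Gp g0 gG hx.
  apply: filterS (filterI NU Ne) => y [h1 h2] /=; have [r|r|r] := annulus_cases gp Gp g0 gG y => //.
    by rewrite glue_annulus//; exact: h1.
  by rewrite glue_hole//; exact: nbhs_singleton.
- have hx := curve_exterior Gp g0 gG h; rewrite /continuous_at glue_exterior// => U Uc.
  have NU : \forall y \near x, annulus y -> U (f y) by exact: (fG x h U Uc).
  have Ne := nbhs_not_hole gc gp Gp g0 gG hx.
  apply: filterS (filterI NU Ne) => y [h1 h2] /=; have [r|r|r] := annulus_cases gp Gp g0 gG y => //.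
    by rewrite glue_annulus//; exact: h1.
  by rewrite glue_exterior//; exact: nbhs_singleton.
- have [h|h|h] := off_curves gc Gc gp Gp g0 gG nc.
  + have N : \forall y \near x, f y = glue c f y.
      have No := open_nbhs_nbhs (conj (open_annulus gc Gc gp Gp g0 gG) h).
      by apply: filterS No => y r; rewrite glue_annulus.
    exact: (for_continuous_near N (fr x h)).
  + have N : \forall y \near x, c = glue c f y by apply: filterS h => y r; rewrite glue_hole.
    by apply: (for_continuous_near N); exact: cvg_cst.
  + have N : \forall y \near x, 0 = glue c f y by apply: filterS h => y r; rewrite glue_exterior.
    by apply: (for_continuous_near N); exact: cvg_cst.
Qed.

Lemma glue_derive c f f' e x : ~ (curve g `|` curve G) x ->
  (forall x, annulus x -> is_derive x e f (f' x)) -> (forall x, annulus x -> {for x, continuous f'}) ->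
  is_derive x e (glue c f) (glue 0 f' x) /\ {for x, continuous (glue 0 f')}.
Proof.
move=> nc fd f'c; have [h|h|h] := off_curves gc Gc gp Gp g0 gG nc.
- have No := open_nbhs_nbhs (conj (open_annulus gc Gc gp Gp g0 gG) h).
  have N d k : \forall y \near x, k y = glue d k y by apply: filterS No => y r; rewrite glue_annulus.
  split; last exact: (for_continuous_near (N 0 f') (f'c x h)).
  rewrite glue_annulus//; apply: (near_eq_is_derive _ (fd x h)).
  by apply: filterS (N c f) => y ->.
- have N d k : \forall y \near x, d = glue d k y by apply: filterS h => y r; rewrite glue_hole.
  split; last by apply: (for_continuous_near (N 0 f')); exact: cvg_cst.
  rewrite -(nbhs_singleton (N 0 f')); apply: (near_eq_is_derive _ (derC x e c)).
  by apply: filterS (N c f) => y <-.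
- have N d k : \forall y \near x, 0 = glue d k y by apply: filterS h => y r; rewrite glue_exterior.
  split; last by apply: (for_continuous_near (N 0 f')); exact: cvg_cst.
  rewrite -(nbhs_singleton (N 0 f')); apply: (near_eq_is_derive _ (derC x e 0)).
  by apply: filterS (N c f) => y <-.
Qed.

Lemma glue_csupp : exists2 L, 0 <= L & curve g `<=` csq (0, 0) L /\ forall c f, csupp L (glue c f).
Proof.
have [L L0 HL] := annulus_bounded Gc Gp gG; exists L => //; split.
  by move=> x /(curve_hole gp g0) h; apply: HL; right.
move=> c f x nx; have [h|h|h] := annulus_cases gp Gp g0 gG x.
- by case: nx; apply: HL; left.
- by case: nx; apply: HL; right.
- by rewrite glue_exterior.
Qed.

(** One statement for incompressibility, where both constants are 0, and for the two rows of the
    momentum equation, where the pressure in the hole appears in one entry. *)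
Lemma glue_divergence (K c1 c2 : R) (f1 f2 f11 f22 phi phi1 phi2 : P2 -> R) :
  (forall s t : R, 0 <= s <= 2 * pi -> 0 <= t <= 2 * pi -> `|g s - g t| <= K * `|s - t|) ->
  (forall s t : R, 0 <= s <= 2 * pi -> 0 <= t <= 2 * pi -> `|G s - G t| <= K * `|s - t|) ->
  continuous (glue c1 f1) -> continuous (glue c2 f2) ->
  (forall x, annulus x -> is_derive x e1 f1 (f11 x)) -> (forall x, annulus x -> is_derive x e2 f2 (f22 x)) ->
  (forall x, annulus x -> {for x, continuous f11}) -> (forall x, annulus x -> {for x, continuous f22}) ->
  (forall x, annulus x -> f11 x + f22 x = 0) -> has_grad setT phi phi1 phi2 ->
  (\int[lam2]_x (glue c1 f1 x * phi1 x + glue c2 f2 x * phi2 x)%:E = 0)%E.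
Proof.
move=> gK GK F1c F2c d1 d2 k1 k2 z pg.
have [L L0 [gL cs]] := glue_csupp.
have G0 t : 0 < G t := lt_trans (g0 t) (gG t).
have [sep sep0 sepP] : exists2 d : R, 0 < d & forall p x, curve g p -> csq p d x -> ~ curve G x.
  apply: compact_separation; [exact: compact_curve|exact: compact_curve|].
  by move=> x /(curve_hole gp g0) h /(curve_exterior Gp g0 gG); exact: (hole_exterior gp Gp g0 gG h).
have tg := thin_curve gc gp g0 gK; have tG := thin_curve Gc Gp G0 GK.
apply: (@divergence_two R (curve g) (curve G) (glue c1 f1) (glue c2 f2) (glue 0 f11) (glue 0 f22)
  L c1 c2 sep phi phi1 phi2) => //.
- move=> x nc; have [a1 b1] := glue_derive c1 nc d1 k1; have [a2 b2] := glue_derive c2 nc d2 k2.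
  split => //; apply: (@glue_ind (fun a b _ => a + b = 0) 0 0 0 f11 f22 f22 x); rewrite ?addr0//.
  exact: z.
- by move=> x /(curve_hole gp g0) h; rewrite !glue_hole.
- by move=> x /(curve_exterior Gp g0 gG) h; rewrite !glue_exterior.
- exact: thinU.
Qed.

End Glue.

(** * Velocity, pressure and the weak Euler equations *)

Section Euler.
Variable R : realType.
Notation P2 := (R * R)%type.
Notation e1 := (e1 R).
Notation e2 := (e2 R).
Notation per f := (forall t : R, f (t + 2 * pi) = f t).
Notation lam2 := (@lebesgue_measure R \x @lebesgue_measure R)%E.

Lemma grad_cst (A : set P2) (k : R) : has_grad A (fun=> k) (fun=> 0) (fun=> 0).
Proof. by move=> x _; split; [exact: derC|exact: derC|exact: cvg_cst|exact: cvg_cst]. Qed.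

Lemma test_fun_grad (phi : P2 -> R) : test_fun phi -> has_grad setT phi ('D_e1 phi) ('D_e2 phi).
Proof.
move=> [sm _] x _; have [_ d0] := sm 1%N [::] isT; have d := d0 isT x.
have [c1 _] := sm 1%N [:: e1] isT; have [c2 _] := sm 1%N [:: e2] isT.
split; [exact: derivableP (d e1 I)|exact: derivableP (d e2 I)|exact: (c1 x I)|exact: (c2 x I)].
Qed.

Variables (g G : R -> R) (K : R).
Hypotheses (gc : continuous g) (Gc : continuous G) (gp : per g) (Gp : per G).
Hypotheses (g0 : forall t, 0 < g t) (gG : forall t, g t < G t).
Hypothesis gK : forall s t : R, 0 <= s <= 2 * pi -> 0 <= t <= 2 * pi -> `|g s - g t| <= K * `|s - t|.
Hypothesis GK : forall s t : R, 0 <= s <= 2 * pi -> 0 <= t <= 2 * pi -> `|G s - G t| <= K * `|s - t|.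

Notation annulus := (annulus g G).
Notation glue := (glue g G).

Variables (mu : R) (u : P2 -> R).
Hypothesis su : sol annulus mu u.

Notation a := ('D_e1 u).
Notation b := ('D_e2 u).
Definition minus_d1 (x : P2) : R := -1 * 'D_e1 u x.
(** With [u] as stream function the vorticity is minus its Laplacian, that is mu times [u]. Hence
    the convective term is the gradient of half of |grad u|^2 + mu u^2, and the pressure is its
    opposite, normalised to vanish where the gradient is 0 and [u] equals [c]. *)
Definition pressure (c : R) (x : P2) : R :=
  - 2^-1 * ('D_e1 u x * 'D_e1 u x + 'D_e2 u x * 'D_e2 u x) + - (mu / 2) * (u x * u x + - c ^+ 2).

Let oA : open annulus. Proof. exact: open_annulus. Qed.

Variables ci co : R.
Hypothesis lima : forall z, (curve g `|` curve G) z -> a y @[y --> within annulus (nbhs z)] --> 0.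
Hypothesis limb : forall z, (curve g `|` curve G) z -> b y @[y --> within annulus (nbhs z)] --> 0.
Hypothesis limi : forall z, curve g z -> u y @[y --> within annulus (nbhs z)] --> ci.
Hypothesis limo : forall z, curve G z -> u y @[y --> within annulus (nbhs z)] --> co.

(** The limit of the pressure at the inner curve, where the gradient vanishes and [u] tends to
    [ci]. *)
Let pin := - (mu / 2) * (ci ^+ 2 - co ^+ 2).

Let ug : has_grad annulus u a b. Proof. case: su => -[h _ _] _; exact: C1_grad h. Qed.
Let ag : has_grad annulus a ('D_e1 a) ('D_e2 a). Proof. case: su => -[_ h _] _; exact: C1_grad h. Qed.
Let bg : has_grad annulus b ('D_e1 b) ('D_e2 b). Proof. case: su => -[_ _ h] _; exact: C1_grad h. Qed.

Let na_grad := gradM oA (grad_cst (A := annulus) (-1)) ag.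
Let p_grad := gradD (gradM oA (grad_cst (A := annulus) (- 2^-1)) (gradD (gradM oA ag ag) (gradM oA bg bg)))
  (gradM oA (grad_cst (A := annulus) (- (mu / 2))) (gradD (gradM oA ug ug) (grad_cst (A := annulus) (- co ^+ 2)))).

Lemma velocity_continuous : continuous (glue 0 b) /\ continuous (glue 0 minus_d1).
Proof.
split; apply: glue_continuous => //.
- by move=> x Ax; exact: (grad_cont oA bg Ax).
- by move=> z h; apply: limb; left.
- by move=> z h; apply: limb; right.
- by move=> x Ax; exact: (grad_cont oA na_grad Ax).
- by move=> z h; rewrite -[0](mulr0 (-1)); apply: cvgM; [exact: cvg_cst|apply: lima; left].
- by move=> z h; rewrite -[0](mulr0 (-1)); apply: cvgM; [exact: cvg_cst|apply: lima; right].
Qed.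

Lemma pressure_continuous : continuous (glue pin (pressure co)).
Proof.
have lim (z : P2) (c : R) : (curve g `|` curve G) z -> u y @[y --> within annulus (nbhs z)] --> c ->
    pressure co y @[y --> within annulus (nbhs z)] --> - (mu / 2) * (c ^+ 2 - co ^+ 2).
  move=> hz hc; have la := lima hz; have lb := limb hz.
  have -> : - (mu / 2) * (c ^+ 2 - co ^+ 2) =
      - 2^-1 * (0 * 0 + 0 * 0) + - (mu / 2) * (c * c + - co ^+ 2).
    by rewrite !mulr0 addr0 mulr0 add0r expr2.
  apply: cvgD; apply: cvgM; [exact: cvg_cst| |exact: cvg_cst|].
    exact: (cvgD (cvgM la la) (cvgM lb lb)).
  by apply: cvgD; [exact: (cvgM hc hc)|exact: cvg_cst].
apply: glue_continuous => //.
- by move=> x Ax; exact: (grad_cont oA p_grad Ax).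
- by move=> z h; apply: lim; [left|exact: limi].
- move=> z h; have := lim z co (or_intror h) (limo h).
  by rewrite subrr mulr0.
Qed.

Let v1 := glue 0 b.
Let v2 := glue 0 minus_d1.
Let p := glue pin (pressure co).

(* The rows of [v (x) v + p I] are divergence free. *)
Lemma momentum_row (phi phi1 phi2 : P2 -> R) : has_grad setT phi phi1 phi2 ->
  (\int[lam2]_x ((v1 x * v1 x + p x) * phi1 x + (v1 x * v2 x) * phi2 x)%:E = 0 /\
   \int[lam2]_x ((v1 x * v2 x) * phi1 x + (v2 x * v2 x + p x) * phi2 x)%:E = 0)%E.
Proof.
move=> pg; have [v1c v2c] := velocity_continuous; have pc := pressure_continuous.
(* In the hole the momentum flux is [pin] times the identity matrix, which dictates the gluing
   constant of each entry. *)
have E11 x : v1 x * v1 x + p x = glue pin (fun x => b x * b x + pressure co x) x.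
  by apply: (@glue_ind R g G gp Gp g0 gG (fun r s t => r * r + s = t)); rewrite ?mul0r ?add0r.
have E22 x : v2 x * v2 x + p x = glue pin (fun x => minus_d1 x * minus_d1 x + pressure co x) x.
  by apply: (@glue_ind R g G gp Gp g0 gG (fun r s t => r * r + s = t)); rewrite ?mul0r ?add0r.
have E12 x : v1 x * v2 x = glue 0 (fun x => b x * minus_d1 x) x.
  by apply: (@glue_ind R g G gp Gp g0 gG (fun r s t => r * s = t)); rewrite ?mul0r.
have c11 : continuous (glue pin (fun x => b x * b x + pressure co x)).
  by rewrite -(funext E11); apply: continuousD2 => //; exact: continuousM2.
have c22 : continuous (glue pin (fun x => minus_d1 x * minus_d1 x + pressure co x)).
  by rewrite -(funext E22); apply: continuousD2 => //; exact: continuousM2.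
have c12 : continuous (glue 0 (fun x => b x * minus_d1 x)).
  by rewrite -(funext E12); exact: continuousM2.
have G11 := gradD (gradM oA bg bg) p_grad.
have G22 := gradD (gradM oA na_grad na_grad) p_grad.
have G12 := gradM oA bg na_grad.
have C x : annulus x -> 'D_e1 b x = 'D_e2 a x by move=> Ax; exact: (clairaut oA su.1 Ax).
(* Together with the equality of the mixed derivatives, this leaves polynomial identities in the
   remaining derivatives. *)
have H x : annulus x -> 'D_e2 b x = - ('D_e1 a x + mu * u x).
  case: su => _ /(_ x) h /h; rewrite addrAC => e.
  by apply/eqP; rewrite -subr_eq0 opprK addrC e.
split.
- under eq_integral do rewrite E11 E12.
  apply: (glue_divergence gc Gc gp Gp g0 gG gK GK c11 c12 _ _ _ _ _ pg).
  + by move=> x /G11[d _ _ _]; exact: d.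
  + by move=> x /G12[_ d _ _]; exact: d.
  + by move=> x /G11[_ _ d _]; exact: d.
  + by move=> x /G12[_ _ _ d]; exact: d.
  + move=> x Ax; cbv beta; rewrite (C x Ax) (H x Ax).
    by move: ('D_e1 a x) ('D_e2 a x) (a x) (b x) (u x) => *; field.
- under eq_integral do rewrite E22 E12.
  apply: (glue_divergence gc Gc gp Gp g0 gG gK GK c12 c22 _ _ _ _ _ pg).
  + by move=> x /G12[d _ _ _]; exact: d.
  + by move=> x /G22[_ d _ _]; exact: d.
  + by move=> x /G12[_ _ d _]; exact: d.
  + by move=> x /G22[_ _ _ d]; exact: d.
  + move=> x Ax; cbv beta; rewrite (C x Ax) (H x Ax).
    by move: ('D_e1 a x) ('D_e2 a x) (a x) (b x) (u x) => *; field.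
Qed.

Lemma euler_flow : stationary_weak_euler v1 v2 p.
Proof.
have [v1c v2c] := velocity_continuous; have pc := pressure_continuous.
have [L L0 [_ cs]] := glue_csupp Gc gp Gp g0 gG.
split.
- exact: (csupp_L2loc L0 v1c (cs _ _)).
- exact: (csupp_L2loc L0 v2c (cs _ _)).
- exact: (csupp_L1loc L0 pc (cs _ _)).
- move=> phi /test_fun_grad pg.
  apply: (glue_divergence gc Gc gp Gp g0 gG gK GK v1c v2c _ _ _ _ _ pg).
  + by move=> x /bg[d _ _ _]; exact: d.
  + by move=> x /na_grad[_ d _ _]; exact: d.
  + by move=> x /bg[_ _ d _]; exact: d.
  + by move=> x /na_grad[_ _ _ d]; exact: d.
  + move=> x Ax; cbv beta; rewrite (clairaut oA su.1 Ax).
    by rewrite mul0r add0r mulN1r subrr.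
- move=> w1 w2 /test_fun_grad g1 /test_fun_grad g2.
  (* The first row is tested with [w1] and the second with [w2]; their sum is the weak momentum
     equation. *)
  have [I1 _] := momentum_row g1; have [_ I2] := momentum_row g2.
  have [w1c w11c w12c] := gradT_continuous g1; have [w2c w21c w22c] := gradT_continuous g2.
  have q11 := continuousD2 (continuousM2 v1c v1c) pc; have q12 := continuousM2 v1c v2c.
  have q22 := continuousD2 (continuousM2 v2c v2c) pc.
  have S := csupp_int_split L0
    (f := fun x => (v1 x * v1 x + p x) * 'D_e1 w1 x + (v1 x * v2 x) * 'D_e2 w1 x)
    (g := fun x => (v1 x * v2 x) * 'D_e1 w2 x + (v2 x * v2 x + p x) * 'D_e2 w2 x).
  rewrite I1 I2 adde0 in S; rewrite /leb2 -S.
  + apply: eq_integral => x _; congr (_%:E).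
    move: (v1 x) (v2 x) (p x) ('D_e1 w1 x) ('D_e2 w1 x) ('D_e1 w2 x) ('D_e2 w2 x) => *; ring.
  + exact: (continuousD2 (continuousM2 q11 w11c) (continuousM2 q12 w12c)).
  + exact: (continuousD2 (continuousM2 q12 w21c) (continuousM2 q22 w22c)).
  + by move=> x h; rewrite /v1 /p !(cs _ _ x h) mul0r !add0r !mul0r addr0.
  + by move=> x h; rewrite /v1 /v2 /p !(cs _ _ x h) mul0r !add0r !mul0r addr0.
Qed.

End Euler.

(** * Unique continuation and connectedness of the annulus *)

Section UniqueContinuation.
Variable R : realType.
Notation P2 := (R * R)%type.
Notation e1 := (e1 R).
Notation e2 := (e2 R).
Notation per f := (forall t : R, f (t + 2 * pi) = f t).
Notation opol := (@pol R (0, 0)).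

Lemma derive_near0 (f : P2 -> R) x v : (\forall y \near x, f y = 0) -> 'D_v f x = 0.
Proof.
move=> f0; have d : is_derive x v f 0.
  by apply: (near_eq_is_derive _ (derC x v 0)); apply: filterS f0 => y ->.
exact: (@derive_val _ _ _ _ _ _ _ d).
Qed.

Lemma Dw_near0 w (f : P2 -> R) x : (\forall y \near x, f y = 0) -> Dw w f x = 0.
Proof.
move=> f0; suff : \forall y \near x, Dw w f y = 0 by exact: nbhs_singleton.
elim: w => [//|b w IH]; rewrite Dw_cons.
by apply: filterS (nbhs_interior IH) => y; exact: derive_near0.
Qed.

Lemma gevrey_Dw w B (f : P2 -> R) : gevrey B f -> gevrey B (Dw w f).
Proof.
move=> fg; elim: w => [//|b w IH]; rewrite Dw_cons.
by have [h1 h2] := gevrey_derive IH; case: b; [exact: h1|exact: h2].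
Qed.

Lemma gevrey_grad B (f : P2 -> R) : gevrey B f -> has_grad B f ('D_e1 f) ('D_e2 f).
Proof. by move=> [M [K [_ _ /(_ 1%N) [_ [h _ _]]]]]; exact: C1_grad h. Qed.

Section Solution.
Variables (A : set P2) (mu : R) (u : P2 -> R).
Hypotheses (oA : open A) (su : sol A mu u).

Lemma sol_gevrey_sub k x : A x -> exists r : R, [/\ 0 < r, box x r `<=` A &
  gevrey (box x r) (fun y => u y + - k)].
Proof.
move=> Ax; have [r [r0 rA ug]] := sol_gevrey oA su Ax; exists r; split => //.
have oB := @box_open R x r.
exact: (gevreyD oB ug (gevrey_cst (- k) oB)).
Qed.

Lemma box_self x (r : R) : 0 < r -> box x r x.
Proof. by move=> r0; split; rewrite subrr normr0. Qed.

Lemma near_of_box x (r : R) (P : P2 -> Prop) : 0 < r -> (forall y, box x r y -> P y) -> \forall y \near x, P y.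
Proof.
move=> r0 H; have N := open_nbhs_nbhs (conj (@box_open R x r) (box_self x r0)).
exact: filterS N.
Qed.

(** All derivatives of [u - u x], order 0 included, vanish at [x]; by the factorial bounds the
    function then vanishes near [x]. *)
Lemma grad0_locally_const x : A x -> (\forall y \near x, 'D_e1 u y = 0 /\ 'D_e2 u y = 0) ->
  \forall y \near x, u y = u x.
Proof.
move=> Ax N; have [r [r0 rA fg]] := sol_gevrey_sub (u x) Ax.
have [[uC _ _] _] := su; have ug := C1_grad uC.
have D y : A y -> 'D_e1 (fun y => u y + - u x) y = 'D_e1 u y /\
    'D_e2 (fun y => u y + - u x) y = 'D_e2 u y.
  move=> Ay; have [d1 d2 _ _] := ug y Ay.
  have D1 := derD d1 (derC y e1 (- u x)); have D2 := derD d2 (derC y e2 (- u x)).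
  by rewrite (@derive_val _ _ _ _ _ _ _ D1) (@derive_val _ _ _ _ _ _ _ D2) !addr0.
have NA := open_nbhs_nbhs (conj oA Ax).
have [|s [s0 sB]] := gevrey_flat r0 fg.
  elim/last_ind => [|w b _]; first by rewrite /Dw /= subrr.
  rewrite Dw_rcons; apply: Dw_near0.
  apply: filterS (filterI N NA) => y [[h1 h2] Ay]; have [E1 E2] := D y Ay.
  by case: b; rewrite /dir ?E1 ?E2.
apply: (near_of_box s0) => y /sB /eqP; rewrite subr_eq0 => /eqP; exact.
Qed.

(** At points near which [u] equals [k] all derivatives of [u - k] vanish, hence by continuity also
    at a limit of such points inside the domain, and there the Taylor expansion is zero. *)
Lemma locally_const_closed k x : A x ->
  closure [set y | \forall z \near y, u z = k] x -> \forall z \near x, u z = k.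
Proof.
move=> Ax cx; have [r [r0 rA fg]] := sol_gevrey_sub k Ax.
have [|s [s0 sB]] := gevrey_flat r0 fg; last first.
  by apply: (near_of_box s0) => y /sB /eqP; rewrite subr_eq0 => /eqP; exact.
move=> w; apply: contrapT => /eqP nz.
have wc := grad_cont (@box_open R x r) (gevrey_grad (gevrey_Dw w fg)) (box_self x r0).
have N0 : nbhs (Dw w (fun y => u y + - k) x) [set z : R | z != 0].
  by apply: open_nbhs_nbhs; split; [exact: open_neq|exact: nz].
have N : \forall y \near x, Dw w (fun y => u y + - k) y != 0 by exact: (wc _ N0).
have [y [hy ny]] := cx _ N; move/eqP: ny; apply; apply: Dw_near0.
by apply: filterS hy => z ->; rewrite subrr.
Qed.

End Solution.

Section Connected.
Variables g G : R -> R.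
Hypotheses (gc : continuous g) (Gc : continuous G) (gp : per g) (Gp : per G).
Hypotheses (g0 : forall t, 0 < g t) (gG : forall t, g t < G t).

Notation annulus := (annulus g G).

(** [W] is open and, within [A], closed, so its trace on the connected image of the parameter
    interval is empty or everything. *)
Lemma path_connected_open (A W : set P2) (c : R -> P2) (s t : R) : continuous c -> open W ->
  (forall x, A x -> closure W x -> W x) -> (forall tau, A (c tau) \/ ~ (Num.min s t <= tau <= Num.max s t)) ->
  W (c s) -> W (c t).
Proof.
move=> cc oW cW cA Ws; pose I := `[Num.min s t, Num.max s t]%classic.
have Is : I s by rewrite /I /= in_itv /= ge_min le_max lexx.
have It : I t by rewrite /I /= in_itv /= ge_min le_max lexx !orbT.
have IA x : (c @` I) x -> A x.
  by move=> [tau]; rewrite /I /= in_itv /= => h <-; have [//|] := cA tau.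
have cn : connected (c @` I).
  by apply: connected_continuous_connected; [exact: segment_connected|exact: continuous_subspaceT].
have E : (c @` I) `&` W = c @` I.
  apply: cn; first by exists (c s); split => //; exists s.
    by exists W.
  exists (closure W); first exact: closed_closure.
  apply/seteqP; split => x [h1 h2]; split => //; first exact: subset_closure.
  by apply: cW => //; exact: IA.
have : (c @` I) (c t) by exists t.
by rewrite -E => -[].
Qed.

Lemma annulus_connected (W : set P2) x y : open W -> (forall x, annulus x -> closure W x -> W x) ->
  annulus x -> annulus y -> W x -> W y.
Proof.
move=> oW cW; have [r [t [r0 _ ->]]] := pol_surj x; have [r' [t' [r'0 _ ->]]] := pol_surj y.
move=> /(ringE gp Gp g0 _ r0) rt /(ringE gp Gp g0 _ r'0) rt'.
pose X s tau : P2 := opol (g tau + s * (G tau - g tau)) tau.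
have d0 tau : 0 < G tau - g tau by rewrite subr_gt0.
have co (q tau : R) : g tau < q < G tau ->
    0 < (q - g tau) / (G tau - g tau) < 1 /\ opol q tau = X ((q - g tau) / (G tau - g tau)) tau.
  move=> /andP[h1 h2]; split; first by rewrite divr_gt0 ?subr_gt0//= ltr_pdivrMr// mul1r ltrD2r.
  by rewrite /X divfK ?gt_eqF// addrC subrK.
have [s01 ->] := co _ _ rt; have [s'01 ->] := co _ _ rt'.
move: (_ / _) (_ / _) s01 s'01 => s' s /andP[s0 s1] /andP[s'0 s'1].
have Xr sg tau : 0 < sg < 1 -> annulus (X sg tau) by move=> h; apply: annulus_path => //; left.
have c1 : continuous (X s).
  move=> tau; apply: (@pol_continuous R R (fun _ : R => (0, 0)) (fun tau : R => g tau + s * (G tau - g tau)) (fun tau : R => tau)).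
  - exact: cvg_cst.
  - apply: cvgD; first exact: gc.
    by apply: cvgM; [exact: cvg_cst|apply: cvgB; [exact: Gc|exact: gc]].
  - exact: cvg_id.
have c2 : continuous (X ^~ t').
  move=> sg; apply: (@pol_continuous R R (fun _ : R => (0, 0)) (fun sg : R => g t' + sg * (G t' - g t')) (fun _ : R => t')).
  - exact: cvg_cst.
  - by apply: cvgD; [exact: cvg_cst|apply: cvgM; [exact: cvg_id|exact: cvg_cst]].
  - exact: cvg_cst.
move=> W0; have W1 : W (X s t').
  apply: (@path_connected_open annulus W (X s) t t' c1 oW cW _ W0) => tau; left; apply: Xr.
  by rewrite s0.
apply: (@path_connected_open annulus W (X ^~ t') s s' c2 oW cW _ W1) => sg.
have [h|h] := pselect (Num.min s s' <= sg <= Num.max s s'); last by right.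
left; apply: Xr; move: h => /andP[h1 h2]; apply/andP; split.
  by apply: lt_le_trans h1; rewrite lt_min s0.
by apply: le_lt_trans h2 _; rewrite gt_max s1.
Qed.

End Connected.
End UniqueContinuation.

(** * The flow attached to a solution of the overdetermined problem *)

Section Flow.
Variable R : realType.
Notation P2 := (R * R)%type.
Notation e1 := (e1 R).
Notation e2 := (e2 R).
Notation per f := (forall t : R, f (t + 2 * pi) = f t).
Notation opol := (@pol R (0, 0)).

Lemma per_derive (f f' : R -> R) : per f -> (forall t, is_derive t (1 : R) f (f' t)) -> per f'.
Proof.
move=> fp df t; have d1 : is_derive t (1 : R) (fun s => s + 2 * pi) 1.
  by apply: (is_derive_eq (derD (is_derive_id t 1) (derC t 1 (2 * pi)))); rewrite addr0.
have D := @is_derive1_comp R f (fun s => s + 2 * pi) t _ _ (df _) d1.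
rewrite (_ : f \o _ = f) ?mulr1 in D; last by apply/funext => s /=.
by rewrite -(@derive_val _ _ _ _ _ _ _ D) -(@derive_val _ _ _ _ _ _ _ (df t)).
Qed.

Lemma Ck2_C2 (A : set P2) (u : P2 -> R) : Ck_on 2 A u -> C2 A u.
Proof.
move=> h; have [_ d0] := h [::] isT.
have [c1 d1] := h [:: e1] isT; have [c2 d2] := h [:: e2] isT.
have [c11 _] := h [:: e1; e1] isT; have [c21 _] := h [:: e2; e1] isT.
have [c12 _] := h [:: e1; e2] isT; have [c22 _] := h [:: e2; e2] isT.
split=> x Ax; split.
- exact: (d0 isT x e1 Ax).
- exact: (d0 isT x e2 Ax).
- exact: (c1 x Ax).
- exact: (c2 x Ax).
- exact: (d1 isT x e1 Ax).
- exact: (d1 isT x e2 Ax).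
- exact: (c11 x Ax).
- exact: (c21 x Ax).
- exact: (d2 isT x e1 Ax).
- exact: (d2 isT x e2 Ax).
- exact: (c12 x Ax).
- exact: (c22 x Ax).
Qed.

Lemma csupp_compactly_supported L (f : P2 -> R) : csupp L f -> compactly_supported f.
Proof.
move=> fL; have cq := @compact_csq R (0, 0) L.
have cl : closed (@csq R (0, 0) L) by apply: compact_closed cq; exact: norm_hausdorff.
apply: (@subclosed_compact _ _ (csq (0, 0) L)); [exact: closed_closure|exact: cq|].
rewrite [X in _ `<=` X](closure_id _).1//; apply: closureS => x /eqP nz.
by apply: contrapT => /fL.
Qed.

Variables g G g' G' : R -> R.
Hypotheses (dg : forall t, is_derive t (1 : R) g (g' t)) (dG : forall t, is_derive t (1 : R) G (G' t)).
Hypotheses (g'c : continuous g') (G'c : continuous G') (gp : per g) (Gp : per G).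
Hypotheses (g0 : forall t, 0 < g t) (gG : forall t, g t < G t).

Notation annulus := (annulus g G).
Notation glue := (glue g G).

Let gc : continuous g. Proof. by move=> t; exact: derive_continuous_at (dg t). Qed.
Let Gc : continuous G. Proof. by move=> t; exact: derive_continuous_at (dG t). Qed.

Lemma radii_bounded : exists M, forall t, [/\ `|g t| <= M, `|G t| <= M, `|g' t| <= M & `|G' t| <= M].
Proof.
have [M1 p1 h1] := per_bounded gc gp; have [M2 p2 h2] := per_bounded Gc Gp.
have [M3 p3 h3] := per_bounded g'c (per_derive gp dg).
have [M4 p4 h4] := per_bounded G'c (per_derive Gp dG).
exists (M1 + M2 + (M3 + M4)) => t; split.
- by apply: le_trans (h1 t) _; rewrite -addrA lerDl !addr_ge0.
- by apply: le_trans (h2 t) _; rewrite addrAC lerDr !addr_ge0.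
- by apply: le_trans (h3 t) _; rewrite addrCA lerDl !addr_ge0.
- by apply: le_trans (h4 t) _; rewrite addrA lerDr !addr_ge0.
Qed.

Lemma lipschitz_of_derive (f f' : R -> R) (M : R) : (forall t, is_derive t (1 : R) f (f' t)) ->
  (forall t, `|f' t| <= M) -> forall s t : R, `|f s - f t| <= M * `|s - t|.
Proof.
move=> df fM s t; have [c _ ->] := mvt_abs (a := t) (b := s) (fun t _ => df t).
by rewrite normrM; apply: ler_wpM2r.
Qed.

Variables (mu : R) (u : P2 -> R).
Hypotheses (ou : overdetermined_sol annulus mu u) (nr : ~ radial_on annulus u).

Let oA : open annulus. Proof. exact: open_annulus. Qed.

Let su : sol annulus mu u.
Proof. by case: ou => h _ e _; split; [exact: Ck2_C2|exact: e]. Qed.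

Notation a := ('D_e1 u).
Notation b := ('D_e2 u).

Let ug : has_grad annulus u a b. Proof. case: su => -[h _ _] _; exact: C1_grad h. Qed.
Let ag : has_grad annulus a ('D_e1 a) ('D_e2 a). Proof. case: su => -[_ h _] _; exact: C1_grad h. Qed.

Let curve_out z : (curve g `|` curve G) z -> closure annulus z /\ ~ annulus z.
Proof.
move=> h; split; first exact: curve_closure.
move=> r; case: h => [/(curve_hole gp g0)|/(curve_exterior Gp g0 gG)].
  exact: annulus_hole r.
exact: annulus_exterior r.
Qed.

Let lima z : (curve g `|` curve G) z -> a y @[y --> within annulus (nbhs z)] --> 0.
Proof. move=> /curve_out[h1 h2]; case: ou => _ _ _ h; exact: (h z h1 h2).1. Qed.

Let limb z : (curve g `|` curve G) z -> b y @[y --> within annulus (nbhs z)] --> 0.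
Proof. move=> /curve_out[h1 h2]; case: ou => _ _ _ h; exact: (h z h1 h2).2. Qed.

Let ac : continuous (glue 0 a).
Proof.
apply: glue_continuous => //.
- by move=> x Ax; exact: (grad_cont oA ag Ax).
- by move=> z h; apply: lima; left.
- by move=> z h; apply: lima; right.
Qed.

Let bc : continuous (glue 0 b).
Proof. exact: (velocity_continuous gc Gc gp Gp g0 gG su lima limb).1. Qed.

Let u_within z : closure annulus z -> u y @[y --> within annulus (nbhs z)] --> u z.
Proof.
move=> cz; case: ou => _ /subspace_continuousP/(_ z cz) uc _ _.
move=> U NU0; have NU : \forall y \near z, closure annulus y -> U (u y) by exact: (uc U NU0).
have : \forall y \near z, annulus y -> U (u y) by apply: filterS NU => y h /subset_closure.
exact.
Qed.

Lemma boundary_value (f0 f1 f0' f1' : R -> R) : (f0 = g /\ f1 = G) \/ (f0 = G /\ f1 = g) ->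
  (forall t, is_derive t (1 : R) f0 (f0' t)) -> (forall t, is_derive t (1 : R) f1 (f1' t)) ->
  (exists M, forall t, [/\ `|f0 t| <= M, `|f1 t| <= M, `|f0' t| <= M & `|f1' t| <= M]) ->
  forall z, curve f0 z -> u y @[y --> within annulus (nbhs z)] --> u (opol (f0 0) 0).
Proof.
move=> fs d0 d1 [M fM] z cz.
have cz' : (curve g `|` curve G) z by case: fs cz => -[-> _]; [left|right].
suff -> : u (opol (f0 0) 0) = u z by apply: u_within; exact: (curve_out cz').1.
have [L L0 [_ cs]] := glue_csupp Gc gp Gp g0 gG.
(* A nonnegative representative of the angle is taken because [boundary_const] compares with the
   value at angle 0 and moves forward. *)
case: cz => r [t0 [r0 -> /eqP ->]]; have [t /andP[t0' _] H] := angle_reduce t0.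
have fp : per f0 by case: fs => -[-> _].
have -> : opol (f0 t0) t0 = opol (f0 t) t.
  by rewrite /pol (H _ _ (@cos_per R)) (H _ _ (@sin_per R)) (H _ _ fp).
have [_ uc _ _] := ou.
apply/esym; apply: (@boundary_const R annulus u a b (glue 0 a) (glue 0 b) f0 f1 f0' f1' M L) => //.
- by move=> x Ax; rewrite !glue_annulus.
- by move=> s; case: (fM s).
- by move=> s; case: (fM s).
- by move=> s; case: (fM s).
- by move=> s; case: (fM s).
- by move=> s tau s01; apply: annulus_path.
- move=> s; have cs' : (curve g `|` curve G) (opol (f0 s) s).
    have c0 : curve f0 (opol (f0 s) s).
      by exists (f0 s), s; split => //; case: fs => -[-> _]; rewrite ltW// (lt_trans (g0 s)).
    by case: fs c0 => -[-> _]; [left|right].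
  case: cs' => [/(curve_hole gp g0) h|/(curve_exterior Gp g0 gG) h]; first by rewrite !glue_hole.
  by rewrite !glue_exterior.
Qed.

Lemma velocity_support : supp2 (glue 0 b) (glue 0 (minus_d1 u)) = closure annulus.
Proof.
pose S : set P2 := [set x | (glue 0 b x, glue 0 (minus_d1 u) x) != 0].
apply/seteqP; split.
  apply: closureS => x /= nz.
  have [//|h|h] := annulus_cases gp Gp g0 gG x; move/eqP: nz; case.
    by rewrite !glue_hole.
  by rewrite !glue_exterior.
have -> : supp2 (glue 0 b) (glue 0 (minus_d1 u)) = closure S by [].
rewrite [X in _ `<=` X](closure_id _).1; last exact: closed_closure.
apply: closureS => x rx; apply: contrapT => nS; apply: nr.
have NS : \forall y \near x, ~ S y.
  have := open_nbhs_nbhs (conj (closed_openC (@closed_closure _ S)) nS).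
  by apply: filterS => y h /subset_closure.
have NA := open_nbhs_nbhs (conj oA rx).
have N0 : \forall y \near x, a y = 0 /\ b y = 0.
  apply: filterS (filterI NS NA) => y [h ry]; move: h; rewrite /S /= !glue_annulus//.
  by move=> /negP; rewrite negbK /minus_d1 => /eqP [-> /eqP]; rewrite mulN1r oppr_eq0 => /eqP.
have uk := grad0_locally_const oA su rx N0.
(* Being defined by a local condition this set is open; it is relatively closed by
   [locally_const_closed], so it contains the whole annulus. *)
pose W : set P2 := [set y | \forall z \near y, u z = u x].
have oW : open W.
  by rewrite openE => y; exact: nbhs_interior.
exists (fun _ => u x) => y ry.
have : W y.
  apply: (annulus_connected gc Gc gp Gp g0 gG oW _ rx ry uk) => z.
  exact: (locally_const_closed oA su).
exact: nbhs_singleton.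
Qed.

Lemma gevrey_flow (k : R) x : annulus x -> exists r : R, [/\ 0 < r, box x r `<=` annulus,
  gevrey (box x r) b, gevrey (box x r) (minus_d1 u) & gevrey (box x r) (pressure mu u k)].
Proof.
move=> rx; have [r [r0 rA uG]] := sol_gevrey oA su rx; exists r.
have oB := @box_open R x r; have [aG bG] := gevrey_derive uG.
have cG (c : R) := gevrey_cst c oB.
split => //; first exact: (gevreyM oB (cG (-1)) aG).
exact: (gevreyD oB (gevreyM oB (cG (- 2^-1)) (gevreyD oB (gevreyM oB aG aG) (gevreyM oB bG bG)))
  (gevreyM oB (cG (- (mu / 2))) (gevreyD oB (gevreyM oB uG uG) (cG (- k ^+ 2))))).
Qed.

Lemma glue_analytic c (f : P2 -> R) : (forall x, annulus x -> exists r : R, [/\ 0 < r, box x r `<=` annulus &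
  gevrey (box x r) f]) -> analytic2_on annulus (glue c f).
Proof.
move=> h; apply: gevrey_analytic => x /h[r [r0 rA fG]]; exists r; split => //.
apply: (gevrey_ext (@box_open R x r) _ fG) => y /rA ry; by rewrite glue_annulus.
Qed.

Lemma annulus_flow : exists v1 v2 p : P2 -> R,
  [/\ continuous v1 /\ continuous v2 /\ continuous p,
      compactly_supported v1 /\ compactly_supported v2 /\ compactly_supported p,
      stationary_weak_euler v1 v2 p,
      supp2 v1 v2 = closure annulus &
      [/\ analytic2_on annulus v1, analytic2_on annulus v2 & analytic2_on annulus p]].
Proof.
have [M gM] := radii_bounded.
have gK s t := lipschitz_of_derive dg (fun t => let: And4 _ _ h _ := gM t in h) s t.
have GK s t := lipschitz_of_derive dG (fun t => let: And4 _ _ _ h := gM t in h) s t.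
pose ci := u (opol (g 0) 0); pose co := u (opol (G 0) 0).
have limi := boundary_value (or_introl (conj erefl erefl)) dg dG (ex_intro _ M gM).
have limo : forall z, curve G z -> u y @[y --> within annulus (nbhs z)] --> co.
  apply: (boundary_value (or_intror (conj erefl erefl)) dG dg); exists M => t.
  by have [h1 h2 h3 h4] := gM t.
have [L L0 [_ cs]] := glue_csupp Gc gp Gp g0 gG.
exists (glue 0 b), (glue 0 (minus_d1 u)), (glue (- (mu / 2) * (ci ^+ 2 - co ^+ 2)) (pressure mu u co)).
split.
- have [h1 h2] := velocity_continuous gc Gc gp Gp g0 gG su lima limb.
  split; [exact: h1|split; [exact: h2|]].
  exact: (pressure_continuous gc Gc gp Gp g0 gG su lima limb limi limo).
- by split; [|split]; apply: (csupp_compactly_supported (cs _ _)).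
- apply: (euler_flow gc Gc gp Gp g0 gG _ _ su lima limb limi limo).
    by move=> s t _ _; exact: gK.
  by move=> s t _ _; exact: GK.
- exact: velocity_support.
- split; apply: glue_analytic => x /(gevrey_flow co)[r [r0 rA h1 h2 h3]]; by exists r.
Qed.

End Flow.

Unset Implicit Arguments.

Theorem theorem1p3 (R : realType) (a s : R) (b B : R -> R) (mu : R)
    (u : R * R -> R) :
  0 < a < 1 ->
  analytic_on_T b -> analytic_on_T B ->
  (forall th : R, 0 < a + s * b th < 1 + s * B th) ->
  overdetermined_sol (polar_domain a s b B) mu u ->
  ~ radial_on (polar_domain a s b B) u ->
  exists v1 v2 p : R * R -> R,
    [/\ continuous v1 /\ continuous v2 /\ continuous p,
        compactly_supported v1 /\ compactly_supported v2 /\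
          compactly_supported p,
        stationary_weak_euler v1 v2 p,
        supp2 v1 v2 = closure (polar_domain a s b B) &
        [/\ analytic2_on (polar_domain a s b B) v1,
            analytic2_on (polar_domain a s b B) v2 &
            analytic2_on (polar_domain a s b B) p]].
Proof.
move=> _ ab aB ord ou nr.
pose g (t : R) := a + s * b t; pose G (t : R) := 1 + s * B t.
(* The requirement [0 < r] in [polar_domain] follows from the positivity of the inner radius. *)
have E : polar_domain a s b B = annulus g G.
  apply/seteqP; split => x.
    move=> [r [t [-> [r0 [h1 h2]]]]]; exists r, t; split; [exact: ltW|by rewrite /pol /= !add0r|].
    by rewrite h1 h2.
  move=> [r [t [_ -> /andP[h1 h2]]]]; exists r, t; split; first by rewrite /pol /= !add0r.
  by split => //; apply: lt_trans h1; case/andP: (ord t).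
rewrite E in ou nr *; have [b' b'c db] := analytic_C1 ab; have [B' B'c dB] := analytic_C1 aB.
have d (k : R) (f f' : R -> R) : (forall t : R, is_derive t (1 : R) f (f' t)) ->
    forall t : R, is_derive t (1 : R) (fun t => k + s * f t) (s * f' t).
  by move=> df t; apply: (is_derive_eq (derD (derC t 1 k) (derZ s (df t)))); rewrite add0r.
have c (f : R -> R) : continuous f -> continuous (fun t => s * f t).
  by move=> fc t; apply: cvgM; [exact: cvg_cst|exact: fc].
apply: (annulus_flow (d a _ _ db) (d 1 _ _ dB) (c _ b'c) (c _ B'c) _ _ _ _ ou nr).
- by move=> t; rewrite /g ab.1.
- by move=> t; rewrite /G aB.1.
- by move=> t; case/andP: (ord t).
- by move=> t; case/andP: (ord t).
Qed.
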